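(* Let $X$ be a standard Gaussian in $H$, let $(\mathcal T,\mu)$ be a standard probability space, and let $Y$ be a randomized shift defined on $(\mathcal T,\mu)$. For every $n\in\mathbb N$ there is a probability measure $\mu_n'$ on $\mathcal T$ equivalent to $\mu$ such that: under $\mu_n'$ all $\langle Y,\xi\rangle$, $\xi\in H$, have finite absolute $n$-th moment and the symmetric tensor $\mathbb E_{\mu_n'}Y^{\otimes n}$ is Hilbert–Schmidt; the quadratic form $$f\mapsto\Big\|\int f(t)Y(t)\,\mu_n'(dt)\Big\|^2$$ is well-defined on $L^2(\mu_n')$ and Hilbert–Schmidt, so that there exists a unique symmetric function $K\in L^2(\mu_n'\otimes\mu_n')$ such that $$\Big\|\int f(t)Y(t)\,\mu_n'(dt)\Big\|^2=\int K(t,s)f(t)f(s)\,\mu_n'(dt)\mu_n'(ds)$$ for all $f\in L^2(\mu_n')$; and moreover $$\int\big(K(t,s)\big)^n\,\mu_n'(dt)\mu_n'(ds)<\infty.$$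
   Context: $H$ is a separable infinite-dimensional real Hilbert space with a fixed orthonormal basis $(e_n)$; $(\Omega,\mathcal F,\mathbb P)$ is a standard probability space. $L^0(\mathcal T,\mu)$ is the space of $\mu$-equivalence classes of real measurable functions with the topology of convergence in measure. A generalized $H$-valued function on $(\mathcal T,\mu)$ is a continuous linear operator $Y:H\to L^0(\mathcal T,\mu)$, $\xi\mapsto\langle Y,\xi\rangle$; $\langle Y(t),\xi\rangle$ denotes the value of $\langle Y,\xi\rangle$ at $t$. If defined on $(\Omega,\mathbb P)$ it is called a generalized random vector. $Y(t)$ is identified with $(\langle Y(t),e_n\rangle)_n\in\mathbb R^\infty$. A standard Gaussian $X$ in $H$ is a generalized random vector on $(\Omega,\mathbb P)$ such that each $\langle X,\xi\rangle$ is centered Gaussian with variance $\|\xi\|^2$. A generalized $H$-valued function $Y$ on $(\mathcal T,\mu)$ is a randomized shift if $\mathrm{Law}_{\mathbb P\otimes\mu}[X+Y]\ll\mathrm{Law}_{\mathbb P}[X]$, where $\mathrm{Law}_{\mathbb P\otimes\mu}[X+Y]$ is the push-forward of $\mathbb P\otimes\mu$ under $(\omega,t)\mapsto X(\omega)+Y(t)\in\mathbb R^\infty$. If $f\langle Y,\xi\rangle\in L^1(\nu)$ for all $\xi\in H$, the vector $\int f(t)Y(t)\,\nu(dt)\in H$ is defined weakly: $\langle\int fY\,d\nu,\xi\rangle=\int f(t)\langle Y(t),\xi\rangle\,\nu(dt)$. A quadratic form on $L^2(\nu)$ is Hilbert–Schmidt if the associated bounded self-adjoint operator on $L^2(\nu)$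 is Hilbert–Schmidt. That $\mathbb E_{\mu_n'}Y^{\otimes n}$ is Hilbert–Schmidt means that the symmetric $n$-linear form $(\xi_1,\dots,\xi_n)\mapsto\mathbb E_{\mu_n'}\big[\langle Y,\xi_1\rangle\cdots\langle Y,\xi_n\rangle\big]$ is represented by an element of the Hilbert tensor power $H^{\otimes n}$, i.e. $\sum_{i_1,\dots,i_n}\big(\mathbb E_{\mu_n'}[\langle Y,e_{i_1}\rangle\cdots\langle Y,e_{i_n}\rangle]\big)^2<\infty$. *)

(* Defs.v *)
From HB Require Import structures.
From mathcomp Require Import all_boot all_order all_algebra.
From mathcomp Require Import all_classical all_reals all_analysis.

Set Implicit Arguments.
Unset Strict Implicit.
Unset Printing Implicit Defensive.

Import Order.TTheory GRing.Theory Num.Theory.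
Import numFieldNormedType.Exports.

Local Open Scope classical_set_scope.
Local Open Scope ring_scope.

Section StandardProbabilitySpace.
Context (R : realType).

(* [f] pulls back measurable sets to sets of the [P]-completion, preserving the
   measure; [f] is only relevant on the set [A], which will be conegligible. *)
Definition measure_preserving_mod0 d d' (T : measurableType d)
    (U : measurableType d') (P : probability T R) (Q : probability U R)
    (A : set T) (f : T -> U) : Prop :=
  forall C : set U, measurable C ->
    exists D : set T, [/\ measurable D,
      P.-negligible ((A `&` f @^-1` C) `+` D) & P D = Q C].

Definition isomorphic_mod0 d d' (T : measurableType d)
    (U : measurableType d') (P : probability T R) (Q : probability U R) : Prop :=
  exists (A : set T) (B : set U) (f : T -> U) (g : U -> T),
    [/\ P.-negligible (~` A) /\ Q.-negligible (~` B),
        {homo f : x / A x >-> B x} /\ {homo g : y / B y >-> A y},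
        (forall x, A x -> g (f x) = x) /\ (forall y, B y -> f (g y) = y),
        measure_preserving_mod0 P Q A f
      & measure_preserving_mod0 Q P B g].

(* Lebesgue-Rokhlin: up to null sets and completion, an interval with Lebesgue
   measure together with at most countably many atoms.  The interval is [0, c]
   and the k-th atom, of mass [w k] (possibly 0), sits at -(k + 1). *)
Definition standard_probability d (T : measurableType d)
    (P : probability T R) : Prop :=
  exists (c : R) (w : nat -> R) (Q : probability (measurableTypeR R) R),
    [/\ 0 <= c, forall k, 0 <= w k,
        forall A : set (measurableTypeR R), measurable A ->
          Q A = (lebesgue_measure (A `&` `[0, c]%classic%R)
                 + \sum_(0 <= k <oo) (w k)%:E * \d_(- k.+1%:R : measurableTypeR R)%R A)%E
      & isomorphic_mod0 P Q].

End StandardProbabilitySpace.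

Section HilbertSpace.
Context (R : realType) (H : completeNormedModType R) (dot : {dot H for idfun}).

Definition hilbert_norm : Prop := forall x : H, dot x x = `|x| ^+ 2.

Definition orthonormal_basis (e : nat -> H) : Prop :=
  (forall i j, dot (e i) (e j) = (i == j)%:R) /\
  (forall x, series (fun k => dot x (e k) *: e k) @ \oo --> x).

End HilbertSpace.

(* L^0(T, mu); an element coerces to a representative. *)
Definition L0 d (T : measurableType d) (R : realType)
    (mu : {measure set T -> \bar R}) : Type :=
  {mfun_ mu, T >-> measurableTypeR R}.

Definition L0_fun d (T : measurableType d) (R : realType)
    (mu : {measure set T -> \bar R}) (u : L0 mu) : T -> R :=
  aqEqMfun_to_fun u.
Coercion L0_fun : L0 >-> Funclass.

Section GeneralizedFunctions.
Context (R : realType) (H : completeNormedModType R).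

(* Continuous linear operators H -> L^0(T, mu), for convergence in measure. *)
Definition generalized_function d (T : measurableType d)
    (mu : probability T R) (Y : H -> L0 mu) : Prop :=
  (forall (a : R) (x y : H),
      L0_fun (Y (a *: x + y)) = (fun t => a * Y x t + Y y t) %[ae mu]) /\
  (forall (x : H) (eps : R), 0 < eps ->
      mu [set t | eps <= `|Y y t - Y x t|] @[y --> x] --> (0 : \bar R)).

(* Law of a centered Gaussian variable of standard deviation [s]; the library's
   [normal_prob m 0] is not the Dirac mass at [m]. *)
Definition centered_gaussian_law (s : R) : set (measurableTypeR R) -> \bar R :=
  if s == 0 then \d_(0 : measurableTypeR R) else normal_prob 0 s.

Definition standard_gaussian d (W : measurableType d)
    (P : probability W R) (X : H -> L0 P) : Prop :=
  generalized_function X /\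
  (forall (x : H) (A : set (measurableTypeR R)), measurable A ->
      pushforward P (X x) A = centered_gaussian_law `|x| A).

(* R^oo with its product (cylinder) sigma-algebra. *)
Definition Rinfty_cylinders : set (set (nat -> R)) :=
  [set C | exists k (B : set (measurableTypeR R)),
      measurable B /\ C = [set u | B (u k)]].
Definition Rinfty := g_sigma_algebraType Rinfty_cylinders.

Definition coordinates (e : nat -> H) d (T : measurableType d)
    (mu : probability T R) (Y : H -> L0 mu) (t : T) : nat -> R :=
  fun k => Y (e k) t.

Definition randomized_shift (e : nat -> H)
    dW (W : measurableType dW) (P : probability W R) (X : H -> L0 P)
    dT (T : measurableType dT) (mu : probability T R) (Y : H -> L0 mu) : Prop :=
  generalized_function Y /\
  pushforward (P \x mu)%E
    (fun z : W * T => coordinates e X z.1 \+ coordinates e Y z.2 : Rinfty)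
  `<< pushforward P (coordinates e X : W -> Rinfty).

End GeneralizedFunctions.

Section HilbertSchmidtForms.
Context (R : realType) d (T : measurableType d) (nu : {measure set T -> \bar R}).

(* Elements of L^2(nu) are handled through representatives. *)
Local Notation L2 := (Lfun nu 2%:E).

Definition L2dot (f g : T -> R) : R := \int[nu]_t (f t * g t).

Definition L2_bounded_operator (A : (T -> R) -> (T -> R)) : Prop :=
  [/\ forall f, f \in L2 -> A f \in L2,
      forall (a : R) f g, f \in L2 -> g \in L2 ->
        A (fun t => a * f t + g t) = (fun t => a * A f t + A g t) %[ae nu]
    & exists C : R, forall f, f \in L2 ->
        L2dot (A f) (A f) <= C * L2dot f f].

Definition L2_self_adjoint (A : (T -> R) -> (T -> R)) : Prop :=
  forall f g, f \in L2 -> g \in L2 -> L2dot (A f) g = L2dot f (A g).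

Definition L2_orthonormal_basis (B : set (T -> R)) : Prop :=
  [/\ forall f, B f -> f \in L2,
      forall f g, B f -> B g -> L2dot f g = (f == g)%:R
    & forall f, f \in L2 -> (forall b, B b -> L2dot f b = 0) ->
        f = cst 0 %[ae nu]].

Definition L2_hilbert_schmidt_operator (A : (T -> R) -> (T -> R)) : Prop :=
  exists2 B, L2_orthonormal_basis B
    & (\esum_(b in B) (L2dot (A b) (A b))%:E < +oo)%E.

Definition L2_hilbert_schmidt_form (q : (T -> R) -> R) : Prop :=
  exists A, [/\ L2_bounded_operator A, L2_self_adjoint A,
                forall f, f \in L2 -> q f = L2dot (A f) f
              & L2_hilbert_schmidt_operator A].

End HilbertSchmidtForms.

Section WeakIntegral.
Context (R : realType) (H : completeNormedModType R) (dot : {dot H for idfun}).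
Context d (T : measurableType d) (mu : probability T R) (Y : H -> L0 mu).
Context (nu : probability T R).

Definition weakly_integrable (f : T -> R) : Prop :=
  forall x : H, nu.-integrable setT (fun t => (f t * Y x t)%:E).

Definition is_weak_integral (f : T -> R) (v : H) : Prop :=
  forall x : H, dot v x = \int[nu]_t (f t * Y x t).

(* Meaningful when [f] is weakly integrable and the vector exists. *)
Definition weak_integral (f : T -> R) : H := xget 0 (is_weak_integral f).

(* E_nu Y^(tensor n) belongs to the Hilbert tensor power of H. *)
Definition hilbert_schmidt_moment (e : nat -> H) (n : nat) : Prop :=
  (\esum_(i in [set: n.-tuple nat])
      ('E_nu[fun t => (\prod_(k < n) Y (e (tnth i k)) t)%R]) ^+ 2 < +oo)%E.

End WeakIntegral.

Section Kernel.
Context (R : realType) d (T : measurableType d) (nu : probability T R).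

Definition L2_symmetric_kernel (K : T * T -> R) : Prop :=
  K \in Lfun (nu \x nu)%E 2%:E /\
  K = (fun z => K (z.2, z.1)) %[ae (nu \x nu)%E].

Definition kernel_represents (K : T * T -> R) (q : (T -> R) -> R) : Prop :=
  forall f, f \in Lfun nu 2%:E ->
    (q f)%:E = (\int[nu \x nu]_z (K z * f z.1 * f z.2)%:E)%E.

End Kernel.

(* Main.v *)
Require Import Defs.
From HB Require Import structures.
From mathcomp Require Import all_boot all_order all_algebra.
From mathcomp Require Import all_classical all_reals all_analysis.
From mathcomp Require Import measurable_realfun ring lra.

Set Implicit Arguments.
Unset Strict Implicit.
Unset Printing Implicit Defensive.

Import Order.TTheory GRing.Theory Num.Theory.
Import numFieldNormedType.Exports.

Local Open Scope classical_set_scope.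
Local Open Scope ring_scope.

(** The kernel is [K(t, s) = <Y(t), Y(s)> = sum_k Y_k(t) Y_k(s)] with
    [Y_k = <Y, e_k>].  Each claim about it, and about the moments of [Y], comes
    from one property of the new measure [nu], required for the orders
    [r = 1, 2, n, 2n]: the map
    [a |-> sum_i a_i Y_(i_1) ... Y_(i_r)] is bounded from [l^2] to [L^2(nu)]
    ([tensor_bounded]).

    The measure.  Let [D] be the density of [Law(X + Y)] with respect to
    [Law(X)] and [w = 1 / (1 + D)]; then [E w(X + Y) F(X + Y) <= E F(X)] for all
    [F >= 0] ([shift_weight]).  Fix an order [k].  By rotation invariance,
    white noise is the normalized mean [k^(-1/2) sum_j B^j] of [k] independent
    copies of itself, and shifting it by [Y] amounts to shifting each [B^j] by
    [k^(-1/2) Y].  The decoupled form [sum_i a_i B^1_(i_1) ... B^k_(i_k)] has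
    second moment at most a constant times [sum_i a_i^2], since its monomials
    are orthogonal.  Evaluate it at [B^j + k^(-1/2) Y] and average over the
    signs of the [B^j]: only [k^(-k/2) sum_i a_i Y_(i_1) ... Y_(i_k)] is left.
    A change of signs preserves the law of the [B^j].  So if [g] is the mean over
    [B] of the product, over all sign patterns, of [w] at the shifted mean, then
    [g > 0] and the integral of [g (sum_i a_i Y_(i_1) ... Y_(i_k))^2] is at most
    [C sum_i a_i^2] ([shift_moment_weight]).  The product of the [g] for all
    orders up to a bound, normalized, is the density of [nu]
    ([exists_tensor_bounded]).  Laws on sequence space are compared by their
    Fourier transforms ([Rinfty_law_unique]).

    The consequences.  By duality, boundedness in order [r] gives
    [sum_i (E Y_(i_1) ... Y_(i_r))^2 < oo], which is the Hilbert-Schmidt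
    property of the moment tensor.  Expanding the [r]-th power of a partial sum
    of [<Y, x> = sum_k x_k Y_k] bounds the moments of [<Y, x>]
    ([evaluation_moment_le]).  For [r = 1] the functional
    [x |-> int f <Y, x>] is bounded, so the weak integral exists
    ([riesz_representation]), and the form is that of the self-adjoint operator
    [f |-> <Y, int f Y>].  Bessel's inequality for the sections of the partial
    kernels [K_m = sum_(k < m) Y_k(t) Y_k(s)] bounds its Hilbert-Schmidt norm
    ([partial_kernel_bessel]).  The [K_m] are Cauchy in [L^2(nu x nu)], and a
    subsequence converges to [K] also almost everywhere ([exists_kernel]).  As
    [int K_m^(2n)] is the sum of [(E Y_(i_1) ... Y_(i_(2n)))^2] over the tuples
    with entries below [m], Fatou's lemma gives [int K^(2n) < oo].  The kernel
    is unique because polarization on indicator functions determines its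
    integral over every rectangle ([kernel_unique]). *)

(** * Gaussian convolutions and moments *)

(** The explicit density is almost everywhere the Radon-Nikodym derivative. *)
Lemma integral_density (d : measure_display) (T : measurableType d) (R : realType)
    (mu : {sigma_finite_measure set T -> \bar R})
    (nu : {finite_measure set T -> \bar R}) (g : T -> R) :
  measurable_fun setT g -> (forall t, 0 <= g t) ->
  (forall A, measurable A -> nu A = \int[mu]_(t in A) (g t)%:E)%E ->
  forall f : T -> \bar R, (forall t, 0 <= f t)%E -> measurable_fun setT f ->
  (\int[nu]_t f t = \int[mu]_t (f t * (g t)%:E))%E.
Proof.
move=> mg g0 nuE f f0 mf.
have numu : nu `<< mu.
  apply/null_content_dominatesP => A mA muA; rewrite nuE//.
  by apply: null_set_integral => //; apply: measurable_funTS; apply/measurable_EFinP.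
rewrite -(Radon_Nikodym_SigmaFinite.change_of_variables numu)//.
apply: ge0_ae_eq_integral => //.
- apply: emeasurable_funM => //.
  exact: measurable_int (Radon_Nikodym_SigmaFinite.f_integrable _).
- by apply: emeasurable_funM => //; apply/measurable_EFinP.
- by move=> x _; apply: mule_ge0 => //; exact: Radon_Nikodym_SigmaFinite.f_ge0.
- by move=> x _; apply: mule_ge0 => //; rewrite lee_fin.
- have : ae_eq mu setT (Radon_Nikodym_SigmaFinite.f nu mu) (EFin \o g).
    apply: integral_ae_eq => //.
    + exact: Radon_Nikodym_SigmaFinite.f_integrable.
    + exact/measurable_EFinP.
    + by move=> E _ mE; rewrite -nuE// -Radon_Nikodym_SigmaFinite.f_integral.
  by apply: filterS => x /= /(_ I) ->.
Qed.

(** Completion of the square in [u]. *)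
Lemma normal_pdf_conv (R : realType) (a b z u : R) : a != 0 -> b != 0 ->
  let c := Num.sqrt (a ^+ 2 + b ^+ 2) in
  normal_pdf 0 b (z - u) * normal_pdf 0 a u =
  normal_pdf 0 c z * normal_pdf (z * a ^+ 2 / c ^+ 2) (a * b / c) u.
Proof.
move=> a0 b0 c.
have a2 : 0 < a ^+ 2 by rewrite exprn_even_gt0.
have b2 : 0 < b ^+ 2 by rewrite exprn_even_gt0.
have c2 : c ^+ 2 = a ^+ 2 + b ^+ 2 by rewrite sqr_sqrtr// addr_ge0// ltW.
have c0 : c != 0 by rewrite gt_eqF// sqrtr_gt0 addr_gt0.
have t0 : a * b / c != 0 by rewrite !mulf_neq0 ?invr_neq0.
rewrite !normal_pdfE//= mulrACA [RHS]mulrACA; congr (_ * _).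
  have h (r : R) : 0 <= r ^+ 2 * pi *+ 2 by apply: mulrn_wge0; apply: mulr_ge0; [exact: sqr_ge0|exact: pi_ge0].
  rewrite /normal_peak -!invfM -sqrtrM ?h// -[in RHS]sqrtrM ?h//.
  congr (Num.sqrt _)^-1.
  move: c0 {t0 c2}; clearbody c; move: (pi : R) => p c0.
  field; exact: c0.
rewrite /normal_fun -!expRD; congr expR.
rewrite !exprMn exprVn c2; field.
by rewrite a0 b0 !andbT gt_eqF// addr_gt0.
Qed.

Lemma integral_normal_prob (R : realType) (s : R) (f : R -> R) :
  measurable_fun setT f -> (forall x, 0 <= f x) ->
  (\int[normal_prob 0 s]_x (f x)%:E =
   \int[lebesgue_measure]_x (f x * normal_pdf 0 s x)%:E)%E.
Proof.
move=> mf f0.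
rewrite (@integral_density _ _ _ lebesgue_measure (normal_prob 0 s) (normal_pdf 0 s))//.
- exact: measurable_normal_pdf.
- exact: normal_pdf_ge0.
- exact/measurable_EFinP.
Qed.

Lemma integral_shift (R : realType) (f : R -> R) (u : R) : continuous f -> (forall x, 0 <= f x) ->
  (\int[lebesgue_measure]_x (f (u + x))%:E = \int[lebesgue_measure]_x (f x)%:E)%E.
Proof.
move=> cf f0.
have dF : (fun x : R => u + x)^`()%classic = cst 1.
  by apply/funext => x; rewrite derive1E deriveD// derive_cst derive_id add0r.
rewrite (@increasing_ge0_integration_by_substitutionT _ (fun x => u + x) f)//.
- by apply: eq_integral => x _; rewrite dF /= fctE mulr1.
- by move=> x y xy; rewrite ltrD2l.
- by rewrite dF; exact: cst_continuous.
- by rewrite dF; exact: is_cvg_cst.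
- by rewrite dF; exact: is_cvg_cst.
- under eq_fun do rewrite addrC; exact: cvg_addrr_Ny.
- under eq_fun do rewrite addrC; exact: cvg_addrr.
Qed.

(** For a fixed sum [z], the product density is by [normal_pdf_conv] a multiple
    of a normal density in [u], which integrates to 1. *)
Lemma normal_convolution (R : realType) (f : R -> R) (a b : R) :
  a != 0 -> b != 0 -> continuous f -> (forall x, 0 <= f x) ->
  (\int[normal_prob 0 a]_u \int[normal_prob 0 b]_v (f (u + v))%:E =
   \int[normal_prob 0 (Num.sqrt (a ^+ 2 + b ^+ 2))]_z (f z)%:E)%E.
Proof.
move=> a0 b0 cf f0; set c := Num.sqrt _.
have conv z u := normal_pdf_conv z u a0 b0.
rewrite /= -/c in conv; clearbody c.
have fp (x : R) : 0 <= f x * normal_pdf 0 c x by rewrite mulr_ge0// normal_pdf_ge0.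
have mf : measurable_fun setT f by exact: continuous_measurable_fun.
have mN m s : measurable_fun setT (normal_pdf m s : R -> R) by exact: measurable_normal_pdf.
have mS (u : R) : measurable_fun setT (fun v => f (u + v)).
  by apply: measurableT_comp => //; exact: measurable_funD.
have inner u : (\int[normal_prob 0 b]_v (f (u + v))%:E =
    \int[lebesgue_measure]_z (f z * normal_pdf 0 b (z - u))%:E)%E.
  rewrite (@integral_normal_prob _ b _ (mS u) (fun x => f0 (u + x))).
  rewrite -(@integral_shift _ (fun z => f z * normal_pdf 0 b (z - u)) u).
  - by apply: eq_integral => x _; rewrite addrAC subrr add0r.
  - move=> x; apply: cvgM; first exact: cf.
    apply: (@continuous_comp _ _ _ (fun z => z - u) (normal_pdf 0 b)).
      by apply: cvgB; [exact: cvg_id|exact: cvg_cst].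
    exact: continuous_normal_pdf.
  - by move=> x; rewrite mulr_ge0 ?normal_pdf_ge0.
pose h (p : R * R) := (f p.2 * normal_pdf 0 b (p.2 - p.1) * normal_pdf 0 a p.1)%R.
have mh : measurable_fun setT (h : measurableTypeR R * measurableTypeR R -> R).
  apply: measurable_funM; [apply: measurable_funM|].
  - exact: measurableT_comp.
  - by apply: measurableT_comp => //; exact: measurable_funB.
  - exact: measurableT_comp.
have h0 p : 0 <= h p by rewrite /h !mulr_ge0 ?normal_pdf_ge0.
have mI : measurable_fun setT (fun u : R => \int[normal_prob 0 b]_v (f (u + v))%:E)%E.
  under eq_fun do rewrite inner.
  apply: (@measurable_fun_fubini_tonelli_F _ _ _ _ _ _ (fun p : measurableTypeR R * measurableTypeR R => (f p.2 * normal_pdf 0 b (p.2 - p.1))%:E)).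
  - apply/measurable_EFinP/measurable_funM; first exact: measurableT_comp.
    by apply: measurableT_comp => //; exact: measurable_funB.
  - by move=> p; rewrite lee_fin mulr_ge0 ?normal_pdf_ge0.
rewrite (@integral_density _ _ _ lebesgue_measure (normal_prob 0 a) (normal_pdf 0 a) (mN 0 a) (@normal_pdf_ge0 _ 0 a) (fun _ _ => erefl) (fun u => \int[normal_prob 0 b]_v (f (u + v))%:E)%E _ mI); last first.
  by move=> u; apply: integral_ge0 => v _; rewrite lee_fin.
transitivity (\int[lebesgue_measure]_u \int[lebesgue_measure]_z (h (u, z))%:E)%E.
  apply: eq_integral => u _; rewrite inner muleC -ge0_integralZl_EFin//.
  - by apply: eq_integral => z _; rewrite -EFinM mulrC.
  - by move=> z _; rewrite lee_fin mulr_ge0 ?normal_pdf_ge0.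
  - apply/measurable_EFinP/measurable_funM => //.
    by apply: measurableT_comp => //; exact: measurable_funB.
  - exact: normal_pdf_ge0.
have tn := @fubini_tonelli _ _ _ _ _ (@lebesgue_measure R) (@lebesgue_measure R) (EFin \o h).
etransitivity.
  by apply: tn; [exact/measurable_EFinP|move=> p; rewrite /= lee_fin].
rewrite (@integral_normal_prob _ c _ mf f0); apply: eq_integral => z _.
transitivity (\int[lebesgue_measure]_u ((f z * normal_pdf 0 c z)%:E * (normal_pdf (z * a ^+ 2 / c ^+ 2) (a * b / c) u)%:E))%E.
  apply: eq_integral => u _; congr EFin.
  by rewrite /= /h /= -mulrA conv mulrA.
etransitivity.
  apply: (@ge0_integralZl_EFin _ _ _ lebesgue_measure _ measurableT).
  - by move=> u _; rewrite lee_fin normal_pdf_ge0.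
  - exact: measurable_int (integrable_normal_pdf _ _).
  - exact: fp.
by rewrite integral_normal_pdf mule1.
Qed.

Lemma integrableRZ (d : measure_display) (T : measurableType d) (R : realType)
    (mu : {measure set T -> \bar R}) (c : R) (f : T -> R) :
  mu.-integrable setT (EFin \o f) -> mu.-integrable setT (EFin \o (fun x => c * f x)).
Proof.
move=> fi; have := integrableZl measurableT c fi.
by apply: eq_integrable => // x _; rewrite /= EFinM.
Qed.

Lemma integrableRD (d : measure_display) (T : measurableType d) (R : realType)
    (mu : {measure set T -> \bar R}) (f g : T -> R) :
  mu.-integrable setT (EFin \o f) -> mu.-integrable setT (EFin \o g) ->
  mu.-integrable setT (EFin \o (fun x => f x + g x)).
Proof.
move=> fi gi; have := integrableD measurableT fi gi.
by apply: eq_integrable => // x _; rewrite /= EFinD.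
Qed.

Lemma integrableR_sum (d : measure_display) (T : measurableType d) (R : realType)
    (mu : {measure set T -> \bar R}) (I : Type) (s : seq I) (f : I -> T -> R) :
  (forall i, mu.-integrable setT (EFin \o f i)) ->
  mu.-integrable setT (EFin \o (fun x => \sum_(i <- s) f i x)).
Proof.
move=> fi; elim: s => [|i s IH].
  by under eq_fun do rewrite big_nil; exact: integrable0.
by under eq_fun do rewrite big_cons; exact: integrableRD.
Qed.

Lemma Rintegral_sum (d : measure_display) (T : measurableType d) (R : realType)
    (mu : {measure set T -> \bar R}) (I : Type) (s : seq I) (f : I -> T -> R) :
  (forall i, mu.-integrable setT (EFin \o f i)) ->
  \int[mu]_x (\sum_(i <- s) f i x) = \sum_(i <- s) \int[mu]_x f i x.
Proof.
move=> fi; elim: s => [|i s IH].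
  rewrite big_nil (_ : (fun x => _) = cst 0); last by apply/funext => x; rewrite big_nil.
  by rewrite Rintegral_cst// mul0r.
rewrite big_cons -IH -RintegralD//; last exact: integrableR_sum.
by apply: eq_Rintegral => x _; rewrite big_cons.
Qed.

Lemma measurable_L0 (d : measure_display) (T : measurableType d) (R : realType)
    (mu : {measure set T -> \bar R}) (u : L0 mu) : measurable_fun setT (u : T -> R).
Proof. exact: (@measurable_funPT _ _ _ _ (repr (u : aeEqMfun _ _))). Qed.

Lemma integrable_bounded (d : measure_display) (T : measurableType d) (R : realType)
    (mu : {finite_measure set T -> \bar R}) (f : T -> R) (M : R) :
  measurable_fun setT f -> (forall x, `|f x| <= M) -> mu.-integrable setT (EFin \o f).
Proof.
move=> mf fM; apply: measurable_bounded_integrable => //.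
  by rewrite ltey_eq fin_num_measure.
by exists M; split; [exact: num_real|] => x xM t _ /=; rewrite (le_trans (fM t))// ltW.
Qed.

Lemma EFin_Rintegral (d : measure_display) (T : measurableType d) (R : realType)
    (mu : {measure set T -> \bar R}) (f : T -> R) :
  mu.-integrable setT (EFin \o f) ->
  ((\int[mu]_x f x)%:E = \int[mu]_x (f x)%:E)%E.
Proof. by move=> fi; rewrite /Rintegral fineK//; apply: integrable_fin_num. Qed.

Lemma Rintegral_ae_eq (d : measure_display) (T : measurableType d) (R : realType)
    (mu : {measure set T -> \bar R}) (f g : T -> R) :
  measurable_fun setT f -> measurable_fun setT g -> f = g %[ae mu] ->
  \int[mu]_x f x = \int[mu]_x g x.
Proof.
move=> mf mg fg; rewrite /Rintegral; congr fine; apply: ae_eq_integral => //.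
- exact/measurable_EFinP.
- exact/measurable_EFinP.
- by apply: filterS fg => x /= /(_ I) -> _.
Qed.

Lemma measurable_cos_fun (d : measure_display) (T : measurableType d) (R : realType)
  (f : T -> R) : measurable_fun setT f -> measurable_fun setT (fun x => cos (f x)).
Proof.
move=> mf; apply: measurableT_comp => //.
by apply: continuous_measurable_fun; exact: continuous_cos.
Qed.

Lemma measurable_sin_fun (d : measure_display) (T : measurableType d) (R : realType)
  (f : T -> R) : measurable_fun setT f -> measurable_fun setT (fun x => sin (f x)).
Proof.
move=> mf; apply: measurableT_comp => //.
by apply: continuous_measurable_fun; exact: continuous_sin.
Qed.

Lemma normr_cos_le1 (R : realType) (x : R) : `|cos x| <= 1.
Proof. by rewrite ler_norml cos_geN1 cos_le1. Qed.

Lemma normr_sin_le1 (R : realType) (x : R) : `|sin x| <= 1.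
Proof. by rewrite ler_norml sin_geN1 sin_le1. Qed.

Lemma Rintegral_probability_cst (d : measure_display) (T : measurableType d) (R : realType)
    (P : probability T R) (c : R) : \int[P]_x c = c.
Proof. by rewrite Rintegral_cst//= probability_setT/= mulr1. Qed.

Lemma cvg_EFin_real (R : realType) (T : Type) (F : set_system T) (FF : Filter F)
    (u : T -> R) (l : R) :
  u n @[n --> F] --> l -> ((u n)%:E @[n --> F] --> l%:E)%E.
Proof. by move=> ul; apply/fine_cvgP; split; [exact: nearW|exact: ul]. Qed.

Lemma cvg_bounded_Rintegral (d : measure_display) (T : measurableType d) (R : realType)
    (P : probability T R) (f : nat -> T -> R) (g : T -> R) (M : R) :
  (forall n, measurable_fun setT (f n)) -> (forall n x, `|f n x| <= M) ->
  (forall x, f n x @[n --> \oo] --> g x) ->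
  \int[P]_x f n x @[n --> \oo] --> \int[P]_x g x.
Proof.
move=> mf fM fg.
have mg : measurable_fun setT g by apply: (measurable_fun_cvg (h := f)).
have gM x : `|g x| <= M.
  by apply: (cvgr_to_le (cvg_norm (fg x))); apply: nearW => n.
have gi : P.-integrable setT (EFin \o g) by exact: (@integrable_bounded _ _ _ P _ M).
apply: (@fine_cvg _ _ _ _ (fun n => \int[P]_x (f n x)%:E)%E).
rewrite fineK; last exact: integrable_fin_num.
apply: (@dominated_cvg _ _ _ P setT measurableT _ _ (fun=> M%:E)) => //.
- by move=> n; exact/measurable_EFinP.
- by move=> x _; apply: cvg_EFin_real; exact: fg.
- exact: finite_measure_integrable_cst.
- by move=> n x _; rewrite lee_fin.
Qed.

Section StandardGaussian.
Context (R : realType) (H : completeNormedModType R).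
Context (d : measure_display) (W : measurableType d) (P : probability W R).
Context (X : H -> L0 P) (hX : standard_gaussian X).

Lemma gaussian_ge0_integral (u : H) (f : R -> R) : u != 0 ->
  measurable_fun setT f -> (forall x, 0 <= f x) ->
  (\int[P]_w (f (X u w))%:E = \int[normal_prob 0 `|u|]_x (f x)%:E)%E.
Proof.
move=> u0 mf f0.
rewrite -(@ge0_integral_pushforward _ _ _ _ _ (X u : W -> measurableTypeR R) (measurable_L0 _) P setT (EFin \o f))//.
- apply: eq_measure_integral => A mA _; have := hX.2 u A mA.
  by rewrite /centered_gaussian_law normr_eq0 (negbTE u0).
- exact/measurable_EFinP.
- by move=> x _ /=; rewrite lee_fin.
Qed.

Lemma gaussian_ge0_integral_eq (u v : H) (f : R -> R) : `|u| = `|v| ->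
  measurable_fun setT f -> (forall x, 0 <= f x) ->
  (\int[P]_w (f (X u w))%:E = \int[P]_w (f (X v w))%:E)%E.
Proof.
move=> uv mf f0.
have e (w : H) := @ge0_integral_pushforward _ _ _ _ _ (X w : W -> measurableTypeR R) (measurable_L0 _) P setT (EFin \o f) measurableT.
rewrite -(e u); [|exact/measurable_EFinP|by move=> x _ /=; rewrite lee_fin].
rewrite -(e v); [|exact/measurable_EFinP|by move=> x _ /=; rewrite lee_fin].
apply: eq_measure_integral => A mA _.
by have := hX.2 v A mA; rewrite -uv -(hX.2 u A mA).
Qed.

Lemma gaussian_Rintegral_eq (u v : H) (f : R -> R) : `|u| = `|v| ->
  measurable_fun setT f -> (forall x, `|f x| <= 1) ->
  \int[P]_w f (X u w) = \int[P]_w f (X v w).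
Proof.
move=> uv mf f1.
have mfX (w : H) : measurable_fun setT (fun t => f (X w t)).
  by apply: measurableT_comp => //; exact: measurable_L0.
have fi (w : H) : P.-integrable setT (EFin \o (fun t => f (X w t))).
  by apply: (@integrable_bounded _ _ _ P _ 1).
have e (w : H) : (\int[P]_t (1 + f (X w t)) = 1 + \int[P]_t f (X w t))%R.
  rewrite RintegralD//; last by apply: finite_measure_integrable_cst.
  by rewrite Rintegral_probability_cst.
(* adding 1 makes the integrand nonnegative *)
apply: (@addrI _ 1%R); rewrite -!e /Rintegral; congr fine.
apply: (@gaussian_ge0_integral_eq u v (fun x => 1 + f x)) => //.
  exact: measurable_funD.
by move=> x; have := f1 x; rewrite ler_norml => /andP[h _]; rewrite -lerBlDl sub0r.
Qed.

Lemma gaussianN (u : H) : L0_fun (X (- u)) = (fun t => - X u t) %[ae P].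
Proof.
have [lin _] := hX.1.
have h0 := lin (-1) u u; rewrite scaleN1r addNr in h0.
have h1 := lin (-1) u 0; rewrite scaleN1r addr0 in h1.
apply: (filterS2 _ _ h0 h1) => x /= /(_ I) a /(_ I) b _.
by rewrite b a mulN1r addNr addr0.
Qed.

(** [X u] is symmetric and the sine is odd. *)
Lemma gaussian_sin (u : H) : \int[P]_w sin (X u w) = 0.
Proof.
have msin : measurable_fun setT (sin : R -> R).
  by apply: continuous_measurable_fun; exact: continuous_sin.
have h : \int[P]_w sin (X u w) = - \int[P]_w sin (X u w).
  rewrite -mulN1r -RintegralZl//; last first.
    apply: (@integrable_bounded _ _ _ P _ 1); last by move=> x; exact: normr_sin_le1.
    exact/measurable_sin_fun/measurable_L0.
  rewrite -(@gaussian_Rintegral_eq (- u) u) ?normrN//; last first.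
    by move=> x; exact: normr_sin_le1.
  apply: Rintegral_ae_eq.
  - exact/measurable_sin_fun/measurable_L0.
  - by apply: measurable_funM => //; exact/measurable_sin_fun/measurable_L0.
  - by apply: filterS (gaussianN u) => x /= /(_ I) -> _; rewrite sinN mulN1r.
lra.
Qed.

(** Multiplicativity along orthogonal sums, from the convolution of normal
    densities. *)
Lemma gaussian_cosM (u v w : H) : `|w| ^+ 2 = `|u| ^+ 2 + `|v| ^+ 2 ->
  \int[P]_t cos (X u t) * \int[P]_t cos (X v t) = \int[P]_t cos (X w t).
Proof.
move=> hw.
have mcos : measurable_fun setT (cos : R -> R).
  by apply: continuous_measurable_fun; exact: continuous_cos.
have E0 (z : H) : `|z| = 0 -> \int[P]_t cos (X z t) = 1.
  move=> z0; rewrite -[RHS](Rintegral_probability_cst P).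
  apply: Rintegral_ae_eq => //; first exact/measurable_cos_fun/measurable_L0.
  move/normr0_eq0 : z0 => ->.
  have := gaussianN 0; rewrite oppr0; apply: filterS => x /= /(_ I) h _.
  by rewrite (_ : X 0 x = 0) ?cos0//; lra.
have [u0|u0] := eqVneq u 0.
  rewrite (E0 u) ?u0 ?normr0// mul1r; apply: gaussian_Rintegral_eq => //.
    by apply: (@pexpIrn _ 2); rewrite ?nnegrE// hw u0 normr0 expr0n add0r.
  by move=> x; exact: normr_cos_le1.
have [v0|v0] := eqVneq v 0.
  rewrite (E0 v) ?v0 ?normr0// mulr1; apply: gaussian_Rintegral_eq => //.
    by apply: (@pexpIrn _ 2); rewrite ?nnegrE// hw v0 normr0 expr0n addr0.
  by move=> x; exact: normr_cos_le1.
have nu0 : `|u| != 0 by rewrite normr_eq0.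
have nv0 : `|v| != 0 by rewrite normr_eq0.
have nw : `|w| = Num.sqrt (`|u| ^+ 2 + `|v| ^+ 2) by rewrite -hw sqrtr_sqr normr_id.
have w0 : w != 0.
  by rewrite -normr_eq0 nw gt_eqF// sqrtr_gt0 addr_gt0// exprn_even_gt0.
(* the convolution formula is for nonnegative functions *)
pose f (x : R) : R := 1 + cos x.
have f0 x : 0 <= f x by rewrite /f; have := cos_geN1 x; lra.
have cf : continuous f by move=> x; apply: cvgD; [exact: cvg_cst|exact: continuous_cos].
have mf : measurable_fun setT f by exact: continuous_measurable_fun.
have conv := normal_convolution nu0 nv0 cf f0.
rewrite -nw -(gaussian_ge0_integral w0 mf f0) in conv.
have icos (a : R) (z : H) : P.-integrable setT (EFin \o (fun t => cos (a + X z t))).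
  apply: (@integrable_bounded _ _ _ P _ 1); last by move=> x; exact: normr_cos_le1.
  by apply: measurable_cos_fun; apply: measurable_funD => //; exact: measurable_L0.
have isin (a : R) (z : H) : P.-integrable setT (EFin \o (fun t => sin (a + X z t))).
  apply: (@integrable_bounded _ _ _ P _ 1); last by move=> x; exact: normr_sin_le1.
  by apply: measurable_sin_fun; apply: measurable_funD => //; exact: measurable_L0.
have icos0 (z : H) : P.-integrable setT (EFin \o (fun t => cos (X z t))).
  by under eq_fun do rewrite -[X z _]add0r; exact: icos.
have isin0 (z : H) : P.-integrable setT (EFin \o (fun t => sin (X z t))).
  by under eq_fun do rewrite -[X z _]add0r; exact: isin.
have ione : P.-integrable setT (EFin \o (fun=> 1 : R)) by exact: finite_measure_integrable_cst.
have inner (a : R) : (\int[normal_prob 0 `|v|]_y (f (a + y))%:E =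
    (1 + cos a * \int[P]_t cos (X v t))%:E)%E.
  rewrite -(@gaussian_ge0_integral v (fun y => f (a + y)) v0) => [|//|]; last 2 first.
  - by apply: measurableT_comp => //; exact: measurable_funD.
  - by move=> x; exact: f0.
  rewrite -(@EFin_Rintegral _ _ _ P (fun t => f (a + X v t))); last first.
    apply: (@integrable_bounded _ _ _ P _ 2).
      by apply: measurableT_comp => //; apply: measurable_funD => //; exact: measurable_L0.
    move=> x; rewrite ger0_norm// /f; have := cos_le1 (a + X v x); lra.
  rewrite /f RintegralD// Rintegral_probability_cst; congr (_ + _)%:E.
  under eq_Rintegral do rewrite cosD.
  rewrite RintegralB//; last 2 first.
  - exact: integrableRZ.
  - exact: integrableRZ.
  by rewrite RintegralZl// RintegralZl// gaussian_sin mulr0 subr0.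
set cv := \int[P]_t cos (X v t) in inner *.
have cv1 : `|cv| <= 1.
  apply: (le_trans (le_normr_Rintegral _ _)) => //.
  rewrite -[leRHS](Rintegral_probability_cst P); apply: le_Rintegral => //.
    exact: integrable_norm.
  by move=> x _; exact: normr_cos_le1.
have mg : measurable_fun setT (fun a : R => 1 + cos a * cv).
  by apply: measurable_funD => //; exact: measurable_funM.
have g0 (a : R) : 0 <= 1 + cos a * cv.
  have : `|cos a * cv| <= 1.
    by rewrite normrM mulr_ile1// normr_cos_le1.
  by rewrite ler_norml => /andP[]; lra.
have {}conv : (\int[P]_t (1 + cos (X u t) * cv)%:E = \int[P]_t (f (X w t))%:E)%E.
  rewrite -conv (@gaussian_ge0_integral u (fun a => 1 + cos a * cv) u0 mg g0).
  by apply: eq_integral => a _; rewrite -inner.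
rewrite -(@EFin_Rintegral _ _ _ P (fun t => 1 + cos (X u t) * cv)) in conv; last first.
  apply: (@integrable_bounded _ _ _ P _ 2).
    by apply: measurable_funD => //; apply: measurable_funM => //; exact/measurable_cos_fun/measurable_L0.
  move=> x; rewrite (le_trans (ler_normD _ _))// normr1 -[2]/(1 + 1) lerD2l.
  by rewrite normrM mulr_ile1// normr_cos_le1.
rewrite -(@EFin_Rintegral _ _ _ P (fun t => f (X w t))) in conv; last first.
  apply: (@integrable_bounded _ _ _ P _ 2).
    by apply: measurableT_comp => //; exact: measurable_L0.
  move=> x; rewrite ger0_norm// /f; have := cos_le1 (X w x); lra.
case: conv; rewrite /f RintegralD//; last by under eq_fun do rewrite mulrC; exact: integrableRZ.
rewrite [in RHS]RintegralD// !Rintegral_probability_cst RintegralZr//.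
by move/addrI.
Qed.

(** The density of N(0, s^2) beats any power because half of its exponent
    already dominates the power, leaving the density of N(0, 2 s^2). *)
Lemma gaussian_moment_lty (u : H) (k : nat) :
  (\int[P]_t (X u t ^+ k.*2)%:E < +oo)%E.
Proof.
have mp (j : nat) : measurable_fun setT (fun x : R => x ^+ j) by exact: exprn_measurable.
have p0 (j : nat) (x : R) : 0 <= x ^+ j.*2 by rewrite exprn_even_ge0// odd_double.
have [->|u0] := eqVneq u 0.
  rewrite (@ae_eq_integral _ _ _ P setT (cst ((0 : R) ^+ k.*2)%:E))//; last 2 first.
  - exact/measurable_EFinP/measurable_funX/measurable_L0.
  - have := gaussianN 0; rewrite oppr0; apply: filterS => x /= /(_ I) h _.
    by rewrite (_ : X 0 x = 0)//; lra.
  by rewrite integral_cst//= probability_setT mule1 ltry.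
rewrite (@gaussian_ge0_integral u (fun x => x ^+ k.*2) u0)//.
rewrite integral_normal_prob//.
have s0 : `|u| != 0 by rewrite normr_eq0.
move: s0; set s := `|u| => s0; clearbody s.
have r0 : Num.sqrt 2 * s != 0 by rewrite mulf_neq0// gt_eqF// sqrtr_gt0.
have s2 : 0 < s ^+ 2 by rewrite exprn_even_gt0.
pose C : R := (4 * s ^+ 2) ^+ k * (k`!)%:R * normal_peak s / normal_peak (Num.sqrt 2 * s).
have C0 : 0 <= C.
  rewrite /C !mulr_ge0 ?invr_ge0 ?normal_peak_ge0 ?exprn_ge0//.
  by rewrite mulr_ge0// ltW.
have key (x : R) : x ^+ k.*2 * normal_pdf 0 s x <= C * normal_pdf 0 (Num.sqrt 2 * s) x.
  rewrite !normal_pdfE//= /C.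
  have q0 := normal_peak_gt0 r0.
  rewrite mulrCA [leRHS](_ : _ = normal_peak s *
    ((4 * s ^+ 2) ^+ k * (k`!)%:R * normal_fun 0 (Num.sqrt 2 * s) x)); last first.
    by field; rewrite gt_eqF.
  rewrite ler_wpM2l ?normal_peak_ge0//.
  pose y : R := x ^+ 2 / (4 * s ^+ 2).
  have y0 : 0 <= y by rewrite /y divr_ge0 ?sqr_ge0// mulr_ge0// ltW.
  have xk : x ^+ k.*2 = (4 * s ^+ 2) ^+ k * y ^+ k.
    by rewrite -mul2n exprM -exprMn; congr (_ ^+ _); rewrite /y; field; rewrite s0.
  have e1 : normal_fun 0 s x = expR (- y) * expR (- y).
    rewrite /normal_fun -expRD subr0 /y; congr expR.
    by field; rewrite s0.
  have e2 : normal_fun 0 (Num.sqrt 2 * s) x = expR (- y).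
    rewrite /normal_fun subr0 /y exprMn sqr_sqrtr//; congr expR.
    by field; rewrite s0.
  rewrite xk e1 e2 mulrA ler_wpM2r ?expR_ge0// -[leLHS]mulrA ler_wpM2l//.
    by rewrite exprn_ge0// mulr_ge0// ltW.
  rewrite expRN ler_pdivrMr ?expR_gt0//.
  case: (k) => [|j].
    by rewrite fact0 mul1r expr0 -expR0 ler_expR.
  rewrite mulrC -ler_pdivrMr ?ltr0n ?fact_gt0//.
  by have := expR_ge1Dxn j y0; lra.
apply: (@le_lt_trans _ _ (\int[lebesgue_measure]_x (C%:E * (normal_pdf 0 (Num.sqrt 2 * s) x)%:E)))%E.
  apply: ge0_le_integral => //.
  - by move=> x _; rewrite lee_fin mulr_ge0// normal_pdf_ge0.
  - by apply/measurable_EFinP/measurable_funM => //; exact: measurable_normal_pdf.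
  - by apply: emeasurable_funM => //; exact: measurable_int (integrable_normal_pdf _ _).
  - by move=> x _; rewrite -EFinM lee_fin.
rewrite ge0_integralZl_EFin//.
- by rewrite integral_normal_pdf mule1 ltry.
- by move=> x _; rewrite lee_fin normal_pdf_ge0.
- exact: measurable_int (integrable_normal_pdf _ _).
Qed.

End StandardGaussian.

(** * Laws on sequence space and their Fourier transforms *)

Lemma bernoulli_ineq (R : realType) (x : R) (n : nat) : -1 <= x ->
  1 + n%:R * x <= (1 + x) ^+ n.
Proof.
move=> x1; have [x0|x0] := leP 0 x.
  elim: n => [|n IH]; first by rewrite mul0r addr0 expr0.
  rewrite exprS -natr1; apply: (@le_trans _ _ ((1 + x) * (1 + n%:R * x))).
    have : 0 <= n%:R * x * x by rewrite !mulr_ge0.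
    by lra.
  by rewrite ler_wpM2l//; lra.
elim: n => [|n IH]; first by rewrite mul0r addr0 expr0.
rewrite exprS -natr1; apply: (@le_trans _ _ ((1 + x) * (1 + n%:R * x))).
  have : 0 <= n%:R * (x * x) by rewrite mulr_ge0// -expr2 sqr_ge0.
  by lra.
by rewrite ler_wpM2l//; lra.
Qed.

(** Polynomials bounded by 1 on [0, 1] that tend to the indicator of
    [1/2, 1]: at [v] the inner power is compared with [2 ^- n], and the factor
    [n] in the exponent decides the tie at [v = 1/2]. *)
Definition step_poly (R : realType) (n : nat) (v : R) : R :=
  1 - (1 - v ^+ n) ^+ (n * 2 ^ n).

Lemma step_poly_itv (R : realType) (n : nat) (v : R) : 0 <= v <= 1 ->
  0 <= step_poly n v <= 1.
Proof.
move=> /andP[v0 v1]; rewrite /step_poly.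
have h : 0 <= 1 - v ^+ n <= 1.
  by rewrite subr_ge0 exprn_ile1//= gerBl exprn_ge0.
case/andP: h => h0 h1.
by rewrite subr_ge0 exprn_ile1//= gerBl exprn_ge0.
Qed.

Lemma cvg_step_poly (R : realType) (v : R) : 0 <= v <= 1 ->
  step_poly n v @[n --> \oo] --> ((2^-1 <= v)%R%:R : R).
Proof.
move=> v01; have /andP[v0 v1] := v01.
have [hv|hv] := leP 2^-1 v.
  have h : harmonic n @[n --> \oo] --> (0 : R) by exact: cvg_harmonic.
  apply: (@squeeze_cvgr _ _ _ _ (fun n => 1 - harmonic n) (cst 1)) => /=.
  - near=> n; have /andP[_ ->] := step_poly_itv n v01; rewrite andbT.
    rewrite /step_poly lerB// /harmonic/=.
    set y := v ^+ n; set N := (n * 2 ^ n)%N.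
    have y0 : 0 <= y by rewrite exprn_ge0.
    have y1 : y <= 1 by rewrite exprn_ile1.
    (* here [N y >= n], and [(1 - y)^N <= (1 + y)^(- N) <= 1 / (N y + 1)] *)
    have Ny : n%:R <= N%:R * y.
      rewrite /N natrM -mulrA ler_peMr// natrX.
      rewrite -exprMn; apply: exprn_ege1; lra.
    have b1 : (1 - y) ^+ N * (1 + y) ^+ N <= 1.
      rewrite -exprMn; apply: exprn_ile1; first by apply: mulr_ge0; lra.
      have := sqr_ge0 y; lra.
    have b2 : n.+1%:R <= (1 + y) ^+ N.
      apply: le_trans (bernoulli_ineq N _); last by lra.
      by rewrite -natr1; lra.
    rewrite -[leRHS]div1r ler_pdivlMr ?ltr0n//.
    apply: le_trans b1; apply: ler_wpM2l => //.
    by rewrite exprn_ge0// subr_ge0.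
  - by rewrite -[X in _ --> X]subr0; apply: cvgB => //; exact: cvg_cst.
  - exact: cvg_cst.
(* here [N v^n = n r^(2n)], and [n r^n] is bounded since [r < 1] *)
pose r : R := Num.sqrt (2 * v).
have r0 : 0 <= r by rewrite sqrtr_ge0.
have r2 : r ^+ 2 = 2 * v by rewrite sqr_sqrtr//; lra.
have r1 : r < 1 by rewrite -[ltRHS]sqrtr1 ltr_sqrt//; lra.
have [r00|rn0] := eqVneq r 0.
  have v00 : v = 0 by move: r2; rewrite r00 expr0n/=; lra.
  apply/cvgrPdist_le => e e0; near=> n.
  have n0 : (0 < n)%N by near: n; exact: nbhs_infty_gt.
  by rewrite /step_poly v00 expr0n gtn_eqF// subr0 expr1n subrr subrr normr0 ltW.
have rp : 0 < r by rewrite lt_def rn0.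
pose C : R := r / (1 - r).
have nr n : n%:R * r ^+ n <= C.
  have ri : 1 <= r^-1 by rewrite invf_ge1// ltW.
  have := @bernoulli_ineq _ (r^-1 - 1) n; rewrite [1 + (_ - 1)]addrC subrK exprVn => h.
  have {}h : n%:R * (r^-1 - 1) <= r ^- n.
    by apply: le_trans (h _); lra.
  rewrite /C ler_pdivlMr ?subr_gt0//.
  have rn : 0 < r ^+ n by rewrite exprn_gt0.
  rewrite -[leRHS]div1r ler_pdivlMr// in h.
  have -> : n%:R * r ^+ n * (1 - r) = (n%:R * (r^-1 - 1)) * (r ^+ n * r).
    by field; rewrite rn0.
  move: h; set q := n%:R * _ => h.
  by rewrite mulrA -[leRHS]mul1r ler_wpM2r.
have cr : C * r ^+ n @[n --> \oo] --> (0 : R).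
  rewrite -(mulr0 C); apply: cvgM; first exact: cvg_cst.
  by apply: cvg_expr; rewrite ger0_norm.
apply: (@squeeze_cvgr _ _ _ _ (cst 0) (fun n => C * r ^+ n)) => //; last exact: cvg_cst.
near=> n; have /andP[-> _] /= := step_poly_itv n v01.
set y := v ^+ n; set N := (n * 2 ^ n)%N.
have y0 : 0 <= y by rewrite exprn_ge0.
have y1 : y <= 1 by rewrite exprn_ile1.
rewrite /step_poly -/y -/N.
have := @bernoulli_ineq _ (- y) N; rewrite lerN2 => /(_ y1) b.
have Ny : N%:R * y = n%:R * r ^+ n * r ^+ n.
  by rewrite /N natrM -!mulrA natrX -!exprMn -r2 expr2.
have : N%:R * y <= C * r ^+ n by rewrite Ny ler_wpM2r// exprn_ge0.
by move: b; rewrite mulrN; lra.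
Unshelve. all: by end_near.
Qed.

(** For small positive [t], [sin (t x)] has the sign of [x]. *)
Lemma cvg_sin_sign (R : realType) (x : R) :
  ((0 <= sin (n.+1%:R^-1 * x))%R%:R : R) @[n --> \oo] --> ((0 <= x)%R%:R : R).
Proof.
apply: cvg_near_cst.
have c : n.+1%:R^-1 * x @[n --> \oo] --> (0 : R).
  by rewrite -(mul0r x); apply: cvgM; [exact: cvg_harmonic|exact: cvg_cst].
have [x0|x0] := leP 0 x.
  have : \forall n \near \oo, n.+1%:R^-1 * x <= pi.
    by apply: (cvgr_le _ c); exact: pi_gt0.
  apply: filterS => n h; rewrite sin_ge0_pi//; apply/andP; split => //.
  by rewrite mulr_ge0.
have : \forall n \near \oo, - pi < n.+1%:R^-1 * x.
  by apply: (cvgr_gt _ c); rewrite oppr_lt0 pi_gt0.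
apply: filterS => n h.
have y0 : 0 < - (n.+1%:R^-1 * x) by rewrite oppr_gt0 nmulr_llt0 ?invr_gt0.
have : 0 < sin (- (n.+1%:R^-1 * x)).
  by apply: sin_gt0_pi; rewrite y0/= ltrNl.
by rewrite sinN oppr_gt0 ltNge => /negbTE ->.
Qed.

Definition linear_form (R : realType) (c : seq (R * nat)) (u : nat -> R) : R :=
  \sum_(p <- c) p.1 * u p.2.

Lemma linear_form_cons (R : realType) (p : R * nat) c (u : nat -> R) :
  linear_form (p :: c) u = p.1 * u p.2 + linear_form c u.
Proof. by rewrite /linear_form big_cons. Qed.

Section FourierUniqueness.
Context (R : realType).
Context (d1 : measure_display) (W1 : measurableType d1) (Q1 : probability W1 R).
Context (d2 : measure_display) (W2 : measurableType d2) (Q2 : probability W2 R).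
Context (z1 : W1 -> nat -> R) (z2 : W2 -> nat -> R).
Hypothesis mz1 : forall i, measurable_fun setT (fun w => z1 w i).
Hypothesis mz2 : forall i, measurable_fun setT (fun w => z2 w i).

Lemma measurable_linear_form1 c : measurable_fun setT (fun w => linear_form c (z1 w)).
Proof.
by apply: measurable_sum => p; apply: measurable_funM => //; exact: mz1.
Qed.

Lemma measurable_linear_form2 c : measurable_fun setT (fun w => linear_form c (z2 w)).
Proof.
by apply: measurable_sum => p; apply: measurable_funM => //; exact: mz2.
Qed.

(** The signed laws [f1 . z1_* Q1] and [f2 . z2_* Q2] have the same Fourier
    transform; the phase [theta] encodes cosines and sines at once. *)
Definition same_fourier (f1 : W1 -> R) (f2 : W2 -> R) : Prop :=
  [/\ measurable_fun setT f1, measurable_fun setT f2,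
      exists M : R, (forall w, `|f1 w| <= M) /\ (forall w, `|f2 w| <= M)
    & forall (c : seq (R * nat)) (theta : R),
      \int[Q1]_w (f1 w * cos (linear_form c (z1 w) - theta)) =
      \int[Q2]_w (f2 w * cos (linear_form c (z2 w) - theta))].

Lemma same_fourier_integrable f1 f2 : same_fourier f1 f2 ->
  forall (c : seq (R * nat)) (theta : R),
   Q1.-integrable setT (EFin \o (fun w => f1 w * cos (linear_form c (z1 w) - theta))) /\
   Q2.-integrable setT (EFin \o (fun w => f2 w * cos (linear_form c (z2 w) - theta))).
Proof.
move=> [m1 m2 [M [M1 M2]] _] c theta; split.
  apply: (@integrable_bounded _ _ _ Q1 _ M).
    apply: measurable_funM => //; apply: measurable_cos_fun; apply: measurable_funB => //.
    exact: measurable_linear_form1.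
  by move=> w; rewrite normrM -[leRHS]mulr1 ler_pM// normr_cos_le1.
apply: (@integrable_bounded _ _ _ Q2 _ M).
  apply: measurable_funM => //; apply: measurable_cos_fun; apply: measurable_funB => //.
  exact: measurable_linear_form2.
by move=> w; rewrite normrM -[leRHS]mulr1 ler_pM// normr_cos_le1.
Qed.

Lemma same_fourierD f1 f2 g1 g2 : same_fourier f1 f2 -> same_fourier g1 g2 ->
  same_fourier (fun w => f1 w + g1 w) (fun w => f2 w + g2 w).
Proof.
move=> sf sg; have fi := same_fourier_integrable sf; have gi := same_fourier_integrable sg.
move: sf sg => [mf1 mf2 [M [M1 M2]] ef] [mg1 mg2 [N [N1 N2]] eg]; split.
- exact: measurable_funD.
- exact: measurable_funD.
- by exists (M + N); split=> w; rewrite (le_trans (ler_normD _ _))// lerD.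
- move=> c theta; under eq_Rintegral do rewrite mulrDl.
  under [in RHS]eq_Rintegral do rewrite mulrDl.
  have [? ?] := fi c theta; have [? ?] := gi c theta.
  by rewrite !RintegralD// ef eg.
Qed.

Lemma same_fourierZ (a : R) f1 f2 : same_fourier f1 f2 ->
  same_fourier (fun w => a * f1 w) (fun w => a * f2 w).
Proof.
move=> sf; have fi := same_fourier_integrable sf.
move: sf => [mf1 mf2 [M [M1 M2]] ef]; split.
- exact: measurable_funM.
- exact: measurable_funM.
- by exists (`|a| * M); split=> w; rewrite normrM ler_wpM2l.
- move=> c theta; under eq_Rintegral do rewrite -mulrA.
  under [in RHS]eq_Rintegral do rewrite -mulrA.
  by have [? ?] := fi c theta; rewrite !RintegralZl// ef.
Qed.

Lemma same_fourier_lim (f1 : nat -> W1 -> R) (f2 : nat -> W2 -> R) g1 g2 (M : R) :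
  (forall n, same_fourier (f1 n) (f2 n)) ->
  (forall n w, `|f1 n w| <= M) -> (forall n w, `|f2 n w| <= M) ->
  (forall w, f1 n w @[n --> \oo] --> g1 w) -> (forall w, f2 n w @[n --> \oo] --> g2 w) ->
  same_fourier g1 g2.
Proof.
move=> sf M1 M2 c1 c2.
have mg1 : measurable_fun setT g1.
  by apply: (measurable_fun_cvg (h := f1)) => // n; have [] := sf n.
have mg2 : measurable_fun setT g2.
  by apply: (measurable_fun_cvg (h := f2)) => // n; have [] := sf n.
split => //.
  exists M; split => w.
    by apply: (cvgr_to_le (cvg_norm (c1 w))); apply: nearW => n.
  by apply: (cvgr_to_le (cvg_norm (c2 w))); apply: nearW => n.
move=> c theta.
have l1 : \int[Q1]_w (f1 n w * cos (linear_form c (z1 w) - theta)) @[n --> \oo] -->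
    \int[Q1]_w (g1 w * cos (linear_form c (z1 w) - theta)).
  apply: (cvg_bounded_Rintegral (M := M)).
  - move=> n; have [mf _ _ _] := sf n; apply: measurable_funM => //.
    by apply/measurable_cos_fun/measurable_funB => //; exact: measurable_linear_form1.
  - by move=> n w; rewrite normrM -[leRHS]mulr1 ler_pM// normr_cos_le1.
  - by move=> w; apply: cvgM => //; exact: cvg_cst.
have l2 : \int[Q2]_w (f2 n w * cos (linear_form c (z2 w) - theta)) @[n --> \oo] -->
    \int[Q2]_w (g2 w * cos (linear_form c (z2 w) - theta)).
  apply: (cvg_bounded_Rintegral (M := M)).
  - move=> n; have [_ mf _ _] := sf n; apply: measurable_funM => //.
    by apply/measurable_cos_fun/measurable_funB => //; exact: measurable_linear_form2.
  - by move=> n w; rewrite normrM -[leRHS]mulr1 ler_pM// normr_cos_le1.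
  - by move=> w; apply: cvgM => //; exact: cvg_cst.
apply: (@cvg_unique _ (@norm_hausdorff R R^o) _ _ _ _ l1).
rewrite (_ : (fun n => _) = fun n => \int[Q2]_w (f2 n w * cos (linear_form c (z2 w) - theta)))//.
by apply/funext => n; have [_ _ _] := sf n.
Qed.

(** Functions by which a pair of signed laws may be multiplied without
    separating their Fourier transforms.  They form an algebra closed under
    bounded pointwise limits, which is how half-line indicators are reached. *)
Definition fourier_multiplier (g1 : W1 -> R) (g2 : W2 -> R) : Prop :=
  forall f1 f2, same_fourier f1 f2 ->
    same_fourier (fun w => f1 w * g1 w) (fun w => f2 w * g2 w).

Lemma multiplier_cst (a : R) : fourier_multiplier (fun=> a) (fun=> a).
Proof.
move=> f1 f2 sf; have := same_fourierZ a sf.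
by under eq_fun do rewrite mulrC; under [X in same_fourier _ X]eq_fun do rewrite mulrC.
Qed.

Lemma multiplierM g1 g2 h1 h2 : fourier_multiplier g1 g2 -> fourier_multiplier h1 h2 ->
  fourier_multiplier (fun w => g1 w * h1 w) (fun w => g2 w * h2 w).
Proof.
move=> mg mh f1 f2 sf; have := mh _ _ (mg _ _ sf).
by under eq_fun do rewrite -mulrA; under [X in same_fourier _ X]eq_fun do rewrite -mulrA.
Qed.

Lemma multiplierD g1 g2 h1 h2 : fourier_multiplier g1 g2 -> fourier_multiplier h1 h2 ->
  fourier_multiplier (fun w => g1 w + h1 w) (fun w => g2 w + h2 w).
Proof.
move=> mg mh f1 f2 sf; have := same_fourierD (mg _ _ sf) (mh _ _ sf).
by under eq_fun do rewrite -mulrDr; under [X in same_fourier _ X]eq_fun do rewrite -mulrDr.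
Qed.

Lemma multiplierX g1 g2 (n : nat) : fourier_multiplier g1 g2 ->
  fourier_multiplier (fun w => g1 w ^+ n) (fun w => g2 w ^+ n).
Proof.
move=> mg; elim: n => [|n IH]; first exact: multiplier_cst.
have -> : (fun w => g1 w ^+ n.+1) = (fun w => g1 w * g1 w ^+ n).
  by apply/funext => w; rewrite exprS.
have -> : (fun w => g2 w ^+ n.+1) = (fun w => g2 w * g2 w ^+ n).
  by apply/funext => w; rewrite exprS.
exact: multiplierM.
Qed.

Lemma multiplier_onem g1 g2 : fourier_multiplier g1 g2 ->
  fourier_multiplier (fun w => 1 - g1 w) (fun w => 1 - g2 w).
Proof.
move=> mg; have := multiplierD (multiplier_cst 1) (multiplierM (multiplier_cst (-1)) mg).
suff -> : (fun w => 1 - g1 w) = (fun w => 1 + -1 * g1 w).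
  by suff -> : (fun w => 1 - g2 w) = (fun w => 1 + -1 * g2 w); last by apply/funext => w; rewrite mulN1r.
by apply/funext => w; rewrite mulN1r.
Qed.

Lemma multiplier_lim (g1 : nat -> W1 -> R) (g2 : nat -> W2 -> R) h1 h2 :
  (forall n, fourier_multiplier (g1 n) (g2 n)) ->
  (forall n w, `|g1 n w| <= 1) -> (forall n w, `|g2 n w| <= 1) ->
  (forall w, g1 n w @[n --> \oo] --> h1 w) -> (forall w, g2 n w @[n --> \oo] --> h2 w) ->
  fourier_multiplier h1 h2.
Proof.
move=> mg b1 b2 c1 c2 f1 f2 sf; have [_ _ [M [M1 M2]] _] := sf.
apply: (@same_fourier_lim (fun n w => f1 w * g1 n w) (fun n w => f2 w * g2 n w) _ _ M).
- by move=> n; exact: mg.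
- by move=> n w; rewrite normrM -[leRHS]mulr1 ler_pM.
- by move=> n w; rewrite normrM -[leRHS]mulr1 ler_pM.
- by move=> w; apply: cvgM => //; exact: cvg_cst.
- by move=> w; apply: cvgM => //; exact: cvg_cst.
Qed.

(** [sin (t (z i - b)) cos (l - theta)] is a combination of two cosines, of the
    linear forms [l] plus and minus [t z i], with other phases. *)
Lemma multiplier_sin (i : nat) (b t : R) :
  fourier_multiplier (fun w => sin (t * (z1 w i - b))) (fun w => sin (t * (z2 w i - b))).
Proof.
move=> f1 f2 sf; have fi := same_fourier_integrable sf.
have [mf1 mf2 [M [M1 M2]] ef] := sf.
have trig (l x theta : R) : sin (t * (x - b)) * cos (l - theta) =
    2^-1 * (cos (t * x + l - (theta + t * b + pi / 2))) +
    2^-1 * (cos (- t * x + l - (theta - t * b - pi / 2))).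
  set A := t * (x - b); set B := l - theta.
  have -> : t * x + l - (theta + t * b + pi / 2) = (A + B) - pi / 2 by rewrite /A /B; ring.
  have -> : - t * x + l - (theta - t * b - pi / 2) = (B - A) + pi / 2 by rewrite /A /B; ring.
  clearbody A B; rewrite (cosB (A + B)) (cosD (B - A)) cos_pihalf sin_pihalf (sinD A B) (sinB B A); by field.
split.
- apply: measurable_funM => //; apply/measurable_sin_fun/measurable_funM => //.
  exact: measurable_funB.
- apply: measurable_funM => //; apply/measurable_sin_fun/measurable_funM => //.
  exact: measurable_funB.
- by exists M; split=> w; rewrite normrM -[leRHS]mulr1 ler_pM// normr_sin_le1.
move=> c theta.
have e1 := ef ((t, i) :: c) (theta + t * b + pi / 2).
have e2 := ef ((- t, i) :: c) (theta - t * b - pi / 2).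
have [i1 i1'] := fi ((t, i) :: c) (theta + t * b + pi / 2).
have [i2 i2'] := fi ((- t, i) :: c) (theta - t * b - pi / 2).
have l1 : \int[Q1]_w (f1 w * sin (t * (z1 w i - b)) * cos (linear_form c (z1 w) - theta)) =
   2^-1 * \int[Q1]_w (f1 w * cos (linear_form ((t, i) :: c) (z1 w) - (theta + t * b + pi / 2))) +
   2^-1 * \int[Q1]_w (f1 w * cos (linear_form ((- t, i) :: c) (z1 w) - (theta - t * b - pi / 2))).
  rewrite -!RintegralZl// -RintegralD//; [|exact: integrableRZ|exact: integrableRZ].
  apply: eq_Rintegral => w _; rewrite !linear_form_cons/= -mulrA trig mulrDr.
  by rewrite !(mulrCA (f1 w)).
have l2 : \int[Q2]_w (f2 w * sin (t * (z2 w i - b)) * cos (linear_form c (z2 w) - theta)) =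
   2^-1 * \int[Q2]_w (f2 w * cos (linear_form ((t, i) :: c) (z2 w) - (theta + t * b + pi / 2))) +
   2^-1 * \int[Q2]_w (f2 w * cos (linear_form ((- t, i) :: c) (z2 w) - (theta - t * b - pi / 2))).
  rewrite -!RintegralZl// -RintegralD//; [|exact: integrableRZ|exact: integrableRZ].
  apply: eq_Rintegral => w _; rewrite !linear_form_cons/= -mulrA trig mulrDr.
  by rewrite !(mulrCA (f2 w)).
by rewrite l1 l2 e1 e2.
Qed.

(** By [cvg_step_poly], the indicator of [0 <= sin] is a bounded limit of
    polynomials in the sine. *)
Lemma multiplier_sign (i : nat) (b t : R) :
  fourier_multiplier (fun w => (0 <= sin (t * (z1 w i - b)))%R%:R)
                     (fun w => (0 <= sin (t * (z2 w i - b)))%R%:R).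
Proof.
pose v (x : R) : R := 2^-1 + 2^-1 * sin (t * (x - b)).
have v01 x : 0 <= v x <= 1.
  rewrite /v; have := sin_geN1 (t * (x - b)); have := sin_le1 (t * (x - b)).
  by move=> h1 h2; apply/andP; split; lra.
have vs x : (2^-1 <= v x) = (0 <= sin (t * (x - b))).
  by rewrite /v lerDl pmulr_rge0// invr_gt0.
have nb n x : `|step_poly n (v x)| <= 1.
  have /andP[h0 h1] := step_poly_itv n (v01 x).
  by rewrite ger0_norm.
apply: (@multiplier_lim (fun n w => step_poly n (v (z1 w i))) (fun n w => step_poly n (v (z2 w i)))).
- move=> n; rewrite /step_poly; apply: multiplier_onem; apply: multiplierX.
  apply: multiplier_onem; apply: multiplierX; apply: multiplierD; first exact: multiplier_cst.
  by apply: multiplierM; [exact: multiplier_cst|exact: multiplier_sin].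
- by move=> n w; exact: nb.
- by move=> n w; exact: nb.
- by move=> w; rewrite -vs; exact: cvg_step_poly.
- by move=> w; rewrite -vs; exact: cvg_step_poly.
Qed.

Lemma multiplier_ray (i : nat) (b : R) :
  fourier_multiplier (fun w => (b <= z1 w i)%R%:R) (fun w => (b <= z2 w i)%R%:R).
Proof.
apply: (@multiplier_lim (fun n w => (0 <= sin (n.+1%:R^-1 * (z1 w i - b)))%R%:R)
  (fun n w => (0 <= sin (n.+1%:R^-1 * (z2 w i - b)))%R%:R)).
- by move=> n; exact: multiplier_sign.
- by move=> n w; case: (0 <= _) => /=; rewrite ?normr1 ?normr0.
- by move=> n w; case: (0 <= _) => /=; rewrite ?normr1 ?normr0.
- by move=> w; rewrite -subr_ge0; exact: cvg_sin_sign.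
- by move=> w; rewrite -subr_ge0; exact: cvg_sin_sign.
Qed.

Definition in_rays (s : seq (R * nat)) (u : nat -> R) : bool := all (fun p => p.1 <= u p.2) s.

Lemma multiplier_rays (s : seq (R * nat)) :
  fourier_multiplier (fun w => (in_rays s (z1 w))%:R) (fun w => (in_rays s (z2 w))%:R).
Proof.
elim: s => [|[b i] s IH]; first exact: multiplier_cst.
have e (u : nat -> R) : (in_rays ((b, i) :: s) u)%:R = (b <= u i)%R%:R * (in_rays s u)%:R :> R.
  by rewrite /in_rays/=; case: (b <= u i) => /=; rewrite ?mul1r ?mul0r.
have -> : (fun w => (in_rays ((b, i) :: s) (z1 w))%:R) = (fun w => (b <= z1 w i)%R%:R * (in_rays s (z1 w))%:R :> R).
  by apply/funext => w; exact: e.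
have -> : (fun w => (in_rays ((b, i) :: s) (z2 w))%:R) = (fun w => (b <= z2 w i)%R%:R * (in_rays s (z2 w))%:R :> R).
  by apply/funext => w; exact: e.
by apply: multiplierM => //; exact: multiplier_ray.
Qed.

Hypothesis fourier_eq : forall (c : seq (R * nat)) (theta : R),
  \int[Q1]_w cos (linear_form c (z1 w) - theta) = \int[Q2]_w cos (linear_form c (z2 w) - theta).

Lemma same_fourier_cst1 : same_fourier (fun=> 1) (fun=> 1).
Proof.
split => //; first by exists 1; rewrite normr1.
move=> c theta; under eq_Rintegral do rewrite mul1r.
by under [RHS]eq_Rintegral do rewrite mul1r.
Qed.

Lemma rays_Rintegral_eq s :
  \int[Q1]_w (in_rays s (z1 w))%:R = \int[Q2]_w (in_rays s (z2 w))%:R.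
Proof.
have [_ _ _ h] := multiplier_rays s same_fourier_cst1.
have := h [::] 0.
under eq_Rintegral do rewrite /linear_form big_nil subr0 cos0 mulr1 mul1r.
by under [X in _ = X -> _]eq_Rintegral do rewrite /linear_form big_nil subr0 cos0 mulr1 mul1r.
Qed.

End FourierUniqueness.

Lemma measurable_Rinfty_coord (R : realType) (k : nat) :
  measurable_fun setT (fun u : Rinfty R => u k : R).
Proof.
move=> _ B mB; rewrite setTI; apply: sub_sigma_algebra.
by exists k, B.
Qed.

Lemma measurable_to_Rinfty (R : realType) (d : measure_display) (T : measurableType d)
    (f : T -> nat -> R) :
  (forall k, measurable_fun setT (fun t => f t k)) ->
  measurable_fun setT (f : T -> Rinfty R).
Proof.
move=> mf; apply: (@measurability _ _ T (Rinfty R) setT f (@Rinfty_cylinders R)) => //.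
move=> _ [C [k [B [mB ->]]] <-].
exact: (mf k measurableT B mB).
Qed.

Definition ray_sets (R : realType) : set (set (nat -> R)) :=
  [set C | exists s, C = [set u | in_rays s u]].

Lemma measurable_RinftyE (R : realType) :
  @measurable _ (Rinfty R) = <<s @ray_sets R >>.
Proof.
rewrite eqEsubset; split.
  apply: smallest_sub; first exact: smallest_sigma_algebra.
  move=> C [k [B [mB ->]]].
  have m : measurable_fun setT (fun u : g_sigma_algebraType (@ray_sets R) => u k : R).
    apply: (measurability (RGenCInfty.G (R := R))).
      exact: RGenCInfty.measurableE.
    move=> _ [_ [b ->] <-]; rewrite setTI; apply: sub_sigma_algebra.
    exists [:: (b, k)]; apply/seteqP; split => u /=.
      by rewrite /in_rays/= in_itv/= !andbT.
    by rewrite /in_rays/= in_itv/= !andbT.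
  by have := m measurableT B mB; rewrite setTI.
apply: smallest_sub; first exact: sigma_algebra_measurable.
move=> _ [s ->]; elim: s => [|[b i] s IH].
  by rewrite (_ : [set _ | _] = setT)//; apply/seteqP; split.
rewrite (_ : [set _ | _] = [set u | `[b, +oo[%classic (u i)] `&` [set u | in_rays s u]).
  apply: (@measurableI _ (Rinfty R)) => //; apply: sub_sigma_algebra.
  by exists i, `[b, +oo[%classic; split => //; exact: measurable_itv.
by apply/seteqP; split => u /=; rewrite in_itv/= andbT => /andP.
Qed.

(** The half-space indicators are multipliers: applied to the two laws, they show
    that these give the same mass to every finite intersection of half-spaces
    [b <= u i], and such intersections generate. *)
Lemma Rinfty_law_unique (R : realType)
    (d1 : measure_display) (W1 : measurableType d1) (Q1 : probability W1 R)
    (d2 : measure_display) (W2 : measurableType d2) (Q2 : probability W2 R)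
    (z1 : W1 -> nat -> R) (z2 : W2 -> nat -> R) :
  (forall i, measurable_fun setT (fun w => z1 w i)) ->
  (forall i, measurable_fun setT (fun w => z2 w i)) ->
  (forall (c : seq (R * nat)) (theta : R),
    \int[Q1]_w cos (linear_form c (z1 w) - theta) =
    \int[Q2]_w cos (linear_form c (z2 w) - theta)) ->
  forall Psi : Rinfty R -> \bar R, measurable_fun setT Psi ->
    (forall u, 0 <= Psi u)%E ->
    (\int[Q1]_w Psi (z1 w) = \int[Q2]_w Psi (z2 w))%E.
Proof.
move=> mz1 mz2 fe Psi mPsi Psi0.
have m1 := measurable_to_Rinfty mz1; have m2 := measurable_to_Rinfty mz2.
have mrays s : measurable ([set u | in_rays s u] : set (Rinfty R)).
  by rewrite measurable_RinftyE; apply: sub_sigma_algebra; exists s.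
rewrite -(ge0_integral_pushforward m1 Q1 measurableT mPsi); last by move=> u _; exact: Psi0.
rewrite -(ge0_integral_pushforward m2 Q2 measurableT mPsi); last by move=> u _; exact: Psi0.
apply: eq_measure_integral => A mA _.
apply: (@measure_unique _ _ (Rinfty R) (@ray_sets R) (fun=> setT)) => //.
- exact: measurable_RinftyE.
- move=> _ _ [s ->] [t ->]; exists (s ++ t).
  by apply/seteqP; split => u /=; rewrite /in_rays all_cat => /andP.
- by move=> _; exists [::]; apply/seteqP; split.
- by rewrite bigcup_const.
- move=> _ [s ->].
  have e (d : measure_display) (W : measurableType d) (Q : probability W R) (z : W -> nat -> R) :
      measurable_fun setT (z : W -> Rinfty R) ->
      Q (z @^-1` [set u | in_rays s u]) = (\int[Q]_w (in_rays s (z w))%:R)%:E.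
    move=> mz; have mC : measurable (z @^-1` [set u | in_rays s u]).
      by rewrite -[X in measurable X]setTI; exact: mz.
    have -> : (fun w => (in_rays s (z w))%:R : R) = \1_(z @^-1` [set u | in_rays s u]).
      apply/funext => w; rewrite indicE.
      by case E : (in_rays s (z w)); [rewrite mem_set|rewrite memNset//= E].
    by rewrite /Rintegral integral_indic// setIT fineK// fin_num_measure.
  by rewrite /= /pushforward (e _ _ _ _ m1) (e _ _ _ _ m2) (rays_Rintegral_eq mz1 mz2 fe).
- by move=> _; rewrite /= /pushforward preimage_setT probability_setT ltry.
Qed.

(** * The domination weight of a randomized shift *)

(** The reciprocal of one plus the density of Law[X + Y] with respect to
    Law[X] is a strictly positive weight under which X + Y is dominated
    by X. *)
Lemma shift_weight (R : realType) (H : completeNormedModType R) (e : nat -> H)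
    (dW : measure_display) (W : measurableType dW) (P : probability W R) (X : H -> L0 P)
    (dT : measure_display) (T : measurableType dT) (mu : probability T R) (Y : H -> L0 mu) :
  randomized_shift e X Y ->
  exists w : Rinfty R -> R,
    [/\ measurable_fun setT w, forall u, 0 < w u <= 1
      & forall F : Rinfty R -> \bar R, measurable_fun setT F -> (forall u, 0 <= F u)%E ->
        (\int[P \x mu]_z ((w (coordinates e X z.1 \+ coordinates e Y z.2))%:E *
                          F (coordinates e X z.1 \+ coordinates e Y z.2)%R) <=
         \int[P]_t F (coordinates e X t))%E].
Proof.
move=> [_ ac].
have mX : measurable_fun setT (coordinates e X : W -> Rinfty R).
  by apply: measurable_to_Rinfty => k; exact: measurable_L0.
pose S (z : W * T) : Rinfty R := (coordinates e X z.1 \+ coordinates e Y z.2)%R.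
have mS : measurable_fun setT S.
  apply: measurable_to_Rinfty => k; apply: measurable_funD.
    by apply: (measurableT_comp (measurable_L0 _)); exact: measurable_fst.
  by apply: (measurableT_comp (measurable_L0 _)); exact: measurable_snd.
pose Xf : {mfun W >-> Rinfty R} := HB.pack (coordinates e X) (isMeasurableFun.Build _ _ _ _ _ mX).
pose Sf : {mfun (W * T)%type >-> Rinfty R} := HB.pack S (isMeasurableFun.Build _ _ _ _ _ mS).
pose ga := distribution P Xf.
pose nu := distribution (P \x mu)%E Sf.
have ng : nu `<< ga by exact: ac.
pose D := Radon_Nikodym_SigmaFinite.f nu ga.
have D0 u : (0 <= D u)%E by exact: Radon_Nikodym_SigmaFinite.f_ge0.
have Df u : D u \is a fin_num by exact: Radon_Nikodym_SigmaFinite.f_fin_num.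
have mD : measurable_fun setT D.
  exact: measurable_int (Radon_Nikodym_SigmaFinite.f_integrable ng).
have fD0 u : 0 <= fine (D u) by rewrite fine_ge0.
pose w u := (1 + fine (D u))^-1.
have w01 u : 0 < w u <= 1.
  have ? : 0 < 1 + fine (D u) by rewrite ltr_pwDl.
  by rewrite invr_gt0 invf_le1// lerDl fD0 andbT.
have mw : measurable_fun setT w.
  have -> : w = (fun x : R => (1 + Num.max 0 x)^-1) \o (fine \o D).
    by apply/funext => u; rewrite /w/= max_r.
  apply: measurableT_comp; last first.
    by apply: measurableT_comp => //; exact: measurable_fine.
  apply: continuous_measurable_fun => x.
  apply: cvgV; first by rewrite gt_eqF// ltr_pwDl// le_max lexx.
  apply: cvgD; first exact: cvg_cst.
  by apply: continuous_max; [exact: cvg_cst|exact: cvg_id].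
exists w; split => // F mF F0.
have mwF : measurable_fun setT (fun u => (w u)%:E * F u)%E.
  by apply: emeasurable_funM => //; exact/measurable_EFinP.
have wF0 u : (0 <= (w u)%:E * F u)%E.
  by apply: mule_ge0 => //; rewrite lee_fin; case/andP: (w01 u) => /ltW.
have -> : (\int[P \x mu]_z ((w (S z))%:E * F (S z)) = \int[nu]_u ((w u)%:E * F u))%E.
  by rewrite /nu ge0_integral_distribution.
have -> : (\int[P]_t F (coordinates e X t) = \int[ga]_u F u)%E.
  by rewrite /ga ge0_integral_distribution.
rewrite -(Radon_Nikodym_SigmaFinite.change_of_variables ng)//.
apply: ge0_le_integral => //.
- by move=> u _; apply: mule_ge0.
- exact: emeasurable_funM.
- move=> u _; rewrite muleAC -[leRHS]mul1e; apply: lee_wpmul2r => //.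
  rewrite -/D -(fineK (Df u)) -EFinM lee_fin /w mulrC ler_pdivrMr ?ltr_pwDl//.
  by rewrite mul1r lerDr.
Qed.

Section HilbertForm.
Context (R : realType) (H : completeNormedModType R) (dot : {dot H for idfun}).

Lemma dotC (x y : H) : dot x y = dot y x.
Proof. by rewrite hermC/= expr0 mul1r. Qed.

Lemma dotDl (x y z : H) : dot (x + y) z = dot x z + dot y z.
Proof. exact: linearDl. Qed.

Lemma dotZl (a : R) (x z : H) : dot (a *: x) z = a * dot x z.
Proof. exact: linearZl_LR. Qed.

Lemma dotDr (x y z : H) : dot z (x + y) = dot z x + dot z y.
Proof. by rewrite dotC dotDl !(dotC z). Qed.

Lemma dotZr (a : R) (x z : H) : dot z (a *: x) = a * dot z x.
Proof. by rewrite dotC dotZl (dotC z). Qed.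

Lemma dot0l (z : H) : dot 0 z = 0.
Proof. by rewrite -(scale0r 0) dotZl mul0r. Qed.

Lemma dotBl (x y z : H) : dot (x - y) z = dot x z - dot y z.
Proof. by rewrite -scaleN1r dotDl dotZl mulN1r. Qed.

Lemma dotBr (x y z : H) : dot z (x - y) = dot z x - dot z y.
Proof. by rewrite dotC dotBl !(dotC z). Qed.

Lemma dot_suml (I : Type) (s : seq I) (f : I -> H) (z : H) :
  dot (\sum_(i <- s) f i) z = \sum_(i <- s) dot (f i) z.
Proof.
elim: s => [|i s IH]; first by rewrite !big_nil dot0l.
by rewrite !big_cons dotDl IH.
Qed.

Lemma dot_sumr (I : Type) (s : seq I) (f : I -> H) (z : H) :
  dot z (\sum_(i <- s) f i) = \sum_(i <- s) dot z (f i).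
Proof. by rewrite dotC dot_suml; apply: eq_bigr => i _; rewrite dotC. Qed.

Hypothesis hH : hilbert_norm dot.

Lemma sqr_norm_comb (c : seq (R * nat)) (f : nat -> H) :
  `|\sum_(p <- c) p.1 *: f p.2| ^+ 2 =
  \sum_(p <- c) \sum_(q <- c) p.1 * q.1 * dot (f p.2) (f q.2).
Proof.
rewrite -hH dot_suml; apply: eq_bigr => p _.
rewrite dot_sumr; apply: eq_bigr => q _.
by rewrite dotZl dotZr mulrA.
Qed.

End HilbertForm.

Lemma generalized_comb (R : realType) (H : completeNormedModType R)
    (d : measure_display) (T : measurableType d) (mu : probability T R) (Y : H -> L0 mu) :
  generalized_function Y -> forall (c : seq (R * nat)) (f : nat -> H),
  L0_fun (Y (\sum_(p <- c) p.1 *: f p.2)) = (fun t => linear_form c (fun k => Y (f k) t)) %[ae mu].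
Proof.
move=> [lin _] c f; elim: c => [|p c IH].
  rewrite big_nil; have := lin (-1) 0 0; rewrite scaleN1r oppr0 addr0.
  apply: filterS => t /= /(_ I) h _.
  by rewrite /linear_form big_nil; lra.
rewrite big_cons; apply: (filterS2 _ _ (lin p.1 (f p.2) (\sum_(p0 <- c) p0.1 *: f p0.2)) IH).
by move=> t /= /(_ I) h1 /(_ I) h2 _; rewrite linear_form_cons h1 h2.
Qed.

Lemma integrable_prodM (R : realType)
    (d1 : measure_display) (T1 : measurableType d1) (Q1 : probability T1 R)
    (d2 : measure_display) (T2 : measurableType d2) (Q2 : probability T2 R)
    (f : T1 -> R) (g : T2 -> R) :
  Q1.-integrable setT (EFin \o f) -> Q2.-integrable setT (EFin \o g) ->
  (Q1 \x Q2)%E.-integrable setT (EFin \o (fun z : T1 * T2 => f z.1 * g z.2)) /\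
  \int[(Q1 \x Q2)%E]_z (f z.1 * g z.2) = \int[Q1]_x f x * \int[Q2]_y g y.
Proof.
move=> fi gi.
have mf : measurable_fun setT f by apply/measurable_EFinP; exact: measurable_int fi.
have mg : measurable_fun setT g by apply/measurable_EFinP; exact: measurable_int gi.
have mfg : measurable_fun setT (EFin \o (fun z : T1 * T2 => f z.1 * g z.2)).
  by apply/measurable_EFinP/measurable_funM; exact: measurableT_comp.
have fgi : (Q1 \x Q2)%E.-integrable setT (EFin \o (fun z : T1 * T2 => f z.1 * g z.2)).
  apply/(integrable12ltyP _ _ mfg) => /=.
  have inner x : (\int[Q2]_y `|(f x * g y)%:E| = `|f x|%:E * \int[Q2]_y `|(g y)%:E|)%E.
    rewrite -ge0_integralZl_EFin//.
    - by apply: eq_integral => y _; rewrite -EFinM /= normrM.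
    - by apply/measurable_EFinP; exact: measurableT_comp.
  under eq_integral do rewrite inner.
  have /integrableP[_ glt] := gi; have /integrableP[_ flt] := fi.
  rewrite ge0_integralZr//; last 2 first.
  - by apply/measurable_EFinP; exact: measurableT_comp.
  - exact: integral_ge0.
  rewrite lte_mul_pinfty//; first exact: integral_ge0.
  by rewrite ge0_fin_numE//; exact: integral_ge0.
split=> //; rewrite /Rintegral -(integral12_prod_meas1 fgi) /fubini_F /=.
have gE : (\int[Q2]_y (g y)%:E = (\int[Q2]_y g y)%:E)%E by rewrite EFin_Rintegral.
have fE : (\int[Q1]_y (f y)%:E = (\int[Q1]_y f y)%:E)%E by rewrite EFin_Rintegral.
have inner x : (\int[Q2]_y (f x * g y)%:E = (\int[Q2]_y g y)%:E * (f x)%:E)%E.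
  by rewrite -gE muleC -(integralZl _ gi).
under eq_integral do rewrite inner.
by rewrite integralZl// fE mulrC.
Qed.

(** * Sign flips of Gaussian replicas *)

(** An R^oo-valued sequence is read as [k] interleaved sequences, the [i]-th
    term of the [j]-th one being the term of index [k * i + j]; here [k = K.+1].
    From two sequences, [replicate] produces a [k]-tuple whose mean is [x1]
    divided by [sqrt k] and whose deviations from the mean come from [x2]. *)
Definition replicate (R : realType) (K : nat) (x1 x2 : nat -> R) (m : nat) : R :=
  (Num.sqrt K.+1%:R)^-1 * x1 (m %/ K.+1)%N +
  (x2 m - K.+1%:R^-1 * \sum_(l < K.+1) x2 (K.+1 * (m %/ K.+1) + l)%N).

Lemma divn_interleave (K i : nat) (j : 'I_K.+1) : ((K.+1 * i + j) %/ K.+1 = i)%N.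
Proof. by rewrite mulnC divnMDl// divn_small ?addn0. Qed.

Lemma replicate_mean (R : realType) (K : nat) (x1 x2 : nat -> R) (i : nat) :
  (Num.sqrt K.+1%:R)^-1 * \sum_(j < K.+1) replicate K x1 x2 (K.+1 * i + j)%N = x1 i.
Proof.
have r0 : Num.sqrt K.+1%:R != 0 :> R by rewrite gt_eqF// sqrtr_gt0.
have r2 : Num.sqrt K.+1%:R ^+ 2 = K.+1%:R :> R by rewrite sqr_sqrtr.
rewrite /replicate; under eq_bigr do rewrite divn_interleave.
rewrite big_split/= sumrB !sumr_const card_ord -[X in _ - X]mulr_natl.
rewrite mulVKf ?pnatr_eq0// subrr addr0.
move: r0 r2; set r := Num.sqrt _; clearbody r => r0 r2.
have -> : r^-1 * x1 i *+ K.+1 = K.+1%:R * (r^-1 * x1 i) by rewrite mulr_natl.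
by rewrite -r2; field.
Qed.

Lemma replicate_shift (R : realType) (K : nat) (x1 x2 y : nat -> R) :
  replicate K (x1 \+ y) x2 =
  (fun m => replicate K x1 x2 m + (Num.sqrt K.+1%:R)^-1 * y (m %/ K.+1)%N).
Proof. by apply/funext => m; rewrite /replicate/= mulrDr addrAC. Qed.

Lemma sum_interleave_delta (R : realType) (K m b : nat) :
  \sum_(l < K.+1) (m == K.+1 * b + l)%N%:R = (m %/ K.+1 == b)%N%:R :> R.
Proof.
have e (l : 'I_K.+1) : (m == K.+1 * b + l)%N = (m %/ K.+1 == b)%N && (m %% K.+1 == l)%N.
  apply/eqP/andP => [->|[/eqP <- /eqP <-]].
    by rewrite divn_interleave mulnC modnMDl modn_small// !eqxx.
  by rewrite mulnC -divn_eq.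
rewrite (bigD1 (inord (m %% K.+1)))//= e inordK ?ltn_pmod// eqxx andbT.
rewrite big1 ?addr0// => l lm; rewrite e andbC.
case: eqP => //= ml; case/eqP: lm; apply: val_inj => /=.
by rewrite inordK ?ltn_pmod.
Qed.

Section Replicas.
Context (R : realType) (H : completeNormedModType R) (dot : {dot H for idfun}) (e : nat -> H).
Context (hH : hilbert_norm dot) (he : orthonormal_basis dot e).
Context (dW : measure_display) (W : measurableType dW) (P : probability W R) (X : H -> L0 P).
Context (hX : standard_gaussian X) (K : nat).

Let f m : H := (Num.sqrt K.+1%:R)^-1 *: e (m %/ K.+1)%N.
Let h m : H := e m - K.+1%:R^-1 *: \sum_(l < K.+1) e (K.+1 * (m %/ K.+1) + l)%N.

(** The replica of index [m] is [X (f m)] on one copy of the probability space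
    plus [X (h m)] on an independent one; its covariance is that of white
    noise. *)
Let gram m m' : dot (f m) (f m') + dot (h m) (h m') = (m == m')%:R.
Proof.
have [eo _] := he; set a := (m %/ K.+1)%N; set b := (m' %/ K.+1)%N.
have k0 : K.+1%:R != 0 :> R by rewrite pnatr_eq0.
have r2 : (Num.sqrt K.+1%:R)^-1 * (Num.sqrt K.+1%:R)^-1 = K.+1%:R^-1 :> R.
  by rewrite -invfM -expr2 sqr_sqrtr.
rewrite /f /h -/a -/b dotZl dotZr eo mulrA r2.
rewrite dotBl !dotBr !dotZr !dotZl eo dot_sumr !dot_suml.
under eq_bigr do rewrite eo; rewrite sum_interleave_delta -/a.
under eq_bigr do rewrite eo eq_sym; rewrite sum_interleave_delta -/b.
have -> : \sum_(i < K.+1) dot (e (K.+1 * a + i)%N) (\sum_(l < K.+1) e (K.+1 * b + l)%N) =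
    K.+1%:R * (a == b)%:R.
  under eq_bigr do rewrite dot_sumr.
  transitivity (\sum_(i < K.+1) (a == b)%:R : R).
    apply: eq_bigr => i _; under eq_bigr do rewrite eo.
    by rewrite sum_interleave_delta divn_interleave.
  by rewrite sumr_const card_ord mulr_natl.
rewrite (eq_sym b a); move: ((a == b)%:R : R) ((m == m')%:R : R) => A B.
by field.
Qed.

Let B (z : W * W) : nat -> R := replicate K (coordinates e X z.1) (coordinates e X z.2).

Lemma measurable_replicas m : measurable_fun setT (fun z => B z m).
Proof.
have m1 k : measurable_fun setT (fun z : W * W => coordinates e X z.1 k).
  by apply: (measurableT_comp (measurable_L0 _)); exact: measurable_fst.
have m2 k : measurable_fun setT (fun z : W * W => coordinates e X z.2 k).
  by apply: (measurableT_comp (measurable_L0 _)); exact: measurable_snd.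
apply: measurable_funD; first exact: measurable_funM.
apply: measurable_funB => //; apply: measurable_funM => //.
exact: measurable_sum.
Qed.

(** A linear form of the replicas is a sum of independent Gaussian variables
    [X u] and [X v]; by [gram] the squared norms of [u] and [v] add up to that of
    the vector with the coefficients of the form. *)
Lemma replicas_fourier (c : seq (R * nat)) (theta : R) :
  \int[(P \x P)%E]_z cos (linear_form c (B z) - theta) =
  cos theta * \int[P]_w cos (X (\sum_(p <- c) p.1 *: e p.2) w).
Proof.
pose c1 := [seq (p.1 * (Num.sqrt K.+1%:R)^-1, (p.2 %/ K.+1)%N) | p <- c].
pose c2 := flatten [seq p :: [seq (- (p.1 * K.+1%:R^-1), (K.+1 * (p.2 %/ K.+1) + l)%N) | l : 'I_K.+1 <- index_enum 'I_K.+1] | p <- c].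
pose U w := linear_form c1 (coordinates e X w).
pose V w := linear_form c2 (coordinates e X w).
have BUV z : linear_form c (B z) = U z.1 + V z.2.
  rewrite /U /V /linear_form /c1 /c2 big_map big_flatten big_map -big_split/=.
  apply: eq_bigr => p _; rewrite /B /replicate big_cons big_map/= mulrDr mulrA; congr (_ + _).
  rewrite mulrBr; congr (_ + _).
  by rewrite mulrA mulr_sumr -sumrN; apply: eq_bigr => l _; rewrite mulNr.
pose u := \sum_(p <- c) p.1 *: f p.2.
pose v := \sum_(p <- c) p.1 *: h p.2.
have Xu : L0_fun (X u) = U %[ae P].
  have := generalized_comb hX.1 c1 e; rewrite (_ : \sum_(p <- c1) _ = u)//.
  by rewrite /c1 big_map; apply: eq_bigr => p _; rewrite /f scalerA.
have Xv : L0_fun (X v) = V %[ae P].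
  have := generalized_comb hX.1 c2 e; rewrite (_ : \sum_(p <- c2) _ = v)//.
  rewrite /c2 big_flatten big_map; apply: eq_bigr => p _.
  rewrite big_cons big_map/= /h scalerBr; congr (_ + _).
  rewrite scalerA scaler_sumr -sumrN; apply: eq_bigr => l _.
  by rewrite scaleNr.
have mU : measurable_fun setT U.
  by apply: measurable_sum => p; apply: measurable_funM => //; exact: measurable_L0.
have mV : measurable_fun setT V.
  by apply: measurable_sum => p; apply: measurable_funM => //; exact: measurable_L0.
have EcU : \int[P]_w cos (U w) = \int[P]_w cos (X u w).
  apply: Rintegral_ae_eq; [exact: measurable_cos_fun|exact/measurable_cos_fun/measurable_L0|].
  by apply: filterS Xu => w /= /(_ I) ->.
have EsU : \int[P]_w sin (U w) = 0.
  rewrite -(gaussian_sin hX u).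
  apply: Rintegral_ae_eq; [exact: measurable_sin_fun|exact/measurable_sin_fun/measurable_L0|].
  by apply: filterS Xu => w /= /(_ I) ->.
have EcV : \int[P]_w cos (V w) = \int[P]_w cos (X v w).
  apply: Rintegral_ae_eq; [exact: measurable_cos_fun|exact/measurable_cos_fun/measurable_L0|].
  by apply: filterS Xv => w /= /(_ I) ->.
have EsV : \int[P]_w sin (V w) = 0.
  rewrite -(gaussian_sin hX v).
  apply: Rintegral_ae_eq; [exact: measurable_sin_fun|exact/measurable_sin_fun/measurable_L0|].
  by apply: filterS Xv => w /= /(_ I) ->.
have PM (a b : W -> R) : measurable_fun setT a -> measurable_fun setT b ->
    (forall x, `|a x| <= 1) -> (forall x, `|b x| <= 1) ->
    (P \x P)%E.-integrable setT (EFin \o (fun z : W * W => a z.1 * b z.2)) /\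
    \int[(P \x P)%E]_z (a z.1 * b z.2) = \int[P]_w a w * \int[P]_w b w.
  move=> ma mb a1 b1; apply: integrable_prodM.
    exact: (@integrable_bounded _ _ _ P _ 1).
  exact: (@integrable_bounded _ _ _ P _ 1).
have mcU := measurable_cos_fun mU; have msU := measurable_sin_fun mU.
have mcV := measurable_cos_fun mV; have msV := measurable_sin_fun mV.
transitivity (\int[(P \x P)%E]_z (cos theta * (cos (U z.1) * cos (V z.2)) +
   (- cos theta * (sin (U z.1) * sin (V z.2)) + (sin theta * (sin (U z.1) * cos (V z.2)) +
     sin theta * (cos (U z.1) * sin (V z.2)))))).
  apply: eq_Rintegral => z _; rewrite BUV cosB cosD sinD; ring.
have nc x : `|cos x| <= 1 :> R := normr_cos_le1 x.
have ns x : `|sin x| <= 1 :> R := normr_sin_le1 x.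
have [i1 e1] := PM _ _ mcU mcV (fun x => nc _) (fun x => nc _).
have [i2 e2] := PM _ _ msU msV (fun x => ns _) (fun x => ns _).
have [i3 e3] := PM _ _ msU mcV (fun x => ns _) (fun x => nc _).
have [i4 e4] := PM _ _ mcU msV (fun x => nc _) (fun x => ns _).
rewrite !RintegralD//; do ?[exact: integrableRZ | apply: integrableRD].
rewrite !RintegralZl//.
rewrite e1 e2 e3 e4.
rewrite EsU EsV EcU EcV !(mul0r, mulr0) !addr0.
rewrite (@gaussian_cosM _ _ _ _ _ _ hX u v (\sum_(p <- c) p.1 *: e p.2))//.
rewrite !(sqr_norm_comb hH) -big_split/=; apply: eq_bigr => p _.
rewrite -big_split/=; apply: eq_bigr => q _.
by rewrite -mulrDr gram (he.1).
Qed.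

(** A sequence on some probability space with the Fourier transforms of
    [coordinates e X]; this determines its law. *)
Definition white_noise (d : measure_display) (Om : measurableType d)
    (Q : probability Om R) (z : Om -> nat -> R) : Prop :=
  (forall m, measurable_fun setT (fun w => z w m)) /\
  forall (c : seq (R * nat)) (theta : R),
    \int[Q]_w cos (linear_form c (z w) - theta) =
    cos theta * \int[P]_w cos (X (\sum_(p <- c) p.1 *: e p.2) w).

Lemma white_noise_law (d1 : measure_display) (W1 : measurableType d1) (Q1 : probability W1 R)
    (d2 : measure_display) (W2 : measurableType d2) (Q2 : probability W2 R)
    (z1 : W1 -> nat -> R) (z2 : W2 -> nat -> R) :
  white_noise Q1 z1 -> white_noise Q2 z2 ->
  forall Psi : Rinfty R -> \bar R, measurable_fun setT Psi -> (forall u, 0 <= Psi u)%E ->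
  (\int[Q1]_w Psi (z1 w) = \int[Q2]_w Psi (z2 w))%E.
Proof.
move=> [m1 h1] [m2 h2]; apply: Rinfty_law_unique => // c theta.
by rewrite h1 h2.
Qed.

(** Changing signs in a finite linear form does not change its norm, hence
    neither its Fourier transform. *)
Lemma white_noise_flip (d : measure_display) (Om : measurableType d)
    (Q : probability Om R) (z : Om -> nat -> R) (s : nat -> R) :
  (forall m, s m * s m = 1) -> white_noise Q z -> white_noise Q (fun w m => s m * z w m).
Proof.
move=> s1 [mz hz]; split=> [m|c theta]; first exact: measurable_funM.
pose c' := [seq (p.1 * s p.2, p.2) | p <- c].
have E (w : Om) : linear_form c (fun m => s m * z w m) = linear_form c' (z w).
  by rewrite /linear_form /c' big_map; apply: eq_bigr => p _ /=; rewrite mulrA.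
under eq_Rintegral do rewrite E.
rewrite hz; congr (_ * _).
apply: (gaussian_Rintegral_eq hX (f := cos)).
- apply: (@pexpIrn _ 2); rewrite ?nnegrE//.
  rewrite (sqr_norm_comb hH) (sqr_norm_comb hH) /c' big_map.
  apply: eq_bigr => p _; rewrite big_map; apply: eq_bigr => q _ /=.
  rewrite (he.1); case: eqP => [->|_]; last by rewrite !mulr0.
  by rewrite !mulr1 mulrACA s1 mulr1.
- by apply: continuous_measurable_fun; exact: continuous_cos.
- by move=> x; exact: normr_cos_le1.
Qed.

Lemma white_noise_coordinates : white_noise P (coordinates e X).
Proof.
split=> [m|c theta]; first exact: measurable_L0.
have Xc := generalized_comb hX.1 c e.
set v := \sum_(p <- c) _ in Xc *.
have mc : measurable_fun setT (fun w => linear_form c (coordinates e X w)).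
  by apply: measurable_sum => p; apply: measurable_funM => //; exact: measurable_L0.
transitivity (\int[P]_w (cos theta * cos (X v w) + sin theta * sin (X v w))).
  apply: Rintegral_ae_eq.
  - by apply: measurable_cos_fun; apply: measurable_funB.
  - apply: measurable_funD; apply: measurable_funM => //.
      exact/measurable_cos_fun/measurable_L0.
    exact/measurable_sin_fun/measurable_L0.
  - by apply: filterS Xc => w /= /(_ I) -> _; rewrite cosB mulrC (mulrC (sin _)).
have ic : P.-integrable setT (EFin \o (fun w => cos (X v w))).
  apply: (@integrable_bounded _ _ _ P _ 1); last by move=> x; exact: normr_cos_le1.
  exact/measurable_cos_fun/measurable_L0.
have is_ : P.-integrable setT (EFin \o (fun w => sin (X v w))).
  apply: (@integrable_bounded _ _ _ P _ 1); last by move=> x; exact: normr_sin_le1.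
  exact/measurable_sin_fun/measurable_L0.
rewrite RintegralD//; [|exact: integrableRZ|exact: integrableRZ].
by rewrite !RintegralZl// gaussian_sin// mulr0 addr0.
Qed.

Lemma white_noise_replicas : white_noise (P \x P)%E B.
Proof. by split; [exact: measurable_replicas|exact: replicas_fourier]. Qed.

Lemma coordinates_moment_eq (m m' j : nat) :
  (\int[P]_w (coordinates e X w m ^+ j.*2)%:E = \int[P]_w (coordinates e X w m' ^+ j.*2)%:E)%E.
Proof.
apply: (@gaussian_ge0_integral_eq _ _ _ _ _ _ hX (e m) (e m') (fun x => x ^+ j.*2)).
- by apply: (@pexpIrn _ 2); rewrite ?nnegrE// -!hH !(he.1) !eqxx.
- exact: exprn_measurable.
- by move=> x; rewrite exprn_even_ge0// odd_double.
Qed.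

(** No factor exceeds the largest one. *)
Lemma prod_le_sum_pow (n : nat) (x : 'I_n.+1 -> R) : (forall j, 0 <= x j) ->
  \prod_(j < n.+1) x j <= \sum_(j < n.+1) x j ^+ n.+1.
Proof.
move=> x0; case: (@arg_maxP _ _ _ (ord0 : 'I_n.+1) xpredT x isT) => j0 _ jmax.
apply: (@le_trans _ _ (x j0 ^+ n.+1)).
  rewrite -[X in _ ^+ X]card_ord -prodr_const; apply: ler_prod => j _.
  by apply/andP; split; [exact: x0|exact: jmax].
by rewrite (bigD1 j0)//= lerDl sumr_ge0// => j _; rewrite exprn_ge0.
Qed.

(** The decoupled monomial: its [j]-th factor is read in the [j]-th of the
    interleaved sequences. *)
Definition block_monomial (i : K.+1.-tuple nat) (b : nat -> R) : R :=
  \prod_(j < K.+1) b (K.+1 * tnth i j + j)%N.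

Definition block_form (s : seq (K.+1.-tuple nat)) (a : K.+1.-tuple nat -> R) (b : nat -> R) : R :=
  \sum_(i <- s) a i * block_monomial i b.

Let x := coordinates e X.
Let M : R := fine (\int[P]_w (x w 0%N ^+ K.+1.*2)%:E)%E.

Let x2i m : P.-integrable setT (EFin \o (fun w => x w m ^+ K.+1.*2)).
Proof.
apply/integrableP; split.
  exact/measurable_EFinP/measurable_funX/measurable_L0.
under eq_integral do rewrite /= ger0_norm ?exprn_even_ge0 ?odd_double//.
exact: gaussian_moment_lty.
Qed.

Let x2E m : \int[P]_w (x w m ^+ K.+1.*2) = M.
Proof. by rewrite /Rintegral (coordinates_moment_eq m 0). Qed.

Let mx m : measurable_fun setT (fun w => x w m).
Proof. exact: measurable_L0. Qed.

Let mmon i : measurable_fun setT (fun w => block_monomial i (x w)).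
Proof. by apply: measurable_prod => j _. Qed.

Let mon2_le i w : block_monomial i (x w) ^+ 2 <=
  \sum_(j < K.+1) x w (K.+1 * tnth i j + j)%N ^+ K.+1.*2.
Proof.
rewrite /block_monomial -prodrXl; apply: le_trans (prod_le_sum_pow _) _.
  by move=> j; rewrite sqr_ge0.
by apply: ler_sum => j _; rewrite -exprM mul2n.
Qed.

Let mon2i i : P.-integrable setT (EFin \o (fun w => block_monomial i (x w) ^+ 2)).
Proof.
have si := integrableR_sum (index_enum 'I_K.+1) (fun j => x2i (K.+1 * tnth i j + j)%N).
apply: le_integrable si => //.
  exact/measurable_EFinP/measurable_funX.
move=> w _; rewrite /= lee_fin ger0_norm ?sqr_ge0//.
exact: le_trans (mon2_le i w) (ler_norm _).
Qed.

Let monMi i i' : P.-integrable setT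
  (EFin \o (fun w => block_monomial i (x w) * block_monomial i' (x w))).
Proof.
apply: le_integrable (integrableRD (mon2i i) (mon2i i')) => //.
  exact/measurable_EFinP/measurable_funM.
move=> w _; rewrite /= lee_fin.
set u := block_monomial i _; set v := block_monomial i' _.
rewrite (ger0_norm (addr_ge0 (sqr_ge0 _) (sqr_ge0 _))) ler_norml.
have := sqr_ge0 (u - v); have := sqr_ge0 (u + v).
have := sqr_ge0 u; have := sqr_ge0 v.
by rewrite sqrrD sqrrB => h1 h2 h3 h4; apply/andP; split; lra.
Qed.

(** The residue modulo [k] separates the factors of a block monomial, so a
    variable in which two block monomials differ occurs once in their product;
    flipping its sign shows that the product has mean zero. *)
Let monM_ortho i i' : i != i' ->
  \int[P]_w (block_monomial i (x w) * block_monomial i' (x w)) = 0.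
Proof.
move=> ii'.
have [j0 ij0] : exists j0, tnth i j0 != tnth i' j0.
  apply/existsP; apply: contraR ii'; rewrite negb_exists => /forallP eqt.
  by apply/eqP/eq_from_tnth => j; apply/eqP; move: (eqt j); rewrite negbK.
pose m0 := (K.+1 * tnth i j0 + j0)%N.
pose s (m : nat) : R := if m == m0 then -1 else 1.
have s1 m : s m * s m = 1 by rewrite /s; case: ifP; rewrite ?mulrNN mulr1.
have inj (p q : nat) (j j' : 'I_K.+1) : (K.+1 * p + j == K.+1 * q + j')%N = (p == q) && (j == j').
  apply/eqP/andP => [eqm|[/eqP -> /eqP ->]//].
  have := congr1 (fun n => n %/ K.+1)%N eqm; rewrite !divn_interleave => pq.
  by split; [exact/eqP|apply/eqP/val_inj => /=; move: eqm; rewrite pq => /addnI].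
have ss i1 (u : nat -> R) : block_monomial i1 (fun m => s m * u m) =
   (\prod_(j < K.+1) s (K.+1 * tnth i1 j + j)%N) * block_monomial i1 u.
  by rewrite /block_monomial big_split.
have si : \prod_(j < K.+1) s (K.+1 * tnth i j + j)%N = -1.
  rewrite (bigD1 j0)//= big1 ?mulr1; first by rewrite /s eqxx.
  by move=> j jj0; rewrite /s inj (negbTE jj0) andbF.
have si' : \prod_(j < K.+1) s (K.+1 * tnth i' j + j)%N = 1.
  rewrite big1// => j _; rewrite /s inj; case: ifP => // /andP[/eqP h1 /eqP h2].
  by case/eqP: ij0; rewrite -h1 h2.
have wn := white_noise_coordinates.
have law := white_noise_law wn (white_noise_flip s1 wn).
pose p (u : nat -> R) : R := block_monomial i u * block_monomial i' u.
have ps u : p (fun m => s m * u m) = - p u by rewrite /p !ss si si' mul1r mulN1r mulNr.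
have mp : measurable_fun setT (p : Rinfty R -> R).
  by apply: measurable_funM; apply: measurable_prod => j _; exact: measurable_Rinfty_coord.
pose q : Rinfty R -> \bar R := EFin \o p.
have mq : measurable_fun setT q by exact/measurable_EFinP.
have pos : (\int[P]_w q^\+ (x w) = \int[P]_w q^\- (x w))%E.
  rewrite (law (q^\+)%E).
  - by apply: eq_integral => w _; rewrite funeposE funenegE /q/= ps.
  - exact: measurable_funepos.
  - by move=> u; exact: funepos_ge0.
pose qx w : \bar R := (block_monomial i (x w) * block_monomial i' (x w))%:E.
have ep : (\int[P]_w qx^\+ w = \int[P]_w q^\+ (x w))%E.
  by apply: eq_integral => w _; rewrite !funeposE.
have en : (\int[P]_w qx^\- w = \int[P]_w q^\- (x w))%E.
  by apply: eq_integral => w _; rewrite !funenegE.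
rewrite /Rintegral -/qx integralE en -pos -ep subee//.
apply: integrable_fin_num => //.
exact: (integrable_funepos measurableT (monMi i i')).
Qed.

Lemma block_form_second_moment (s : seq (K.+1.-tuple nat)) (a : K.+1.-tuple nat -> R) :
  uniq s ->
  (\int[P]_w (block_form s a (x w) ^+ 2)%:E <= (K.+1%:R * M * \sum_(i <- s) a i ^+ 2)%:E)%E.
Proof.
move=> us.
have E w : block_form s a (x w) ^+ 2 = \sum_(i <- s) \sum_(i' <- s)
    (a i * a i') * (block_monomial i (x w) * block_monomial i' (x w)).
  rewrite expr2 /block_form mulr_suml; apply: eq_bigr => i _.
  by rewrite mulr_sumr; apply: eq_bigr => i' _; rewrite mulrACA.
have I1 i : P.-integrable setT (EFin \o (fun w => \sum_(i' <- s)
    (a i * a i') * (block_monomial i (x w) * block_monomial i' (x w)))).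
  by apply: integrableR_sum => i'; exact: integrableRZ.
under eq_integral do rewrite E.
rewrite -EFin_Rintegral; last exact: integrableR_sum.
rewrite lee_fin Rintegral_sum// mulr_sumr big_seq [leRHS]big_seq; apply: ler_sum => i si.
rewrite Rintegral_sum; last by move=> i'; exact: integrableRZ.
rewrite (bigD1_seq i)//= big1_seq ?addr0; last first.
  by move=> i' /andP[ii' _]; rewrite RintegralZl// monM_ortho 1?eq_sym// mulr0.
rewrite RintegralZl// mulrC -expr2 ler_wpM2r ?sqr_ge0//.
apply: (@le_trans _ _ (\int[P]_w \sum_(j < K.+1) x w (K.+1 * tnth i j + j)%N ^+ K.+1.*2)).
  apply: le_Rintegral => //; first exact: integrableR_sum.
  by move=> w _; rewrite -expr2; exact: mon2_le.
rewrite Rintegral_sum//; under eq_bigr do rewrite x2E.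
by rewrite sumr_const card_ord mulr_natl.
Qed.

Context (dT : measure_display) (T : measurableType dT) (mu : probability T R) (Y : H -> L0 mu).
Context (hY : randomized_shift e X Y).

(** One sign for each of the interleaved sequences. *)
Let sgn (sg : {ffun 'I_K.+1 -> bool}) (m : nat) : R :=
  if sg (inord (m %% K.+1)) then -1 else 1.

Let sgnM sg m : sgn sg m * sgn sg m = 1.
Proof. by rewrite /sgn; case: ifP; rewrite ?mulrNN mulr1. Qed.

Let sgnE sg (i : nat) (j : 'I_K.+1) :
  sgn sg (K.+1 * i + j)%N = if sg j then -1 else 1.
Proof.
rewrite /sgn mulnC modnMDl modn_small//; congr (if sg _ then _ else _).
by apply: val_inj; rewrite /= inordK.
Qed.

(** Averaging over the signs of the blocks kills every term of the expansion
    except the one free of [b]. *)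
Let block_form_flip s a (b y : nat -> R) :
  \sum_sg block_form s a (fun m => sgn sg m * b m + y m) = 2 ^+ K.+1 * block_form s a y.
Proof.
rewrite /block_form exchange_big/= mulr_sumr; apply: eq_bigr => i _.
rewrite -mulr_sumr mulrCA; congr (_ * _); rewrite /block_monomial.
transitivity (\sum_(sg : {ffun 'I_K.+1 -> bool}) \prod_(j < K.+1)
   ((if sg j then -1 else 1) * b (K.+1 * tnth i j + j)%N + y (K.+1 * tnth i j + j)%N)).
  by apply: eq_bigr => sg _; apply: eq_bigr => j _; rewrite sgnE.
rewrite -(bigA_distr_bigA (fun (j : 'I_K.+1) (t : bool) => (if t then -1 else 1) * b (K.+1 * tnth i j + j)%N + y (K.+1 * tnth i j + j)%N))/=.
rewrite -[X in _ ^+ X]card_ord -prodr_const -big_split/=; apply: eq_bigr => j _.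
by rewrite big_bool/= mulN1r mul1r; ring.
Qed.

(** [block_form_flip] and the convexity of the square. *)
Let block_form_flip_sqr s a (b y : nat -> R) :
  block_form s a y ^+ 2 <=
  (2 ^+ K.+1)^-1 * \sum_sg block_form s a (fun m => sgn sg m * b m + y m) ^+ 2.
Proof.
have N0 : 0 < 2 ^+ K.+1 :> R by rewrite exprn_gt0.
set A := block_form s a y.
pose F sg := block_form s a (fun m => sgn sg m * b m + y m).
have hA : \sum_sg F sg = 2 ^+ K.+1 * A := block_form_flip s a b y.
rewrite -[X in _ <= _ * X]/(\sum_sg F sg ^+ 2).
have : 0 <= \sum_sg (F sg - A) ^+ 2 by apply: sumr_ge0 => sg _; rewrite sqr_ge0.
under eq_bigr do rewrite sqrrB.
rewrite big_split/= sumrB sumrMnl -mulr_suml hA sumr_const.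
have cc : #|{: {ffun 'I_K.+1 -> bool}}| = (2 ^ K.+1)%N by rewrite card_ffun card_bool card_ord.
rewrite cc -[A ^+ 2 *+ _]mulr_natl natrX => h1.
rewrite ler_pdivlMl//; move: h1; set S2 := \sum_sg _.
move: (2 ^+ K.+1 : R) => N; rewrite expr2 mulr2n; lra.
Qed.

Let y t : nat -> R := coordinates e Y t.
(** Adding [ys t] to the replicas adds [y t] to their normalized mean. *)
Let ys t m : R := (Num.sqrt K.+1%:R)^-1 * y t (m %/ K.+1)%N.
Let mean (b : nat -> R) i : R := (Num.sqrt K.+1%:R)^-1 * \sum_(j < K.+1) b (K.+1 * i + j)%N.

Let my k : measurable_fun setT (fun t => y t k).
Proof. exact: measurable_L0. Qed.

Let measurable_block_form s a (d : measure_display) (U : measurableType d) (b : U -> nat -> R) :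
  (forall m, measurable_fun setT (fun u => b u m)) ->
  measurable_fun setT (fun u => block_form s a (b u)).
Proof.
move=> mb; apply: measurable_sum => i; apply: measurable_funM => //.
by apply: measurable_prod => j _.
Qed.

Let measurable_mean (d : measure_display) (U : measurableType d) (b : U -> nat -> R) i :
  (forall m, measurable_fun setT (fun u => b u m)) ->
  measurable_fun setT (fun u => mean (b u) i).
Proof. by move=> mb; apply: measurable_funM => //; exact: measurable_sum. Qed.

Let measurable_replicate (d : measure_display) (U : measurableType d) (b c : U -> nat -> R) m :
  (forall m, measurable_fun setT (fun u => b u m)) ->
  (forall m, measurable_fun setT (fun u => c u m)) ->
  measurable_fun setT (fun u => replicate K (b u) (c u) m).
Proof.
move=> mb mc; apply: measurable_funD; first exact: measurable_funM.
apply: measurable_funB => //; apply: measurable_funM => //.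
exact: measurable_sum.
Qed.

(** A flip preserves the law of the replicas, and adding [ys t] to them shifts
    their mean by [y t] without changing the deviations from it; the domination
    by [w] applies with the deviations frozen. *)
Let flip_estimate (w : Rinfty R -> R) s a sg :
  uniq s -> measurable_fun setT w -> (forall u, 0 < w u <= 1) ->
  (forall F : Rinfty R -> \bar R, measurable_fun setT F -> (forall u, 0 <= F u)%E ->
    (\int[P \x mu]_z ((w (coordinates e X z.1 \+ coordinates e Y z.2))%:E *
                      F (coordinates e X z.1 \+ coordinates e Y z.2)%R) <=
     \int[P]_t F (coordinates e X t))%E) ->
  (\int[mu]_t \int[P \x P]_z
     (w (mean (fun m => sgn sg m * B z m) \+ y t) *
      block_form s a (fun m => sgn sg m * B z m + ys t m) ^+ 2)%:E <=
   (K.+1%:R * M * \sum_(i <- s) a i ^+ 2)%:E)%E.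
Proof.
move=> us mw w01 hw.
have w0 u : 0 <= w u by case/andP: (w01 u) => /ltW.
have mwc (d : measure_display) (U : measurableType d) (b : U -> nat -> R) :
    (forall k, measurable_fun setT (fun u => b u k)) -> measurable_fun setT (fun u => w (b u)).
  by move=> mb; exact: (measurableT_comp mw (measurable_to_Rinfty mb)).
pose A u v : R := block_form s a (replicate K u v) ^+ 2.
have A0 u v : 0 <= A u v by rewrite sqr_ge0.
(* undo the flip, and separate the mean [x w1] from the deviations [x w2] *)
have step1 t : (\int[P \x P]_z
     (w (mean (fun m => sgn sg m * B z m) \+ y t) *
      block_form s a (fun m => sgn sg m * B z m + ys t m) ^+ 2)%:E =
   \int[P]_w2 \int[P]_w1 (w (x w1 \+ y t) * A (x w1 \+ y t) (x w2))%:E)%E.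
  pose Psi (b : Rinfty R) : \bar R :=
    (w (mean b \+ y t) * block_form s a (fun m => b m + ys t m) ^+ 2)%:E.
  have mPsi : measurable_fun setT Psi.
    apply/measurable_EFinP; apply: measurable_funM.
      apply: (mwc _ (Rinfty R) (fun b => mean b \+ y t)) => k.
      apply: measurable_funD => //; apply: (@measurable_mean _ (Rinfty R)) => m.
      exact: measurable_Rinfty_coord.
    apply: measurable_funX; apply: (@measurable_block_form s a _ (Rinfty R)) => m.
    by apply: measurable_funD => //; exact: measurable_Rinfty_coord.
  have Psi0 b : (0 <= Psi b)%E by rewrite lee_fin mulr_ge0// sqr_ge0.
  have wnB := white_noise_replicas.
  rewrite -[LHS](white_noise_law wnB (white_noise_flip (sgnM sg) wnB) mPsi Psi0).
  have PsiB z : Psi (B z) = (w (x z.1 \+ y t) * A (x z.1 \+ y t) (x z.2))%:E.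
    rewrite /Psi /A (_ : mean (B z) = x z.1); last by apply/funext => i; exact: replicate_mean.
    by rewrite replicate_shift.
  under eq_integral do rewrite PsiB.
  rewrite fubini_tonelli2//.
  - apply/measurable_EFinP/measurable_funM.
      apply: (mwc _ _ (fun z : W * W => x z.1 \+ y t)) => k.
      by apply: measurable_funD => //; exact: (measurableT_comp (mx k)).
    apply: measurable_funX; apply: measurable_block_form => m.
    apply: measurable_replicate => k; last exact: (measurableT_comp (mx k)).
    by apply: measurable_funD => //; exact: (measurableT_comp (mx k)).
  - by move=> z; rewrite lee_fin mulr_ge0.
under eq_integral do rewrite step1.
pose f3 (p : (T * W) * W) : \bar R :=
  (w (x p.2 \+ y p.1.1) * A (x p.2 \+ y p.1.1) (x p.1.2))%:E.
have mx2 k : measurable_fun setT (fun p : (T * W) * W => x p.2 k).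
  exact: (measurableT_comp (mx k)).
have mx1 k : measurable_fun setT (fun p : (T * W) * W => x p.1.2 k).
  apply: (measurableT_comp (mx k)).
  by apply: (measurableT_comp measurable_snd); exact: measurable_fst.
have my1 k : measurable_fun setT (fun p : (T * W) * W => y p.1.1 k).
  apply: (measurableT_comp (my k)).
  by apply: (measurableT_comp measurable_fst); exact: measurable_fst.
have mf3 : measurable_fun setT f3.
  apply/measurable_EFinP/measurable_funM.
    by apply: (mwc _ _ (fun p : (T * W) * W => x p.2 \+ y p.1.1)) => k; exact: measurable_funD.
  apply: measurable_funX; apply: measurable_block_form => m.
  by apply: measurable_replicate => k //; exact: measurable_funD.
have f30 p : (0 <= f3 p)%E by rewrite lee_fin mulr_ge0.
have mF := @measurable_fun_fubini_tonelli_F _ _ _ _ _ P f3 mf3 f30.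
have F0 q : (0 <= fubini_F P f3 q)%E by apply: integral_ge0.
have := @fubini_tonelli _ _ _ _ _ mu P (fubini_F P f3) mF F0.
rewrite /fubini_F/= => ->.
(* remove the shift at fixed [w2] *)
apply: (@le_trans _ _ (\int[P]_w2 \int[P]_w1 (A (x w1) (x w2))%:E)%E).
  apply: ge0_le_integral => //.
  - by move=> w2 _; apply: integral_ge0 => t _; apply: integral_ge0 => w1 _; rewrite lee_fin mulr_ge0.
  - exact: (@measurable_fun_fubini_tonelli_G _ _ _ _ _ mu (fubini_F P f3) mF F0).
  - apply: (@measurable_fun_fubini_tonelli_F _ _ _ _ _ P (fun p => (A (x p.2) (x p.1))%:E)).
    + apply/measurable_EFinP/measurable_funX/measurable_block_form => m.
      by apply: measurable_replicate => k; exact: (measurableT_comp (mx k)).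
    + by move=> p; rewrite lee_fin.
  - move=> w2 _.
    have mA : measurable_fun setT (fun u : Rinfty R => (A u (x w2))%:E).
      apply/measurable_EFinP/measurable_funX.
      apply: (@measurable_block_form s a _ (Rinfty R)) => m.
      by apply: (@measurable_replicate _ (Rinfty R)) => k //; exact: measurable_Rinfty_coord.
    apply: le_trans (hw _ mA (fun u => A0 u (x w2))).
    rewrite fubini_tonelli2//.
    + apply: emeasurable_funM; apply/measurable_EFinP.
        apply: (mwc _ _ (fun z : W * T => x z.1 \+ y z.2)) => k.
        by apply: measurable_funD; [exact: (measurableT_comp (mx k))|exact: (measurableT_comp (my k))].
      apply: measurable_funX; apply: measurable_block_form => m.
      apply: measurable_replicate => k //.
      by apply: measurable_funD; [exact: (measurableT_comp (mx k))|exact: (measurableT_comp (my k))].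
    + by move=> p; rewrite -EFinM lee_fin mulr_ge0.
rewrite -(fubini_tonelli2 (fun z : W * W => (A (x z.1) (x z.2))%:E)).
- pose Psi (b : Rinfty R) : \bar R := (block_form s a b ^+ 2)%:E.
  have := block_form_second_moment a us; apply: le_trans.
  rewrite le_eqVlt; apply/orP; left; apply/eqP.
  apply: (white_noise_law white_noise_replicas white_noise_coordinates (Psi := Psi)).
  + apply/measurable_EFinP/measurable_funX; apply: (@measurable_block_form s a _ (Rinfty R)) => m.
    exact: measurable_Rinfty_coord.
  + by move=> u; rewrite lee_fin sqr_ge0.
- apply/measurable_EFinP/measurable_funX/measurable_block_form => m.
  by apply: measurable_replicate => k; exact: (measurableT_comp (mx k)).
- by move=> p; rewrite lee_fin.
Qed.

(** The product of [w] over all sign patterns is positive and below each of its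
    factors, so that [flip_estimate] applies to every term of the average in
    [block_form_flip_sqr]. *)
Lemma shift_moment_weight : exists g : T -> R, exists C : R,
  [/\ measurable_fun setT g, forall t, 0 < g t <= 1, 0 <= C &
   forall (s : seq (K.+1.-tuple nat)) (a : K.+1.-tuple nat -> R), uniq s ->
    (\int[mu]_t (g t * (\sum_(i <- s) a i * \prod_(j < K.+1) y t (tnth i j)) ^+ 2)%:E <=
     (C * \sum_(i <- s) a i ^+ 2)%:E)%E].
Proof.
have [w [mw w01 hw]] := shift_weight hY.
have w0 u : 0 < w u by case/andP: (w01 u).
have w1 u : w u <= 1 by case/andP: (w01 u).
pose S sg z t : nat -> R := mean (fun m => sgn sg m * B z m) \+ y t.
pose wt z t : R := \prod_(sg : {ffun 'I_K.+1 -> bool}) w (S sg z t).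
have wt0 z t : 0 < wt z t by apply: prodr_gt0 => sg _.
have wt1 z t : wt z t <= 1 by apply: prodr_ile1 => sg _; rewrite ltW/=.
have wt_le sg z t : wt z t <= w (S sg z t).
  rewrite /wt (bigD1 sg)//= ler_piMr ?(ltW (w0 _))//.
  by apply: prodr_ile1 => sg' _; rewrite ltW/=.
have mS sg : measurable_fun setT (fun p : (W * W) * T => w (S sg p.1 p.2)).
  apply: (measurableT_comp mw (measurable_to_Rinfty _)) => k.
  apply: measurable_funD; last exact: (measurableT_comp (my k)).
  apply: (measurable_mean (b := fun p : (W * W) * T => fun m => sgn sg m * B p.1 m)) => m.
  by apply: measurable_funM => //; exact: (measurableT_comp (measurable_replicas m)).
have mwt : measurable_fun setT (fun p : (W * W) * T => (wt p.1 p.2)%:E).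
  by apply/measurable_EFinP; apply: measurable_prod => sg _.
have wt0E (p : (W * W) * T) : (0 <= (wt p.1 p.2)%:E)%E by rewrite lee_fin ltW.
pose PP : probability (W * W)%type R := (P \x P)%E.
pose gE t : \bar R := (\int[PP]_z (wt z t)%:E)%E.
have mwtt t : measurable_fun setT (fun z => wt z t).
  by apply/measurable_EFinP; exact: (measurable_fun_pair1 t mwt).
have iwt t : PP.-integrable setT (EFin \o (fun z => wt z t)).
  apply: (@integrable_bounded _ _ _ PP _ 1) => // z.
  by rewrite ger0_norm ?(ltW (wt0 _ _)).
pose g t : R := \int[PP]_z wt z t.
have gEE t : (g t)%:E = gE t by rewrite /g EFin_Rintegral.
have mg : measurable_fun setT g.
  apply/measurable_EFinP; rewrite (_ : EFin \o g = gE); last by apply/funext => t; rewrite /= gEE.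
  exact: (@measurable_fun_fubini_tonelli_G _ _ _ _ _ PP _ mwt wt0E).
have g_ge0 t : 0 <= g t by apply: Rintegral_ge0 => z _; rewrite ltW.
have g1 t : g t <= 1.
  rewrite -(Rintegral_probability_cst PP 1); apply: le_Rintegral => //.
  exact: finite_measure_integrable_cst.
have g0 t : 0 < g t.
  rewrite lt_def g_ge0 andbT; apply/eqP => gt0.
  have z0 : (\int[PP]_z `|(wt z t)%:E| = 0)%E.
    under eq_integral do rewrite /= ger0_norm ?(ltW (wt0 _ _))//.
    by rewrite -/(gE t) -gEE gt0.
  have := (ae_eq_integral_abs PP measurableT (measurable_int _ (iwt t))).1 z0.
  move=> [N [mN N0 sub]].
  have : (PP setT <= PP N)%E.
    apply: le_measure; rewrite ?inE//.
    apply: subset_trans sub => z _ /= /(_ I) [] h0.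
    by have := wt0 z t; rewrite h0 ltxx.
  by rewrite probability_setT N0 lee_fin ler10.
pose D := K.+1%:R * M.
have M0 : 0 <= M by rewrite /M fine_ge0// integral_ge0// => w2 _; rewrite lee_fin exprn_even_ge0// odd_double.
have D0 : 0 <= D by rewrite mulr_ge0.
exists g, (K.+1%:R ^+ K.+1 * D); split => //.
- by move=> t; rewrite g0 g1.
- by rewrite mulr_ge0// exprn_ge0.
move=> s a us.
have rK : (Num.sqrt K.+1%:R)^-1 ^+ 2 = K.+1%:R^-1 :> R by rewrite exprVn sqr_sqrtr.
pose Q t := \sum_(i <- s) a i * \prod_(j < K.+1) y t (tnth i j).
have AQ t : block_form s a (ys t) ^+ 2 = K.+1%:R^-1 ^+ K.+1 * Q t ^+ 2.
  rewrite -rK -exprM mulnC exprM -exprMn; congr (_ ^+ 2).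
  rewrite mulr_sumr; apply: eq_bigr => i _; rewrite mulrCA; congr (_ * _).
  rewrite -[X in _ ^+ X]card_ord -prodr_const -big_split/=; apply: eq_bigr => j _.
  by rewrite /ys divn_interleave.
have QA t : Q t ^+ 2 = K.+1%:R ^+ K.+1 * block_form s a (ys t) ^+ 2.
  by rewrite AQ mulrA -exprMn divff ?pnatr_eq0// expr1n mul1r.
pose G sg (p : (W * W) * T) : R := w (S sg p.1 p.2) *
   block_form s a (fun m => sgn sg m * B p.1 m + ys p.2 m) ^+ 2.
have mG sg : measurable_fun setT (G sg).
  apply: measurable_funM => //; apply: measurable_funX.
  apply: (@measurable_block_form s a _ _ (fun (p : (W * W) * T) m => sgn sg m * B p.1 m + ys p.2 m)) => m.
  apply: measurable_funD; apply: measurable_funM => //.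
    exact: (measurableT_comp (measurable_replicas m)).
  exact: (measurableT_comp (my _)).
have G0 sg p : 0 <= G sg p by rewrite mulr_ge0// ?sqr_ge0// ltW.
have mGt sg t : measurable_fun setT (fun z => G sg (z, t)).
  exact: (measurable_fun_pair1 t (mG sg)).
have mA : measurable_fun setT (fun t => block_form s a (ys t) ^+ 2).
  by apply: measurable_funX; apply: (@measurable_block_form s a _ _ ys) => m; apply: measurable_funM.
pose N : R := (2 ^+ K.+1)^-1.
have N0 : 0 <= N by rewrite invr_ge0 exprn_ge0.
have mGG sg : measurable_fun setT (fun t => \int[PP]_z (G sg (z, t))%:E)%E.
  apply: (@measurable_fun_fubini_tonelli_G _ _ _ _ _ PP (fun p => (G sg p)%:E)).
    exact/measurable_EFinP.
  by move=> p; rewrite lee_fin.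
have pt t : ((g t * block_form s a (ys t) ^+ 2)%:E <=
    N%:E * \sum_(sg : {ffun 'I_K.+1 -> bool}) \int[PP]_z (G sg (z, t))%:E)%E.
  rewrite EFinM gEE /gE muleC -ge0_integralZl_EFin//; last 3 first.
  - by move=> z _; rewrite lee_fin ltW.
  - exact/measurable_EFinP.
  - by rewrite sqr_ge0.
  rewrite -ge0_integral_sum//; last 2 first.
  - by move=> sg; exact/measurable_EFinP.
  - by move=> sg z _; rewrite lee_fin.
  rewrite -ge0_integralZl_EFin//; last 2 first.
  - by move=> z _; apply: sume_ge0 => sg _; rewrite lee_fin.
  - by apply: emeasurable_sum => sg; exact/measurable_EFinP.
  apply: ge0_le_integral => //.
  - by move=> z _; rewrite -EFinM lee_fin mulr_ge0 ?sqr_ge0// ltW.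
  - by apply: emeasurable_funM => //; exact/measurable_EFinP.
  - apply: emeasurable_funM => //; apply: emeasurable_sum => sg; exact/measurable_EFinP.
  move=> z _; rewrite sumEFin -!EFinM lee_fin.
  have := block_form_flip_sqr s a (B z) (ys t).
  move=> /(ler_wpM2l (ltW (wt0 z t))); rewrite mulrC => /le_trans; apply.
  rewrite mulrCA ler_wpM2l// mulr_sumr; apply: ler_sum => sg _.
  by rewrite ler_wpM2r ?sqr_ge0.
have QE t : (g t * Q t ^+ 2)%:E = (K.+1%:R ^+ K.+1 * (g t * block_form s a (ys t) ^+ 2))%:E.
  by rewrite QA mulrCA.
under eq_integral do rewrite -/(Q _) QE EFinM.
rewrite ge0_integralZl_EFin//; last 2 first.
- by move=> t _; rewrite lee_fin mulr_ge0// sqr_ge0.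
- by apply/measurable_EFinP/measurable_funM.
rewrite -mulrA EFinM; apply: lee_wpmul2l; first by rewrite lee_fin exprn_ge0.
apply: (@le_trans _ _ (\int[mu]_t (N%:E * \sum_(sg : {ffun 'I_K.+1 -> bool}) \int[PP]_z (G sg (z, t))%:E))%E).
  apply: ge0_le_integral => //.
  - by move=> t _; rewrite lee_fin mulr_ge0// sqr_ge0.
  - by apply/measurable_EFinP/measurable_funM.
  - by apply: emeasurable_funM => //; exact: emeasurable_sum.
have GG0 sg t : (0 <= \int[PP]_z (G sg (z, t))%:E)%E.
  by apply: integral_ge0 => z _; rewrite lee_fin.
rewrite ge0_integralZl_EFin//; last 2 first.
- by move=> t _; apply: sume_ge0.
- exact: emeasurable_sum.
rewrite ge0_integral_sum//.
apply: (@le_trans _ _ (N%:E * \sum_(sg : {ffun 'I_K.+1 -> bool}) (D * \sum_(i <- s) a i ^+ 2)%:E)%E).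
  apply: lee_wpmul2l; first by rewrite lee_fin.
  by apply: lee_sum => sg _; exact: (flip_estimate a sg us mw w01 hw).
rewrite sumEFin -EFinM lee_fin sumr_const.
have cc : #|{: {ffun 'I_K.+1 -> bool}}| = (2 ^ K.+1)%N by rewrite card_ffun card_bool card_ord.
rewrite cc -[X in N * X]mulr_natl natrX mulrA /N mulVf ?mul1r//.
Qed.

End Replicas.

(** * Change of measure *)

Lemma density_probability (d : measure_display) (T : measurableType d) (R : realType)
    (mu : probability T R) (g : T -> R) :
  measurable_fun setT g -> (forall t, 0 < g t <= 1) ->
  exists nu : probability T R, [/\ nu `<< mu, mu `<< nu &
    exists2 c : R, 0 < c & forall f : T -> \bar R, measurable_fun setT f ->
      (forall t, 0 <= f t)%E -> (\int[nu]_t f t = c%:E * \int[mu]_t ((g t)%:E * f t))%E].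
Proof.
move=> mg g01.
have g0 t : 0 < g t by case/andP: (g01 t).
have g1 t : g t <= 1 by case/andP: (g01 t).
have gi : mu.-integrable setT (EFin \o g).
  by apply: (@integrable_bounded _ _ _ mu _ 1) => // t; rewrite ger0_norm// ltW.
have null (A : set T) : measurable A -> (\int[mu]_(t in A) (g t)%:E = 0)%E -> mu A = 0.
  move=> mA intA.
  have mgA : measurable_fun A (EFin \o g) by apply/measurable_funTS/measurable_EFinP.
  have : (\int[mu]_(t in A) `|(g t)%:E| = 0)%E.
    by under eq_integral do rewrite /= ger0_norm ?(ltW (g0 _))//.
  move=> /(ae_eq_integral_abs mu mA mgA) [N [mN N0 sub]].
  apply/eqP; rewrite eq_le measure_ge0 andbT -N0; apply: le_measure; rewrite ?inE//.
  apply: subset_trans sub => t At /= /(_ At) [] h0.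
  by have := g0 t; rewrite h0 ltxx.
pose c : R := \int[mu]_t g t.
have cE : (c%:E = \int[mu]_t (g t)%:E)%E by rewrite /c EFin_Rintegral.
have c0 : 0 < c.
  rewrite lt_def Rintegral_ge0 ?andbT; last by move=> t _; rewrite ltW.
  apply/eqP => c00; have := null setT measurableT; rewrite -cE c00 => /(_ erefl).
  by rewrite probability_setT => -[] /eqP; rewrite oner_eq0.
pose h t := c^-1 * g t.
have h0 t : 0 <= h t by rewrite mulr_ge0 ?invr_ge0 ?ltW.
have mh : measurable_fun setT h by exact: measurable_funM.
have hi : mu.-integrable setT (EFin \o h) by exact: integrableRZ.
pose m (A : set T) : \bar R := (\int[mu]_(t in A) (h t)%:E)%E.
have m0 : m set0 = 0%E by rewrite /m integral_set0.
have m_ge0 A : (0 <= m A)%E by apply: integral_ge0 => t _; rewrite lee_fin.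
have m_sigma : semi_sigma_additive m.
  move=> A mA tA mUA; rewrite /m integral_bigcup//; last first.
    exact: (integrableS _ _ (subsetT _)).
  by apply: is_cvg_ereal_nneg_natsum_cond => n _ _; exact: m_ge0.
have mT : m setT = 1%E.
  rewrite /m /h; under eq_integral do rewrite EFinM.
  rewrite ge0_integralZl_EFin//.
  - by rewrite -cE -EFinM mulVf// gt_eqF.
  - by move=> t _; rewrite lee_fin ltW.
  - exact/measurable_EFinP.
  - by rewrite invr_ge0 ltW.
pose M1 : {measure set T -> \bar R} := HB.pack m (isMeasure.Build _ _ _ m m0 m_ge0 m_sigma).
pose nu : probability T R := HB.pack m (isMeasure.Build _ _ _ m m0 m_ge0 m_sigma)
  (Measure_isProbability.Build _ _ _ M1 mT).
exists nu; split.
- apply/null_content_dominatesP => A mA A0.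
  by apply: null_set_integral => //; apply/measurable_funTS/measurable_EFinP.
- apply/null_content_dominatesP => A mA A0; apply: null => //.
  have : (\int[mu]_(t in A) (h t)%:E = 0)%E by exact: A0.
  rewrite /h; under eq_integral do rewrite EFinM.
  rewrite ge0_integralZl_EFin//.
  - by move/eqP; rewrite mule_eq0 eqe invr_eq0 gt_eqF//= => /eqP.
  - by move=> t _; rewrite lee_fin ltW.
  - by apply/measurable_funTS/measurable_EFinP.
  - by rewrite invr_ge0 ltW.
exists c^-1; first by rewrite invr_gt0.
move=> f mf f0.
rewrite (@integral_density _ _ _ mu nu h)//.
rewrite -ge0_integralZl_EFin//.
- by apply: eq_integral => t _; rewrite /h EFinM muleC muleA.
- by move=> t _; apply: mule_ge0 => //; rewrite lee_fin ltW.
- by apply: emeasurable_funM => //; exact/measurable_EFinP.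
- by rewrite invr_ge0 ltW.
Qed.

(** The tensor [Y^(tensor r)] is bounded from the Hilbert tensor power to
    [L^2(nu)]; by density it is enough to test finitely supported tensors. *)
Definition tensor_bounded (R : realType) (d : measure_display) (T : measurableType d)
    (nu : {measure set T -> \bar R}) (y : T -> nat -> R) (r : nat) : Prop :=
  exists2 C : R, 0 <= C & forall (s : seq (r.-tuple nat)) (a : r.-tuple nat -> R), uniq s ->
    (\int[nu]_t ((\sum_(i <- s) a i * \prod_(j < r) y t (tnth i j)) ^+ 2)%:E <=
     (C * \sum_(i <- s) a i ^+ 2)%:E)%E.

Lemma measurable_tensor (R : realType) (d : measure_display) (T : measurableType d)
    (y : T -> nat -> R) (r : nat) (s : seq (r.-tuple nat)) (a : r.-tuple nat -> R) :
  (forall k, measurable_fun setT (fun t => y t k)) ->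
  measurable_fun setT (fun t => \sum_(i <- s) a i * \prod_(j < r) y t (tnth i j)).
Proof.
move=> my; apply: measurable_sum => i; apply: measurable_funM => //.
by apply: measurable_prod => j _.
Qed.

(** The weights of all orders can be multiplied, since a weight is still good
    after multiplication by a function with values in ]0, 1]. *)
Lemma exists_tensor_bounded (R : realType) (H : completeNormedModType R) (dot : {dot H for idfun})
    (e : nat -> H)
    (dW : measure_display) (W : measurableType dW) (P : probability W R) (X : H -> L0 P)
    (dT : measure_display) (T : measurableType dT) (mu : probability T R) (Y : H -> L0 mu)
    (N : nat) :
  hilbert_norm dot -> orthonormal_basis dot e -> standard_gaussian X -> randomized_shift e X Y ->
  exists nu : probability T R, [/\ nu `<< mu, mu `<< nu &
    forall r, (r <= N)%N -> tensor_bounded nu (coordinates e Y) r].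
Proof.
move=> hH he hX hY.
have my k : measurable_fun setT (fun t => coordinates e Y t k) by exact: measurable_L0.
have [g [mg g01 hg]] : exists g : T -> R, [/\ measurable_fun setT g, forall t, 0 < g t <= 1 &
    forall r, (r <= N)%N -> exists2 C : R, 0 <= C &
    forall (s : seq (r.-tuple nat)) (a : r.-tuple nat -> R), uniq s ->
    (\int[mu]_t (g t * (\sum_(i <- s) a i * \prod_(j < r) coordinates e Y t (tnth i j)) ^+ 2)%:E <=
     (C * \sum_(i <- s) a i ^+ 2)%:E)%E].
  elim: N => [|N [g [mg g01 hg]]].
    (* order 0: there is one tuple only, and the empty product is 1 *)
    exists (fun=> 1); split => //; first by move=> t; rewrite ltr01 lexx.
    move=> r; rewrite leqn0 => /eqP ->; exists 1 => // s a us.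
    have : (size s <= 1)%N.
      have := uniq_leq_size us (s2 := [:: [tuple]]); apply => i _.
      by rewrite (tuple0 i) inE.
    case: s {us} => [_|i [_|//]].
      by rewrite big_nil mulr0; under eq_integral do rewrite big_nil expr0n mulr0; rewrite integral0.
    rewrite big_seq1 mul1r; under eq_integral do rewrite big_seq1 big_ord0 mulr1 mul1r.
    have -> : (fun=> (a i ^+ 2)%:E) = cst (a i ^+ 2)%:E :> (T -> \bar R) by [].
    by rewrite integral_cst// [X in (_ * X)%E]probability_setT mule1.
  have [g' [C' [mg' g'01 C'0 hg']]] := shift_moment_weight hH he hX N hY.
  exists (fun t => g t * g' t); split.
  - exact: measurable_funM.
  - move=> t; have /andP[a b] := g01 t; have /andP[a' b'] := g'01 t.
    by rewrite mulr_gt0//= mulr_ile1// ltW.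
  have sub (k1 k2 : T -> R) (r : nat) (C : R) (s : seq (r.-tuple nat)) (a : r.-tuple nat -> R) :
      measurable_fun setT k1 -> measurable_fun setT k2 ->
      (forall t, 0 <= k1 t <= k2 t) ->
      (\int[mu]_t (k2 t * (\sum_(i <- s) a i * \prod_(j < r) coordinates e Y t (tnth i j)) ^+ 2)%:E <=
       (C * \sum_(i <- s) a i ^+ 2)%:E)%E ->
      (\int[mu]_t (k1 t * (\sum_(i <- s) a i * \prod_(j < r) coordinates e Y t (tnth i j)) ^+ 2)%:E <=
       (C * \sum_(i <- s) a i ^+ 2)%:E)%E.
    move=> mk1 mk2 k12; apply: le_trans; apply: ge0_le_integral => //.
    - by move=> t _; have /andP[? _] := k12 t; rewrite lee_fin mulr_ge0 ?sqr_ge0.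
    - by apply/measurable_EFinP/measurable_funM => //; apply/measurable_funX/measurable_tensor.
    - by apply/measurable_EFinP/measurable_funM => //; apply/measurable_funX/measurable_tensor.
    - by move=> t _; have /andP[_ ?] := k12 t; rewrite lee_fin ler_wpM2r ?sqr_ge0.
  move=> r; rewrite leq_eqVlt => /predU1P[->|rN].
    exists C' => // s a us; apply: (sub _ g') (hg' s a us) => //; first exact: measurable_funM.
    move=> t; have /andP[a0 b0] := g01 t; have /andP[a' b'] := g'01 t.
    by rewrite mulr_ge0 ?(ltW a0) ?(ltW a')//= ler_piMl// ltW.
  have [C C0 hC] := hg r rN.
  exists C => // s a us; apply: (sub _ g) (hC s a us) => //; first exact: measurable_funM.
  move=> t; have /andP[a0 b0] := g01 t; have /andP[a' b'] := g'01 t.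
  by rewrite mulr_ge0 ?(ltW a0) ?(ltW a')//= ler_piMr// ltW.
have [nu [numu munu [c c0 intE]]] := density_probability mu mg g01.
exists nu; split => // r /hg[C C0 hC]; exists (c * C); first by rewrite mulr_ge0// ltW.
move=> s a us; rewrite intE.
- rewrite -mulrA EFinM; apply: lee_wpmul2l; first by rewrite lee_fin ltW.
  by under eq_integral do rewrite -EFinM; exact: hC.
- by apply/measurable_EFinP/measurable_funX/measurable_tensor.
- by move=> t; rewrite lee_fin sqr_ge0.
Qed.

(** * Square-integrable functions *)

Lemma discriminant_le (R : realType) (a b c : R) :
  (forall x, 0 <= a + x * b *+ 2 + x ^+ 2 * c) -> b ^+ 2 <= a * c.
Proof.
move=> h; have a0 : 0 <= a by have := h 0; rewrite mul0r mul0rn expr0n mul0r !addr0.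
have [c0|c0|c0] := ltgtP c 0.
- (* a point so far away that the quadratic is negative there *)
  have := h ((a + 1 + `|b| *+ 2) / - c + 1); set x := _ / _.
  have nc : 0 < - c by rewrite oppr_gt0.
  have xE : x * - c = a + 1 + `|b| *+ 2 by rewrite /x mulfVK// gt_eqF.
  have x0 : 0 <= x by rewrite /x divr_ge0 ?(ltW nc)//; have := normr_ge0 b; lra.
  have := ler_norm b; have := normr_ge0 b; nra.
- have := h (- b / c).
  have -> : a + - b / c * b *+ 2 + (- b / c) ^+ 2 * c = a - b ^+ 2 / c by field; rewrite gt_eqF.
  by rewrite subr_ge0 ler_pdivrMr.
- have [->|b0] := eqVneq b 0; first by rewrite expr0n c0 mulr0.
  have := h (- (a + 1) / b); rewrite c0 mulr0 addr0 mulfVK//; lra.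
Qed.

Section SquareIntegrable.
Context (R : realType) (d : measure_display) (T : measurableType d).
Context (mu : {measure set T -> \bar R}).
Local Notation L2 := (Lfun mu 2%:E).

Lemma Lfun2P (f : T -> R) : f \in L2 <->
  measurable_fun setT f /\ (\int[mu]_t (f t ^+ 2)%:E < +oo)%E.
Proof.
split=> [l2f|[mf fi]].
  split; first by move: l2f; rewrite inE => /andP[/[!inE]].
  have /integrableP[_] := Lfun2_integrable_sqr l2f; congr (_ < _)%E.
  by apply: eq_integral => t _; rewrite /= ger0_norm// sqr_ge0.
rewrite inE; apply/andP; split; first by rewrite inE.
rewrite inE /= /finite_norm unlock /=.
rewrite (_ : (\int[mu]_x _)%E = (\int[mu]_t (f t ^+ 2)%:E)%E); last first.
  by apply: eq_integral => t _ /=; rewrite powR_mulrn// real_normK// num_real.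
by rewrite poweR_lty.
Qed.

Lemma Lfun2_measurable (f : T -> R) : f \in L2 -> measurable_fun setT f.
Proof. by case/Lfun2P. Qed.

Lemma Lfun2_mul_integrable (f g : T -> R) : f \in L2 -> g \in L2 ->
  mu.-integrable setT (fun t => (f t * g t)%:E).
Proof. by move=> fL gL; have /Lfun1_integrable := Lfun2_mul_Lfun1 fL gL. Qed.

Lemma Lfun2_lin (a : R) (f g : T -> R) : f \in L2 -> g \in L2 ->
  (fun t => a * f t + g t) \in L2.
Proof.
move=> fL gL; have two1 : (1 <= 2%:E :> \bar R)%E by rewrite lee_fin ler1n.
have [_ h] := Lfun_submod_closed mu two1.
exact: (h a f g fL gL).
Qed.

Lemma Lfun2_cst0 : (fun=> 0 : R) \in L2.
Proof.
apply/Lfun2P; split; first exact: measurable_cst.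
by under eq_integral do rewrite expr0n; rewrite integral0 ltry.
Qed.

Lemma Lfun2_sum (I : Type) (s : seq I) (a : I -> R) (phi : I -> T -> R) :
  (forall i, phi i \in L2) -> (fun t => \sum_(i <- s) a i * phi i t) \in L2.
Proof.
move=> h; elim: s => [|i s ih].
  by under eq_fun do rewrite big_nil; exact: Lfun2_cst0.
by under eq_fun do rewrite big_cons; exact: Lfun2_lin.
Qed.

Lemma L2dotC (f g : T -> R) : L2dot mu f g = L2dot mu g f.
Proof. by apply: eq_Rintegral => t _; rewrite mulrC. Qed.

Lemma EFin_L2dot (f g : T -> R) : f \in L2 -> g \in L2 ->
  (L2dot mu f g)%:E = (\int[mu]_t (f t * g t)%:E)%E.
Proof. by move=> fL gL; rewrite /L2dot EFin_Rintegral//; exact: Lfun2_mul_integrable. Qed.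

Lemma L2dot_ge0 (f : T -> R) : 0 <= L2dot mu f f.
Proof. by apply: Rintegral_ge0 => t _; rewrite -expr2 sqr_ge0. Qed.

Lemma L2dot_linl (a : R) (f g h : T -> R) : f \in L2 -> g \in L2 -> h \in L2 ->
  L2dot mu (fun t => a * f t + g t) h = a * L2dot mu f h + L2dot mu g h.
Proof.
move=> fL gL hL; have fh := Lfun2_mul_integrable fL hL; have gh := Lfun2_mul_integrable gL hL.
rewrite /L2dot -RintegralZl//.
rewrite -RintegralD//; last by apply: integrableRZ.
by apply: eq_Rintegral => t _; rewrite mulrDl mulrA.
Qed.

Lemma L2dot_linr (a : R) (f g h : T -> R) : f \in L2 -> g \in L2 -> h \in L2 ->
  L2dot mu h (fun t => a * f t + g t) = a * L2dot mu h f + L2dot mu h g.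
Proof. by move=> fL gL hL; rewrite L2dotC L2dot_linl// !(L2dotC h). Qed.

Lemma L2dot_suml (I : Type) (s : seq I) (a : I -> R) (phi : I -> T -> R) (h : T -> R) :
  (forall i, phi i \in L2) -> h \in L2 ->
  L2dot mu (fun t => \sum_(i <- s) a i * phi i t) h = \sum_(i <- s) a i * L2dot mu (phi i) h.
Proof.
move=> hp hh; elim: s => [|i s ih].
  rewrite big_nil /L2dot; under eq_Rintegral do rewrite big_nil mul0r.
  by rewrite /Rintegral integral0.
rewrite big_cons -ih -L2dot_linl//; last exact: Lfun2_sum.
by congr L2dot; apply/funext => t; rewrite big_cons.
Qed.

Lemma L2dot_sumr (I : Type) (s : seq I) (a : I -> R) (phi : I -> T -> R) (h : T -> R) :
  (forall i, phi i \in L2) -> h \in L2 ->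
  L2dot mu h (fun t => \sum_(i <- s) a i * phi i t) = \sum_(i <- s) a i * L2dot mu h (phi i).
Proof.
by move=> hp hh; rewrite L2dotC L2dot_suml//; apply: eq_bigr => i _; rewrite L2dotC.
Qed.

Lemma L2_CauchySchwarz (f g : T -> R) : f \in L2 -> g \in L2 ->
  L2dot mu f g ^+ 2 <= L2dot mu f f * L2dot mu g g.
Proof.
move=> fL gL; apply: discriminant_le => x.
have := L2dot_ge0 (fun t => x * g t + f t).
have hL := Lfun2_lin x gL fL.
rewrite L2dot_linl// !L2dot_linr// (L2dotC g f); congr (_ <= _); ring.
Qed.

(** Duality: if the synthesis map [a |-> sum_i a_i phi_i] has norm at most
    [sqrt C], so has its adjoint, the analysis map [f |-> (<f, phi_i>)_i]. *)
Lemma L2_analysis_le (I : Type) (s : seq I) (phi : I -> T -> R) (C : R) (f : T -> R) :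
  0 <= C -> (forall i, phi i \in L2) -> f \in L2 ->
  (forall a : I -> R, L2dot mu (fun t => \sum_(i <- s) a i * phi i t)
     (fun t => \sum_(i <- s) a i * phi i t) <= C * \sum_(i <- s) a i ^+ 2) ->
  \sum_(i <- s) L2dot mu f (phi i) ^+ 2 <= C * L2dot mu f f.
Proof.
move=> C0 hp fL hC; set S := \sum_(i <- s) _.
pose u t := \sum_(i <- s) L2dot mu f (phi i) * phi i t.
have uL : u \in L2 by exact: Lfun2_sum.
have SE : L2dot mu f u = S by rewrite L2dot_sumr//; apply: eq_bigr => i _; rewrite expr2.
have := L2_CauchySchwarz fL uL; have := hC (fun i => L2dot mu f (phi i)).
rewrite -/u -/S SE => uS cs.
have S0 : 0 <= S by apply: sumr_ge0 => i _; exact: sqr_ge0.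
have f0 := L2dot_ge0 f.
have : S ^+ 2 <= L2dot mu f f * (C * S) by apply: le_trans cs _; rewrite ler_wpM2l.
have [->|Sn0] := eqVneq S 0; first by move=> _; rewrite mulr_ge0.
by rewrite mulrA expr2 ler_pM2r ?lt_def ?Sn0// mulrC.
Qed.

Lemma L2_bessel (s : seq (T -> R)) (f : T -> R) : uniq s ->
  (forall b, b \in s -> b \in L2) ->
  (forall b c, b \in s -> c \in s -> L2dot mu b c = (b == c)%:R) -> f \in L2 ->
  \sum_(b <- s) L2dot mu f b ^+ 2 <= L2dot mu f f.
Proof.
move=> us sL on fL; pose phi (b : T -> R) := if b \in s then b else (fun=> 0).
have phiL b : phi b \in L2.
  by rewrite /phi; case: ifP => [/sL//|_]; exact: Lfun2_cst0.
rewrite (eq_big_seq (fun b => L2dot mu f (phi b) ^+ 2)); last by move=> b bs; rewrite /phi bs.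
rewrite -[leRHS]mul1r; apply: L2_analysis_le => // a.
rewrite mul1r L2dot_suml//; last exact: Lfun2_sum.
rewrite le_eqVlt; apply/orP; left; apply/eqP/eq_big_seq => b bs.
rewrite L2dot_sumr// (bigD1_seq b)//= big1_seq => [|c /andP[cb cs]].
  by rewrite addr0 /phi bs on// eqxx mulr1 expr2.
by rewrite /phi bs cs on// eq_sym (negbTE cb) mulr0.
Qed.

Lemma L2dot_ae (f f' g g' : T -> R) : f \in L2 -> f' \in L2 -> g \in L2 -> g' \in L2 ->
  f = f' %[ae mu] -> g = g' %[ae mu] -> L2dot mu f g = L2dot mu f' g'.
Proof.
move=> fL f'L gL g'L ff gg; apply: Rintegral_ae_eq => //.
- exact: measurable_funM (Lfun2_measurable fL) (Lfun2_measurable gL).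
- exact: measurable_funM (Lfun2_measurable f'L) (Lfun2_measurable g'L).
by apply: filterS2 ff gg => t /(_ I) -> /(_ I) ->.
Qed.

End SquareIntegrable.

(** * Almost everywhere convergent subsequences *)

Lemma fatou_le (d : measure_display) (T : measurableType d) (R : realType)
    (mu : {measure set T -> \bar R}) (f_ : nat -> T -> R) (F : T -> R) (C : \bar R) :
  (forall n, measurable_fun setT (f_ n)) -> (forall n t, 0 <= f_ n t) ->
  measurable_fun setT F -> {ae mu, forall t, f_ n t @[n --> \oo] --> F t} ->
  (forall n, \int[mu]_t (f_ n t)%:E <= C)%E -> (\int[mu]_t (F t)%:E <= C)%E.
Proof.
move=> mf f0 mF fF fC.
have mfE n : measurable_fun setT (EFin \o f_ n) by exact/measurable_EFinP.
have -> : (\int[mu]_t (F t)%:E = \int[mu]_t limn_einf (fun n => (f_ n t)%:E))%E; last first.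
  apply: le_trans (fatou _ _ _ _) _ => //; first by move=> n t _; rewrite lee_fin.
  apply: le_trans (limn_einf_sup _) _; rewrite limn_esup_lim.
  apply: lime_le; first exact: is_cvg_esups.
  by apply: nearW => n; apply: ge_ereal_sup => _ [k _ <-].
apply: ae_eq_integral => //.
- exact/measurable_EFinP.
- rewrite (_ : (fun _ => _) = fun t => (- limn_esup (fun n => - (f_ n t)%:E))%E).
    apply: (measurableT_comp (@oppe_measurable R setT)); apply: measurable_fun_limn_esup => n.
    exact: (measurableT_comp (@oppe_measurable R setT) (mfE n)).
  by apply/funext => t; rewrite -[RHS]/(- limn_esup (-%E \o _))%E limn_esupN oppeK.
- apply: filterS fF => t ft _ /=.
  have /cvg_limn_einf_sup[-> _] : (f_ n t)%:E @[n --> \oo] --> (F t)%:E by exact: cvg_EFin_real.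
  by [].
Qed.

Lemma geometric_le2 (R : realType) (n : nat) : \sum_(0 <= k < n) (2^-1 : R) ^+ k <= 2.
Proof.
have : \sum_(0 <= k < n) (2^-1 : R) ^+ k + 2 * 2^-1 ^+ n = 2.
  elim: n => [|n ih]; first by rewrite big_geq// expr0; ring.
  by rewrite big_nat_recr//= exprS -[RHS]ih; field.
move=> sE; rewrite -[leRHS]sE lerDl mulr_ge0// exprn_ge0// invr_ge0//.
Qed.

(** The sum of the series is integrable. *)
Lemma ae_cvg_series (d : measure_display) (T : measurableType d) (R : realType)
    (mu : {measure set T -> \bar R}) (w : nat -> T -> R) :
  (forall m, measurable_fun setT (w m)) -> (forall m t, 0 <= w m t) ->
  (forall m, \int[mu]_t (w m t)%:E <= ((2^-1) ^+ m)%:E)%E ->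
  {ae mu, forall t, cvgn (series (fun m => w m t))}.
Proof.
move=> mw w0 wC.
have mwE m : measurable_fun setT (EFin \o w m) by exact/measurable_EFinP.
have si : mu.-integrable setT (fun t => \sum_(0 <= m <oo) (w m t)%:E)%E.
  apply/integrableP; split.
    have h0 m t : setT t -> xpredT m -> (0 <= (w m t)%:E)%E by rewrite lee_fin.
    exact: (ge0_emeasurable_sum h0 (fun m _ => mwE m)).
  have s0 t : (0 <= \sum_(0 <= m <oo) (w m t)%:E)%E.
    by apply: nneseries_ge0 => m _ _; rewrite lee_fin.
  under eq_integral do rewrite (gee0_abs (s0 _)).
  rewrite integral_nneseries//; last by move=> m t _; rewrite lee_fin.
  apply: (@le_lt_trans _ _ 2%:E); last by rewrite ltry.
  apply: lime_le.
    by apply: is_cvg_nneseries => m _ _; apply: integral_ge0 => t _; rewrite lee_fin.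
  apply: nearW => n; apply: (@le_trans _ _ (\sum_(0 <= k < n) ((2^-1) ^+ k)%:E)%E).
    by apply: lee_sum => k _; exact: wC.
  by rewrite sumEFin lee_fin geometric_le2.
have := integrable_ae measurableT si; apply: filterS => t /(_ I) fin.
apply: nondecreasing_is_cvgn.
  by apply/nondecreasing_seqP => n; rewrite !seriesEnat/= big_nat_recr//= lerDl.
exists (fine (\sum_(0 <= m <oo) (w m t)%:E)%E) => _ [n _ <-].
rewrite -lee_fin fineK// seriesEnat /= -sumEFin.
by apply: nneseries_lim_ge => k _ _; rewrite lee_fin.
Qed.

Lemma geometric_half_cvg0 (R : realType) : ((2^-1 : R) ^+ m) @[m --> \oo] --> (0 : R).
Proof. by apply: cvg_expr; rewrite ger0_norm ?invr_ge0// invf_lt1 ?ltr1n. Qed.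

(** Borel-Cantelli: the indices are such that the exceptional sets have
    geometrically small measures. *)
Lemma ae_cvg_subsequence (d : measure_display) (T : measurableType d) (R : realType)
    (mu : {measure set T -> \bar R}) (u_ : nat -> T -> R) (u : T -> R) :
  (forall n, measurable_fun setT (u_ n)) -> measurable_fun setT u ->
  (forall eps : R, 0 < eps ->
     mu [set t | eps <= `|u_ n t - u t|] @[n --> \oo] --> (0 : \bar R)) ->
  exists phi : nat -> nat, {ae mu, forall t, u_ (phi m) t @[m --> \oo] --> u t}.
Proof.
move=> mu_ mu0 cv; pose h m : R := (2^-1) ^+ m.
have h0 m : 0 < h m by rewrite exprn_gt0// invr_gt0.
pose A m n := [set t | h m <= `|u_ n t - u t|].
have mA m n : measurable (A m n).
  have mg : measurable_fun setT (fun t => `|u_ n t - u t|).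
    by apply: measurableT_comp => //; exact: measurable_funB.
  rewrite -[A m n]setTI; have := mg measurableT _ (measurable_itv `[h m, +oo[).
  by congr measurable; apply/seteqP; split => t /=; rewrite in_itv/= andbT.
have /choice[phi phiP] : forall m, exists n, (mu (A m n) <= (h m)%:E)%E.
  move=> m; have : \forall n \near \oo, (mu (A m n) < (h m)%:E)%E.
    have := cv _ (h0 m) (fun x => (x < (h m)%:E)%E); apply.
    by apply: open_nbhs_nbhs; split; [exact: open_ereal_lt_ereal | rewrite /= lte_fin].
  by move=> [n _ hn]; exists n; apply/ltW/hn => /=.
exists phi.
have := @ae_cvg_series _ _ _ mu (fun m => \1_(A m (phi m))).
have mi m : measurable_fun setT (\1_(A m (phi m)) : T -> R) by exact: measurable_indic.
move=> /(_ mi) /(_ (fun m t => ler0n _ _)).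
have ind m : (\int[mu]_t (\1_(A m (phi m)) t)%:E <= (h m)%:E)%E.
  by rewrite integral_indic// setIT phiP.
move=> /(_ ind); apply: filterS => t /cvg_series_cvg_0 /cvgrPdist_lt /(_ 1 ltr01) near1.
apply/cvgrPdist_le => eps eps0.
have /cvgrPdist_lt /(_ eps eps0) near2 := @geometric_half_cvg0 R.
near=> m; rewrite distrC.
have : `|0 - \1_(A m (phi m)) t| < 1 :> R by near: m.
rewrite sub0r normrN indicE; case: (boolP (t \in _)) => [|tA _]; first by rewrite normr1 ltxx.
have : `|u_ (phi m) t - u t| < h m.
  rewrite ltNge; apply/negP => hm; move/negP: tA; apply; by rewrite inE.
move/ltW/le_trans; apply.
have : `|0 - (2^-1 : R) ^+ m| < eps by near: m.
by rewrite sub0r normrN ger0_norm ?(ltW (h0 m))// => /ltW.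
Unshelve. all: by end_near. Qed.

(** * Moments of a bounded tensor *)

Lemma esum_le_uniq (R : realType) (I : choiceType) (D : set I) (f : I -> \bar R) (C : \bar R) :
  (forall s : seq I, uniq s -> (forall i, i \in s -> D i) -> (\sum_(i <- s) f i <= C)%E) ->
  (\esum_(i in D) f i <= C)%E.
Proof.
move=> h; apply: ge_ereal_sup => _ [F [finF FD] <-]; rewrite fsbig_finite//.
by apply: h; [exact: finmap.fset_uniq | move=> i; rewrite in_fset_set// inE => /FD].
Qed.

Section TensorMoments.
Context (R : realType) (d : measure_display) (T : measurableType d) (nu : probability T R).
Context (y : T -> nat -> R) (my : forall k, measurable_fun setT (fun t => y t k)) (r : nat).
Context (tb : tensor_bounded nu y r).
Local Notation L2 := (Lfun nu 2%:E).
Local Notation mono i := (fun t => \prod_(j < r) y t (tnth i j)).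

Lemma tensor_Lfun2 (i : r.-tuple nat) : mono i \in L2.
Proof.
have [C C0 hC] := tb; apply/Lfun2P; split; first exact: measurable_prod.
have := hC [:: i] (fun=> 1) isT; under eq_integral do rewrite big_seq1 mul1r.
by move/le_lt_trans; apply; rewrite ltry.
Qed.

Lemma Lfun2_cst (c : R) : (fun=> c) \in L2.
Proof.
apply/Lfun2P; split; first exact: measurable_cst.
have -> : (fun=> (c ^+ 2)%:E) = cst (c ^+ 2)%:E :> (T -> \bar R) by [].
by rewrite integral_cst// [X in (_ * X)%E]probability_setT mule1 ltry.
Qed.

Lemma tensor_analysis_le : exists2 C : R, 0 <= C &
  forall (s : seq (r.-tuple nat)) (f : T -> R), uniq s -> f \in L2 ->
    \sum_(i <- s) L2dot nu f (mono i) ^+ 2 <= C * L2dot nu f f.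
Proof.
have [C C0 hC] := tb; exists C => // s f us fL.
apply: L2_analysis_le => //; first exact: tensor_Lfun2.
move=> a; have uL := Lfun2_sum s a tensor_Lfun2.
rewrite -lee_fin EFin_L2dot//; apply: le_trans (hC s a us).
by under eq_integral do rewrite -expr2.
Qed.

(** [tensor_analysis_le] for the constant function 1. *)
Lemma tensor_moments_le : exists2 C : R, 0 <= C &
  forall s : seq (r.-tuple nat), uniq s -> \sum_(i <- s) (\int[nu]_t mono i t) ^+ 2 <= C.
Proof.
have [C C0 hC] := tensor_analysis_le; exists C => // s us.
have := hC s _ us (Lfun2_cst 1).
rewrite /L2dot (_ : \int[nu]_t (1 * 1) = 1); last first.
  by under eq_Rintegral do rewrite mulr1; rewrite Rintegral_probability_cst.
rewrite mulr1; apply: le_trans; rewrite le_eqVlt; apply/orP; left; apply/eqP.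
by apply: eq_bigr => i _; under [in RHS]eq_Rintegral do rewrite mul1r.
Qed.

Lemma tensor_expectation (i : r.-tuple nat) : ('E_nu[mono i] = (\int[nu]_t mono i t)%:E)%E.
Proof.
rewrite unlock EFin_Rintegral//.
have := Lfun2_mul_integrable (Lfun2_cst 1) (tensor_Lfun2 i).
by apply: eq_integrable => // t _; rewrite mul1r.
Qed.

End TensorMoments.

Lemma tensor_bounded_hilbert_schmidt (R : realType) (H : completeNormedModType R) (e : nat -> H)
    (d : measure_display) (T : measurableType d) (mu nu : probability T R) (Y : H -> L0 mu) (r : nat) :
  tensor_bounded nu (coordinates e Y) r -> hilbert_schmidt_moment Y nu e r.
Proof.
move=> tb; have my k : measurable_fun setT (fun t => coordinates e Y t k) by exact: measurable_L0.
have [C C0 hC] := tensor_moments_le my tb.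
apply: (@le_lt_trans _ _ C%:E); last by rewrite ltry.
apply: esum_le_uniq => s us _; have := hC s us; rewrite -lee_fin -sumEFin.
congr (_ <= _)%E; apply: eq_bigr => i _.
by rewrite (tensor_expectation my tb) -EFin_expe.
Qed.

Lemma ae_dominates (d : measure_display) (T : measurableType d) (R : realType)
    (mu nu : {measure set T -> \bar R}) (Q : T -> Prop) :
  nu `<< mu -> {ae mu, forall t, Q t} -> {ae nu, forall t, Q t}.
Proof.
by move=> /null_content_dominatesP dom [N [mN N0 sub]]; exists N; split => //; exact: dom.
Qed.

(** * Moments of the evaluations *)

Definition tuples_below (d r : nat) : seq (r.-tuple nat) :=
  [seq [tuple val (f j) | j < r] | f : {ffun 'I_r -> 'I_d}].

Lemma tuples_below_uniq (d r : nat) : uniq (tuples_below d r).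
Proof.
rewrite map_inj_uniq ?enum_uniq// => f g /(congr1 (@tnth _ _)) fg; apply/ffunP => j.
by have := congr1 (@^~ j) fg; rewrite !tnth_mktuple => /val_inj.
Qed.

Lemma sum_expn_tuples (R : comNzRingType) (d r : nat) (c : nat -> R) :
  (\sum_(k < d) c k) ^+ r = \sum_(i <- tuples_below d r) \prod_(j < r) c (tnth i j).
Proof.
rewrite -[r in LHS]card_ord -prodr_const bigA_distr_bigA big_map big_enum /=.
by apply: eq_bigr => f _; apply: eq_bigr => j _; rewrite tnth_mktuple.
Qed.

Section Evaluations.
Context (R : realType) (H : completeNormedModType R) (dot : {dot H for idfun}) (e : nat -> H).
Context (hH : hilbert_norm dot) (he : orthonormal_basis dot e).

Lemma dot_basis_sum (x : H) (d k : nat) : (k < d)%N ->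
  dot (\sum_(i < d) dot x (e i) *: e i) (e k) = dot x (e k).
Proof.
move=> kd; rewrite dot_suml (bigD1 (Ordinal kd))//= dotZl he.1 eqxx mulr1.
by rewrite big1 ?addr0// => i ik; rewrite dotZl he.1 [_ == k](negbTE ik) mulr0.
Qed.

Lemma parseval_diff (x : H) (d : nat) :
  `|x - \sum_(i < d) dot x (e i) *: e i| ^+ 2 = `|x| ^+ 2 - \sum_(i < d) dot x (e i) ^+ 2.
Proof.
rewrite -!hH; set s := \sum_(i < d) _ *: _.
have sx : dot s x = \sum_(i < d) dot x (e i) ^+ 2.
  by rewrite dot_suml; apply: eq_bigr => i _; rewrite dotZl (dotC _ (e i)) expr2.
have ss : dot s s = \sum_(i < d) dot x (e i) ^+ 2.
  rewrite -sx [in LHS]/s dot_suml [in RHS]/s dot_suml; apply: eq_bigr => i _.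
  by rewrite !dotZl (dotC _ (e i) s) dot_basis_sum// (dotC _ (e i)).
by rewrite dotBl !dotBr ss (dotC _ x s) sx subrr subr0.
Qed.

Lemma bessel_basis (x : H) (d : nat) : \sum_(i < d) dot x (e i) ^+ 2 <= `|x| ^+ 2.
Proof. by rewrite -subr_ge0 -parseval_diff sqr_ge0. Qed.

Lemma cvg_basis_sum (x : H) : \sum_(i < d) dot x (e i) *: e i @[d --> \oo] --> x.
Proof.
have -> : (fun d => \sum_(i < d) dot x (e i) *: e i) = series (fun k => dot x (e k) *: e k).
  by apply/funext => d; rewrite seriesEord.
exact: he.2.
Qed.

Context (dT : measure_display) (T : measurableType dT) (mu nu : probability T R).
Context (Y : H -> L0 mu) (gY : generalized_function Y) (numu : nu `<< mu).
Local Notation y := (coordinates e Y).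

Lemma generalized_basis_sum (x : H) (d : nat) :
  L0_fun (Y (\sum_(i < d) dot x (e i) *: e i)) = (fun t => \sum_(i < d) dot x (e i) * y t i) %[ae nu].
Proof.
have iotaE (V : nmodType) (F : nat -> V) : \sum_(i <- iota 0 d) F i = \sum_(i < d) F i.
  by rewrite -[in LHS](subn0 d) -/(index_iota 0 d) big_mkord.
apply: (ae_dominates numu).
have := generalized_comb gY [seq (dot x (e k), k) | k <- iota 0 d] e.
rewrite big_map iotaE; apply: filterS => t /[apply] ->.
by rewrite /linear_form big_map iotaE.
Qed.

Lemma generalized_ae_subsequence (x_ : nat -> H) (x : H) : x_ n @[n --> \oo] --> x ->
  exists phi : nat -> nat, {ae nu, forall t, Y (x_ (phi m)) t @[m --> \oo] --> Y x t}.
Proof.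
move=> xx; have [|||phi hphi] := @ae_cvg_subsequence _ _ _ mu (fun n => L0_fun (Y (x_ n))) (L0_fun (Y x)).
- by move=> n; exact: measurable_L0.
- exact: measurable_L0.
- move=> eps eps0; exact: (cvg_comp _ _ xx (gY.2 x eps eps0)).
by exists phi; exact: (ae_dominates numu).
Qed.

(** The [r]-th power of a partial sum of [<Y, x>] is a combination of monomials
    in [Y] whose coefficients have squared [l^2] norm at most [|x|^(2r)]; Fatou's
    lemma passes to the limit along an almost everywhere convergent
    subsequence. *)
Lemma evaluation_moment_le (r : nat) : tensor_bounded nu y r ->
  exists2 C : R, 0 <= C &
    forall x, (\int[nu]_t (Y x t ^+ r ^+ 2)%:E <= (C * (`|x| ^+ 2) ^+ r)%:E)%E.
Proof.
move=> [C C0 hC]; exists C => // x.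
have [phi hphi] := generalized_ae_subsequence (@cvg_basis_sum x).
pose S d t := \sum_(i < d) dot x (e i) * y t i.
have mS d : measurable_fun setT (S d).
  by apply: measurable_sum => i; apply: measurable_funM => //; exact: measurable_L0.
apply: (@fatou_le _ _ _ nu (fun m t => S (phi m) t ^+ r ^+ 2)).
- by move=> m; apply: measurable_funX; exact: measurable_funX.
- by move=> m t; exact: sqr_ge0.
- by apply: measurable_funX; apply: measurable_funX; exact: measurable_L0.
- have := ae_foralln (fun m => generalized_basis_sum x (phi m)).
  move=> h; apply: filterS2 h hphi => t h ct.
  have st : S (phi m) t @[m --> \oo] --> Y x t.
    have -> : (fun m => S (phi m) t) = (fun m => Y (\sum_(i < phi m) dot x (e i) *: e i) t).
      by apply/funext => m; rewrite (h m I).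
    exact: ct.
  under eq_fun do rewrite -exprM; rewrite -exprM.
  exact: (continuous_cvg _ (@exprn_continuous R (r * 2) _) st).
- move=> m; set d := phi m.
  have E t : S d t ^+ r = \sum_(i <- tuples_below d r)
      (\prod_(j < r) dot x (e (tnth i j))) * \prod_(j < r) y t (tnth i j).
    rewrite (sum_expn_tuples d r (fun k => dot x (e k) * y t k)).
    by apply: eq_bigr => i _; rewrite big_split.
  under eq_integral do rewrite E.
  apply: le_trans (hC _ _ (tuples_below_uniq d r)) _.
  rewrite lee_fin ler_wpM2l//.
  have -> : \sum_(i <- tuples_below d r) (\prod_(j < r) dot x (e (tnth i j))) ^+ 2 =
      (\sum_(k < d) dot x (e k) ^+ 2) ^+ r.
    rewrite (sum_expn_tuples d r (fun k => dot x (e k) ^+ 2)).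
    by apply: eq_bigr => i _; rewrite prodrXl.
  rewrite lerXn2r ?nnegrE ?sqr_ge0 ?bessel_basis//.
  by apply: sumr_ge0 => k _; exact: sqr_ge0.
Qed.

End Evaluations.

(** * Bounded functionals on a Hilbert space with a basis *)

Section Riesz.
Context (R : realType) (H : completeNormedModType R) (dot : {dot H for idfun}) (e : nat -> H).
Context (hH : hilbert_norm dot) (he : orthonormal_basis dot e).

Lemma dot_CauchySchwarz (x z : H) : dot x z ^+ 2 <= `|x| ^+ 2 * `|z| ^+ 2.
Proof.
rewrite -!hH; apply: discriminant_le => a.
have := sqr_ge0 `|x + a *: z|.
rewrite -hH dotDl !dotDr !dotZl !dotZr (dotC _ z x); congr (_ <= _); ring.
Qed.

Definition bounded_functional (L : H -> R) : Prop :=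
  (forall a x z, L (a *: x + z) = a * L x + L z) /\
  exists2 M : R, 0 <= M & forall x, L x ^+ 2 <= M * `|x| ^+ 2.

Lemma bounded_functional_dot (z : H) : bounded_functional (fun x => dot x z).
Proof.
split; first by move=> a x x'; rewrite dotDl dotZl.
by exists (`|z| ^+ 2); [exact: sqr_ge0 | move=> x; rewrite mulrC dot_CauchySchwarz].
Qed.

Lemma bounded_functional_cvg (L : H -> R) (x_ : nat -> H) (x : H) : bounded_functional L ->
  x_ n @[n --> \oo] --> x -> L (x_ n) @[n --> \oo] --> L x.
Proof.
move=> [lin [M M0 hM]] xx; apply/cvgrPdist_lt => eps eps0.
pose S := Num.sqrt M + 1.
have S0 : 0 < S by rewrite ltr_wpDl// sqrtr_ge0.
have L_le z : `|L z| <= S * `|z|.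
  rewrite -(@ler_pXn2r _ 2)// ?nnegrE ?mulr_ge0 ?(ltW S0)//.
  rewrite real_normK ?num_real// exprMn; apply: le_trans (hM z) _.
  rewrite ler_wpM2r ?sqr_ge0// -[leLHS]sqr_sqrtr// lerXn2r ?nnegrE ?sqrtr_ge0 ?(ltW S0)//.
  by rewrite lerDl.
have := xx; move/cvgrPdist_lt => /(_ (eps / S)); rewrite divr_gt0// => /(_ isT).
apply: filterS => n xn.
have -> : L x - L (x_ n) = L (x - x_ n).
  by rewrite -(scaleN1r (x_ n)) [in RHS]addrC lin mulN1r addrC.
by apply: le_lt_trans (L_le _) _; rewrite mulrC -ltr_pdivlMr.
Qed.

Lemma bounded_functional_sum (L : H -> R) (I : Type) (s : seq I) (a : I -> R) (x : I -> H) :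
  bounded_functional L -> L (\sum_(i <- s) a i *: x i) = \sum_(i <- s) a i * L (x i).
Proof.
move=> [lin _]; elim: s => [|i s ih]; last by rewrite !big_cons lin ih.
by rewrite !big_nil; have := lin (-1) 0 0; rewrite scaler0 addr0; lra.
Qed.

Lemma sqr_norm_sum_basis (l : nat -> R) (m n : nat) :
  `|\sum_(m <= k < n) l k *: e k| ^+ 2 = \sum_(m <= k < n) l k ^+ 2.
Proof.
rewrite -hH dot_suml; apply: eq_big_nat => k /andP[mk kn].
rewrite dotZl dot_sumr (bigD1_seq k) ?mem_index_iota ?mk ?iota_uniq//= dotZr he.1 eqxx mulr1.
by rewrite big1 ?addr0 ?expr2// => i ik; rewrite dotZr he.1 eq_sym (negbTE ik) mulr0.
Qed.

(** The representing vector is [sum_k L(e_k) e_k]; testing [L] on the partial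
    sums bounds the coefficients in [l^2], so that the series is Cauchy. *)
Lemma riesz_representation (L : H -> R) : bounded_functional L -> exists v, forall x, dot v x = L x.
Proof.
move=> bL; have [lin [M M0 hM]] := bL; pose l k := L (e k).
pose v_ := series (fun k => l k *: e k).
have lM n : \sum_(0 <= k < n) l k ^+ 2 <= M.
  set S := \sum_(0 <= k < n) l k ^+ 2.
  have S0 : 0 <= S by apply: sumr_ge0 => i _; exact: sqr_ge0.
  have := hM (\sum_(0 <= k < n) l k *: e k).
  rewrite bounded_functional_sum// sqr_norm_sum_basis -/S.
  have [->//|Sn0] := eqVneq S 0.
  by rewrite expr2 ler_pM2r// lt_def Sn0.
have cl : cvgn (series (fun k => l k ^+ 2)).
  apply: nondecreasing_is_cvgn.
    by apply/nondecreasing_seqP => n; rewrite !seriesEnat/= big_nat_recr//= lerDl sqr_ge0.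
  by exists M => _ [n _ <-]; rewrite seriesEnat; exact: lM.
have cv : cvgn v_.
  apply/cauchy_cvgP/cauchy_seriesP => eps eps0.
  have /cauchy_cvgP/cauchy_seriesP/(_ (eps ^+ 2)) := cl; rewrite exprn_gt0// => /(_ isT).
  apply: filterS => n; rewrite -sqr_norm_sum_basis ger0_norm ?sqr_ge0// => h.
  by rewrite -(@ltr_pXn2r _ 2)// nnegrE// ltW.
exists (limn v_) => x.
have c1 := bounded_functional_cvg (bounded_functional_dot x) cv.
have c2 := bounded_functional_cvg bL (@cvg_basis_sum _ _ _ _ he x).
apply: (@cvg_unique _ (@norm_hausdorff R R^o) _ _ _ _ c1).
suff <- : (fun n => L (\sum_(i < n) dot x (e i) *: e i)) = (fun n => dot (v_ n) x) by exact: c2.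
apply/funext => n; rewrite bounded_functional_sum// /v_ seriesEord dot_suml.
by apply: eq_bigr => i _; rewrite dotZl mulrC (dotC _ x).
Qed.

Lemma dot_inj (v v' : H) : (forall x, dot v x = dot v' x) -> v = v'.
Proof.
move=> h; apply/eqP; rewrite -subr_eq0 -normr_eq0 -sqrf_eq0.
by rewrite -hH dotBl h subrr.
Qed.

End Riesz.

(** * The weak integral and its operator *)

Section WeakIntegralOperator.
Context (R : realType) (H : completeNormedModType R) (dot : {dot H for idfun}) (e : nat -> H).
Context (hH : hilbert_norm dot) (he : orthonormal_basis dot e).
Context (dT : measure_display) (T : measurableType dT) (mu nu : probability T R).
Context (Y : H -> L0 mu) (gY : generalized_function Y) (numu : nu `<< mu).
Local Notation y := (coordinates e Y).
Local Notation L2 := (Lfun nu 2%:E).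

Lemma evaluation_abs_moment (n : nat) : tensor_bounded nu y n ->
  forall x, ('E_nu[fun t => (`|Y x t| ^+ n)%R] < +oo)%E.
Proof.
move=> tb x; have [C C0 /(_ x) hC] := evaluation_moment_le hH he gY numu tb.
have mY : measurable_fun setT (L0_fun (Y x)) by exact: measurable_L0.
rewrite unlock; apply: (@le_lt_trans _ _ (\int[nu]_t (1 + (Y x t ^+ n ^+ 2)%:E))%E).
  apply: ge0_le_integral => //.
  - by apply/measurable_EFinP; apply: measurable_funX; exact: measurableT_comp.
  - apply: emeasurable_funD; first exact: measurable_cst.
    by apply/measurable_EFinP; apply: measurable_funX; exact: measurable_funX.
  - move=> t _; rewrite -EFinD lee_fin -normrX.
    have := sqr_ge0 (`|Y x t ^+ n| - 1); rewrite sqrrB1 real_normK ?num_real//.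
    by have := normr_ge0 (Y x t ^+ n); lra.
rewrite ge0_integralD//.
- rewrite -[X in (X + _)%E]/(\int[nu]_t (cst 1%E t))%E integral_cst// mul1e.
  rewrite [X in (X + _)%E]probability_setT lte_add_pinfty ?ltry//.
  by apply: le_lt_trans hC _; rewrite ltry.
- by move=> t _; rewrite lee_fin sqr_ge0.
- by apply/measurable_EFinP; apply: measurable_funX; exact: measurable_funX.
Qed.

Context (tb1 : tensor_bounded nu y 1).

Lemma evaluation_Lfun2 (x : H) : L0_fun (Y x) \in L2.
Proof.
have [C C0 /(_ x) hC] := evaluation_moment_le hH he gY numu tb1.
apply/Lfun2P; split; first exact: measurable_L0.
by apply: le_lt_trans hC _; rewrite ltry.
Qed.

Lemma evaluation_norm_le : exists2 C : R, 0 <= C &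
  forall x, L2dot nu (Y x) (Y x) <= C * `|x| ^+ 2.
Proof.
have [C C0 hC] := evaluation_moment_le hH he gY numu tb1.
exists C => // x; rewrite -lee_fin EFin_L2dot ?evaluation_Lfun2//.
exact: hC.
Qed.

Lemma evaluation_linear (a : R) (x z : H) :
  L0_fun (Y (a *: x + z)) = (fun t => a * Y x t + Y z t) %[ae nu].
Proof. exact: (ae_dominates numu (gY.1 a x z)). Qed.

Lemma L2dot_evaluation (f : T -> R) : f \in L2 ->
  bounded_functional (fun x => L2dot nu f (Y x)).
Proof.
move=> fL; split=> [a x z|].
  rewrite -L2dot_linr ?evaluation_Lfun2//.
  apply: L2dot_ae => //; rewrite ?evaluation_Lfun2//.
  - by apply: Lfun2_lin; exact: evaluation_Lfun2.
  - exact: ae_eq_refl.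
  - exact: evaluation_linear.
have [C C0 hC] := evaluation_norm_le.
exists (L2dot nu f f * C); first by rewrite mulr_ge0 ?L2dot_ge0.
move=> x; apply: le_trans (L2_CauchySchwarz fL (evaluation_Lfun2 x)) _.
by rewrite -mulrA ler_wpM2l ?L2dot_ge0.
Qed.

Local Notation wint f := (weak_integral dot Y nu f).

Lemma weak_integralP (f : T -> R) : f \in L2 ->
  weakly_integrable Y nu f /\ is_weak_integral dot Y nu f (wint f).
Proof.
move=> fL; split; first by move=> x; exact: Lfun2_mul_integrable fL (evaluation_Lfun2 x).
rewrite /weak_integral; apply: xgetPex.
have [v vE] := riesz_representation hH he (L2dot_evaluation fL).
by exists v => x; rewrite vE.
Qed.

Lemma dot_weak_integral (f : T -> R) (x : H) : f \in L2 -> dot (wint f) x = L2dot nu f (Y x).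
Proof. by move=> fL; exact: (weak_integralP fL).2. Qed.

Lemma weak_integral_linear (a : R) (f g : T -> R) : f \in L2 -> g \in L2 ->
  wint (fun t => a * f t + g t) = a *: wint f + wint g.
Proof.
move=> fL gL; apply: (dot_inj hH) => x.
rewrite dotDl dotZl !dot_weak_integral//; last exact: Lfun2_lin.
by rewrite L2dot_linl// evaluation_Lfun2.
Qed.

Lemma weak_integral_norm_le : exists2 C : R, 0 <= C &
  forall f, f \in L2 -> `|wint f| ^+ 2 <= C * L2dot nu f f.
Proof.
have [C C0 hC] := evaluation_norm_le; exists C => // f fL.
set N := `|_| ^+ 2; have N0 : 0 <= N by exact: sqr_ge0.
have := L2_CauchySchwarz fL (evaluation_Lfun2 (wint f)).
rewrite -dot_weak_integral// hH -/N => h.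
have [->|Nn0] := eqVneq N 0; first by rewrite mulr_ge0 ?L2dot_ge0.
rewrite -(@ler_pM2r _ N) ?lt_def ?Nn0// -expr2; apply: le_trans h _.
by rewrite (mulrC C) -mulrA ler_wpM2l ?L2dot_ge0//; exact: hC.
Qed.

(** The operator [f |-> <Y, int f Y>] of the quadratic form. *)
Definition covariance_operator (f : T -> R) : T -> R := L0_fun (Y (wint f)).

Lemma covariance_operatorE (f g : T -> R) : f \in L2 -> g \in L2 ->
  L2dot nu (covariance_operator f) g = dot (wint f) (wint g).
Proof. by move=> fL gL; rewrite L2dotC (dotC _ (wint f)) dot_weak_integral. Qed.

Lemma covariance_operator_bounded : L2_bounded_operator nu covariance_operator.
Proof.
split=> [f _|a f g fL gL|]; first exact: evaluation_Lfun2.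
  by rewrite /covariance_operator weak_integral_linear//; exact: evaluation_linear.
have [C C0 hC] := evaluation_norm_le; have [D D0 hD] := weak_integral_norm_le.
exists (C * D) => f fL; apply: le_trans (hC _) _.
by rewrite -mulrA ler_wpM2l// hD.
Qed.

Lemma covariance_operator_self_adjoint : L2_self_adjoint nu covariance_operator.
Proof.
by move=> f g fL gL; rewrite covariance_operatorE// L2dotC covariance_operatorE// dotC.
Qed.

Lemma covariance_operator_form (f : T -> R) : f \in L2 ->
  `|wint f| ^+ 2 = L2dot nu (covariance_operator f) f.
Proof. by move=> fL; rewrite covariance_operatorE// hH. Qed.

End WeakIntegralOperator.

(** * Orthonormal bases and the Hilbert-Schmidt property *)

Section OrthonormalBasis.
Context (R : realType) (d : measure_display) (T : measurableType d).
Context (nu : {measure set T -> \bar R}).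
Local Notation L2 := (Lfun nu 2%:E).

Lemma L2dot_eq0 (f : T -> R) : f \in L2 -> L2dot nu f f = 0 -> f = cst 0 %[ae nu].
Proof.
move=> fL f0; have mf := Lfun2_measurable fL.
have : (\int[nu]_t `|(f t * f t)%:E| = 0)%E.
  under eq_integral do rewrite gee0_abs ?lee_fin -?expr2 ?sqr_ge0// expr2.
  by rewrite -EFin_L2dot// f0.
have mff : measurable_fun setT (fun t => (f t * f t)%:E).
  by apply/measurable_EFinP; exact: measurable_funM.
move/(ae_eq_integral_abs nu measurableT mff); apply: filterS => t /[apply] -[] /eqP.
by rewrite mulf_eq0 orbb => /eqP.
Qed.

Definition L2_orthonormal (B : set (T -> R)) : Prop :=
  (forall f, B f -> f \in L2) /\ (forall f g, B f -> B g -> L2dot nu f g = (f == g)%:R).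

(** A maximal orthonormal set is a basis: a nonzero vector orthogonal to it
    could be normalized and added. *)
Lemma exists_L2_orthonormal_basis : exists B, L2_orthonormal_basis nu B.
Proof.
have [|B [[BL2 Bon] Bmax]] := @Zorn_bigcup _ L2_orthonormal.
  move=> F FP tot; split=> [f [X FX Xf]|f g [X FX Xf] [X' FX' X'g]].
    exact: (FP X FX).1.
  have [XX'|X'X] := tot X X' FX FX'.
    by apply: (FP X' FX').2 => //; exact: XX'.
  by apply: (FP X FX).2 => //; exact: X'X.
exists B; split => // f fL fB.
have [f0|fn0] := eqVneq (L2dot nu f f) 0; first exact: L2dot_eq0.
exfalso; pose N := L2dot nu f f; have N0 : 0 < N by rewrite lt_def fn0 L2dot_ge0.
pose c := (Num.sqrt N)^-1; pose g t := c * f t + 0.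
have gL : g \in L2 by apply: Lfun2_lin => //; exact: Lfun2_cst0.
have zL h : h \in L2 -> L2dot nu (fun=> 0) h = 0.
  by move=> hL; rewrite /L2dot; under eq_Rintegral do rewrite mul0r; rewrite /Rintegral integral0.
have gE h : h \in L2 -> L2dot nu g h = c * L2dot nu f h.
  by move=> hL; rewrite L2dot_linl ?zL ?addr0//; exact: Lfun2_cst0.
have gB b : B b -> L2dot nu g b = 0 by move=> Bb; rewrite gE ?fB ?mulr0//; exact: BL2.
have gg : L2dot nu g g = 1.
  rewrite gE// L2dotC gE// mulrA -/N -expr2 /c exprVn sqr_sqrtr ?(ltW N0)// mulVf// gt_eqF.
have gnB : ~ B g by move=> Bg; have := gB _ Bg; rewrite gg => /eqP; rewrite oner_eq0.
apply: (Bmax (B `|` [set g])).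
  by split=> [|h]; [exact: subsetUl | apply: gnB; apply: h; right].
split=> [h [/BL2//|->//]|h h' [Bh|->] [Bh'|->]].
- exact: Bon.
- rewrite L2dotC gB//; case: eqP => // hg; case: gnB; by rewrite -hg.
- rewrite gB//; case: eqP => // hg; case: gnB; by rewrite hg.
- by rewrite gg eqxx.
Qed.

End OrthonormalBasis.

Section PartialKernel.
Context (R : realType) (d : measure_display) (T : measurableType d) (nu : probability T R).
Context (y : T -> nat -> R) (my : forall k, measurable_fun setT (fun t => y t k)).
Local Notation L2 := (Lfun nu 2%:E).
Local Notation mono i := (fun t => \prod_(j < _) y t (tnth i j)).

Definition partial_kernel (n : nat) (z : T * T) : R := \sum_(k < n) y z.1 k * y z.2 k.

Lemma partial_kernel_expn (n r : nat) (z : T * T) :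
  partial_kernel n z ^+ r = \sum_(i <- tuples_below n r) mono i z.1 * mono i z.2.
Proof.
rewrite /partial_kernel (sum_expn_tuples n r (fun k => y z.1 k * y z.2 k)).
by apply: eq_bigr => i _; rewrite big_split.
Qed.

(** Bessel's inequality for the sections [s |-> sum_(k < n) y_k(t) y_k(s)],
    integrated over [t]. *)
Lemma partial_kernel_bessel (n : nat) (s : seq (T -> R)) :
  tensor_bounded nu y 1 -> tensor_bounded nu y 2 -> uniq s ->
  (forall b, b \in s -> b \in L2) ->
  (forall b c, b \in s -> c \in s -> L2dot nu b c = (b == c)%:R) ->
  \sum_(b <- s) \int[nu]_t (\sum_(k < n) L2dot nu b (fun t => y t k) * y t k) ^+ 2 <=
  \sum_(i <- tuples_below n 2) (\int[nu]_t mono i t) ^+ 2.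
Proof.
move=> tb1 tb2 us sL on.
have yL (k : 'I_n) : (fun t => y t k) \in L2.
  suff -> : (fun t => y t k) = mono [tuple val k] by exact: tensor_Lfun2.
  by apply/funext => t; rewrite big_ord_recl big_ord0 mulr1.
pose g b t := \sum_(k < n) L2dot nu b (fun t => y t k) * y t k.
have gL b : g b \in L2.
  exact: (@Lfun2_sum _ _ _ nu _ (index_enum 'I_n) (fun k : 'I_n => L2dot nu b (fun t => y t k))
    (fun (k : 'I_n) t => y t k) yL).
have ui t : (fun s => partial_kernel n (t, s)) \in L2.
  exact: (@Lfun2_sum _ _ _ nu _ (index_enum 'I_n) (fun k : 'I_n => y t k)
    (fun (k : 'I_n) t => y t k) yL).
have monoi (i : 2.-tuple nat) : nu.-integrable setT (EFin \o mono i).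
  have := Lfun2_mul_integrable (Lfun2_cst nu 1) (tensor_Lfun2 my tb2 i).
  by apply: eq_integrable => // t _; rewrite mul1r.
pose G t := \sum_(i <- tuples_below n 2) (\int[nu]_t mono i t) * mono i t.
have ptw t : \sum_(b <- s) g b t ^+ 2 <= G t.
  have -> : G t = L2dot nu (fun s => partial_kernel n (t, s)) (fun s => partial_kernel n (t, s)).
    rewrite /L2dot; under [RHS]eq_Rintegral do rewrite -expr2 partial_kernel_expn.
    rewrite Rintegral_sum/=; last by move=> i; apply: integrableRZ.
    by apply: eq_bigr => i _; rewrite RintegralZl// mulrC.
  apply: le_trans (L2_bessel us sL on (ui t)).
  rewrite le_eqVlt; apply/orP; left; apply/eqP/eq_big_seq => b bs; congr (_ ^+ 2).
  rewrite (@L2dot_suml _ _ _ nu _ (index_enum 'I_n) (fun k : 'I_n => y t k)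
    (fun (k : 'I_n) t => y t k))//; last exact: sL.
  by apply: eq_bigr => k _; rewrite mulrC (L2dotC _ b).
have g2i b : nu.-integrable setT (EFin \o (fun t => g b t ^+ 2)).
  have := Lfun2_mul_integrable (gL b) (gL b).
  by apply: eq_integrable => // t _; rewrite /= expr2.
rewrite -(Rintegral_sum _ (f := fun b t => g b t ^+ 2))//.
have -> : \sum_(i <- tuples_below n 2) (\int[nu]_t mono i t) ^+ 2 = \int[nu]_t G t.
  rewrite Rintegral_sum/=; last by move=> i; apply: integrableRZ.
  by apply: eq_bigr => i _; rewrite RintegralZl// expr2.
apply: le_Rintegral => //.
- exact: (integrableR_sum _ (f := fun b t => g b t ^+ 2)).
- by apply: (integrableR_sum _ (f := fun i t => (\int[nu]_t mono i t) * mono i t)) => i; exact: integrableRZ.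
Qed.

End PartialKernel.

Section HilbertSchmidtOperator.
Context (R : realType) (H : completeNormedModType R) (dot : {dot H for idfun}) (e : nat -> H).
Context (hH : hilbert_norm dot) (he : orthonormal_basis dot e).
Context (dT : measure_display) (T : measurableType dT) (mu nu : probability T R).
Context (Y : H -> L0 mu) (gY : generalized_function Y) (numu : nu `<< mu).
Local Notation y := (coordinates e Y).
Local Notation L2 := (Lfun nu 2%:E).
Context (tb1 : tensor_bounded nu y 1) (tb2 : tensor_bounded nu y 2).
Local Notation wint f := (weak_integral dot Y nu f).
Let YL := evaluation_Lfun2 hH he gY numu tb1.

(** Around [x], the form is a linear term plus a remainder of order
    [|x_n - x|^2]. *)
Lemma evaluation_quadratic_cvg (x_ : nat -> H) (x : H) : x_ n @[n --> \oo] --> x ->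
  L2dot nu (Y (x_ n)) (Y (x_ n)) @[n --> \oo] --> L2dot nu (Y x) (Y x).
Proof.
move=> xx; pose B u v := L2dot nu (Y u) (Y v).
have Bl u : bounded_functional (fun v => B u v) by exact: (L2dot_evaluation hH he gY numu tb1 (YL u)).
have BC u v : B u v = B v u by exact: L2dotC.
have BD u v : B (u - v) (u - v) = B u u - 2 * B v u + B v v.
  have lin w : B w (u - v) = B w u - B w v.
    by rewrite -(scaleN1r v) [in LHS]addrC (Bl w).1; ring.
  by rewrite lin !(BC (u - v)) !lin (BC u v); ring.
have E n : B (x_ n) (x_ n) = 2 * B x (x_ n) - B x x + B (x_ n - x) (x_ n - x).
  by rewrite BD; ring.
have -> : (fun n => L2dot nu (Y (x_ n)) (Y (x_ n))) =
    (fun n => 2 * B x (x_ n) - B x x + B (x_ n - x) (x_ n - x)).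
  by apply/funext => n; exact: E.
have -> : L2dot nu (Y x) (Y x) = 2 * B x x - B x x + 0 by rewrite -/(B x x); ring.
apply: cvgD; first apply: cvgB; last 2 first.
- exact: cvg_cst.
- have [C C0 hC] := evaluation_norm_le hH he gY numu tb1.
  have c0 : C * `|x_ n - x| ^+ 2 @[n --> \oo] --> (0 : R).
    have d0 : `|x_ n - x| @[n --> \oo] --> (0 : R).
      have := cvg_norm (cvgB xx (cvg_cst x)); rewrite subrr normr0; exact.
    rewrite -(mulr0 C); apply: cvgM; first exact: cvg_cst.
    by rewrite -(mulr0 0); under eq_fun do rewrite expr2; exact: cvgM.
  apply: (@squeeze_cvgr _ _ _ _ (fun=> 0) (fun n => C * `|x_ n - x| ^+ 2)) c0 => //; last exact: cvg_cst.
  by apply: nearW => n; rewrite L2dot_ge0 hC.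
- by apply: cvgM; [exact: cvg_cst | exact: bounded_functional_cvg (Bl x) xx].
Qed.

(** For finitely many basis vectors [b], [sum_b |A b|^2] is the limit of the sums
    in [partial_kernel_bessel], which the moment tensor of order 2 bounds. *)
Lemma covariance_operator_hilbert_schmidt :
  L2_hilbert_schmidt_operator nu (covariance_operator dot nu Y).
Proof.
have my k : measurable_fun setT (fun t => y t k) by exact: measurable_L0.
have [B BB] := exists_L2_orthonormal_basis nu; exists B => //.
have [BL2 Bon _] := BB.
have [C C0 hC] := tensor_moments_le my tb2.
apply: (@le_lt_trans _ _ C%:E); last by rewrite ltry.
apply: esum_le_uniq => s us sB; rewrite sumEFin lee_fin.
have sL b : b \in s -> b \in L2 by move=> /sB/BL2.
pose S b n := \sum_(k < n) dot (wint b) (e k) *: e k.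
have cv : (\sum_(b <- s) L2dot nu (Y (S b n)) (Y (S b n))) @[n --> \oo] -->
    \sum_(b <- s) L2dot nu (covariance_operator dot nu Y b) (covariance_operator dot nu Y b).
  by apply: cvg_big => [|b _]; [exact: add_continuous | apply: evaluation_quadratic_cvg; exact: cvg_basis_sum].
rewrite -(cvg_lim _ cv)//; apply: limr_le; first by apply/cvg_ex; eexists; exact: cv.
apply: nearW => n; apply: le_trans (hC _ (tuples_below_uniq n 2)).
apply: le_trans (partial_kernel_bessel my n tb1 tb2 us sL _); last by move=> b c /sB bB /sB cB; exact: Bon.
rewrite le_eqVlt; apply/orP; left; apply/eqP/eq_big_seq => b bs.
apply: Rintegral_ae_eq.
- by apply: measurable_funM; exact: measurable_L0.
- apply: measurable_funX; apply: measurable_sum => k.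
  by apply: measurable_funM => //; exact: measurable_cst.
apply: filterS (generalized_basis_sum dot e gY numu (wint b) n) => t /[apply] ->.
rewrite -expr2; congr (_ ^+ 2); apply: eq_bigr => k _; congr (_ * _).
by rewrite (dot_weak_integral hH he gY numu tb1)// sL.
Qed.

Lemma covariance_form_hilbert_schmidt :
  L2_hilbert_schmidt_form nu (fun f => `|wint f| ^+ 2).
Proof.
exists (covariance_operator dot nu Y); split.
- exact: (covariance_operator_bounded hH he gY numu tb1).
- exact: (covariance_operator_self_adjoint hH he gY numu tb1).
- exact: (covariance_operator_form hH he gY numu tb1).
- exact: covariance_operator_hilbert_schmidt.
Qed.

End HilbertSchmidtOperator.

(** * The kernel *)

Section KernelEstimates.
Context (R : realType) (d : measure_display) (T : measurableType d) (nu : probability T R).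
Context (y : T -> nat -> R) (my : forall k, measurable_fun setT (fun t => y t k)).
Local Notation mono i := (fun t => \prod_(j < _) y t (tnth i j)).
Local Notation Kn := (partial_kernel y).

Lemma measurable_partial_kernel (n : nat) : measurable_fun setT (Kn n).
Proof.
apply: measurable_sum => k; apply: measurable_funM.
  exact: (measurableT_comp (my k) (measurable_fst)).
exact: (measurableT_comp (my k) (measurable_snd)).
Qed.

Lemma tensor_integrable (r : nat) (i : r.-tuple nat) : tensor_bounded nu y r ->
  nu.-integrable setT (EFin \o mono i).
Proof.
move=> tb; have := Lfun2_mul_integrable (Lfun2_cst nu 1) (tensor_Lfun2 my tb i).
by apply: eq_integrable => // t _; rewrite mul1r.
Qed.

Lemma partial_kernel_moment (n r : nat) : tensor_bounded nu y r ->
  (nu \x nu)%E.-integrable setT (EFin \o (fun z => Kn n z ^+ r)) /\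
  \int[(nu \x nu)%E]_z (Kn n z ^+ r) = \sum_(i <- tuples_below n r) (\int[nu]_t mono i t) ^+ 2.
Proof.
move=> tb; have P i := integrable_prodM (tensor_integrable i tb) (tensor_integrable i tb).
rewrite (_ : (fun z => _) = (fun z => \sum_(i <- tuples_below n r) mono i z.1 * mono i z.2)); last first.
  by apply/funext => z; rewrite partial_kernel_expn.
split; first by apply: integrableR_sum => i; exact: (P i).1.
by rewrite Rintegral_sum => [|i]; [apply: eq_bigr => i _; rewrite (P i).2 expr2 | exact: (P i).1].
Qed.

Lemma partial_kernel_Lfun2 (n : nat) : tensor_bounded nu y 2 -> Kn n \in Lfun (nu \x nu)%E 2%:E.
Proof.
move=> tb; apply/Lfun2P; split; first exact: measurable_partial_kernel.
have [/integrableP[_ lt] _] := partial_kernel_moment n tb.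
by move: lt; under [in X in X -> _]eq_integral do rewrite /= ger0_norm ?sqr_ge0//.
Qed.

(** In [L^2(nu x nu)] the partial kernels have increasing squared norms, and
    [|K_m - K_n|^2 <= |K_m|^2 - |K_n|^2] for [n <= m]. *)
Lemma partial_kernel_diff (n m : nat) : tensor_bounded nu y 2 -> (n <= m)%N ->
  \int[(nu \x nu)%E]_z (Kn m z - Kn n z) ^+ 2 <=
  \int[(nu \x nu)%E]_z (Kn m z ^+ 2) - \int[(nu \x nu)%E]_z (Kn n z ^+ 2).
Proof.
move=> tb nm.
pose g k l := \int[nu]_t (y t k * y t l).
have P k l : (nu \x nu)%E.-integrable setT
      (EFin \o (fun z => (y z.1 k * y z.1 l) * (y z.2 k * y z.2 l))) /\
    \int[(nu \x nu)%E]_z ((y z.1 k * y z.1 l) * (y z.2 k * y z.2 l)) = g k l ^+ 2.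
  have yi : nu.-integrable setT (EFin \o (fun t => y t k * y t l)).
    have := tensor_integrable [tuple k; l] tb.
    by apply: eq_integrable => // t _; rewrite /= big_ord_recl big_ord1.
  by rewrite expr2; exact: integrable_prodM.
have KK p q z : Kn p z * Kn q z =
    \sum_(k < p) \sum_(l < q) (y z.1 k * y z.1 l) * (y z.2 k * y z.2 l).
  rewrite /partial_kernel big_distrl; apply: eq_bigr => k _; rewrite big_distrr.
  by apply: eq_bigr => l _ /=; rewrite mulrACA.
have C p q : \int[(nu \x nu)%E]_z (Kn p z * Kn q z) = \sum_(k < p) \sum_(l < q) g k l ^+ 2.
  under eq_Rintegral do rewrite KK.
  rewrite Rintegral_sum => [|k]; last by apply: integrableR_sum => l; exact: (P k l).1.
  apply: eq_bigr => k _; rewrite Rintegral_sum => [|l]; last exact: (P k l).1.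
  by apply: eq_bigr => l _; rewrite (P k l).2.
have KL := partial_kernel_Lfun2 _ tb.
have nmle : \int[(nu \x nu)%E]_z (Kn n z * Kn n z) <= \int[(nu \x nu)%E]_z (Kn m z * Kn n z).
  rewrite !C -!(big_mkord xpredT (fun k => \sum_(l < n) g k l ^+ 2)) (big_cat_nat (leq0n n) nm)/=.
  by rewrite lerDl; apply: sumr_ge0 => k _; apply: sumr_ge0 => l _; exact: sqr_ge0.
have -> : \int[(nu \x nu)%E]_z (Kn m z - Kn n z) ^+ 2 =
    L2dot (nu \x nu)%E (fun z => -1 * Kn n z + Kn m z) (fun z => -1 * Kn n z + Kn m z).
  by apply: eq_Rintegral => z _; ring.
have DL := Lfun2_lin (-1) (KL n) (KL m).
rewrite L2dot_linl// !L2dot_linr// (L2dotC _ (Kn n) (Kn m)).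
under [X in _ <= X - _]eq_Rintegral do rewrite expr2.
under [X in _ <= _ - X]eq_Rintegral do rewrite expr2.
move: nmle; rewrite -/(L2dot _ (Kn n) (Kn n)) -/(L2dot _ (Kn m) (Kn n)) -/(L2dot _ (Kn m) (Kn m)).
lra.
Qed.

End KernelEstimates.

Section KernelLimit.
Context (R : realType) (d : measure_display) (T : measurableType d) (nu : probability T R).
Context (y : T -> nat -> R) (my : forall k, measurable_fun setT (fun t => y t k)).
Context (tb2 : tensor_bounded nu y 2).
Local Notation Kn := (partial_kernel y).
Local Notation pp := (nu \x nu)%E.

Lemma partial_kernel_fast_subsequence : exists phi : nat -> nat,
  [/\ forall m, (m <= phi m)%N, forall m, (phi m <= phi m.+1)%N &
  forall m n, (phi m <= n)%N ->
    \int[pp]_z (Kn n z - Kn (phi m) z) ^+ 2 <= (4^-1) ^+ m].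
Proof.
pose ms n := \int[pp]_z (Kn n z ^+ 2).
have msd n m : (n <= m)%N -> ms n <= ms m.
  move=> nm; rewrite -subr_ge0; apply: le_trans (partial_kernel_diff my tb2 nm).
  by apply: Rintegral_ge0 => z _; exact: sqr_ge0.
have [C C0 hC] := tensor_moments_le my tb2.
have cms : cvgn ms.
  apply: nondecreasing_is_cvgn => //; exists C => _ [n _ <-].
  by rewrite /ms (partial_kernel_moment my n tb2).2 hC// tuples_below_uniq.
have msl n : ms n <= limn ms by exact: nondecreasing_cvgn_le.
have /choice[N hN] : forall m, exists n, limn ms - ms n <= (4^-1) ^+ m.
  move=> m; have q0 : 0 < (4^-1 : R) ^+ m by rewrite exprn_gt0// invr_gt0.
  move: (cms) => /cvgrPdist_le /(_ _ q0) [n _ hn]; exists n.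
  by apply: le_trans (ler_norm _) (hn n _) => /=.
(* [phi m] is at least [N m] and [m], and is nondecreasing in [m] *)
pose phi m := (\sum_(k < m.+1) (N k).+1)%N.
have Nphi m : (N m <= phi m)%N.
  by rewrite /phi big_ord_recr/=; apply: leq_trans (leq_addl _ _); exact: leqnSn.
have phiS m : (phi m <= phi m.+1)%N by rewrite [X in (_ <= X)%N]/phi big_ord_recr leq_addr.
exists phi; split=> // [m|m n mn].
  elim: m => // m ih; rewrite /phi big_ord_recr/=.
  by apply: (@leq_trans (phi m).+1); rewrite ?ltnS// -addn1 leq_add.
apply: le_trans (partial_kernel_diff my tb2 mn) _; apply: le_trans (hN m).
by apply: lerB; [exact: msl | exact/msd/Nphi].
Qed.

(** The increments have [L^1] norms bounded by a geometric sequence. *)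
Lemma partial_kernel_ae_cvg (phi : nat -> nat) : (forall m, (phi m <= phi m.+1)%N) ->
  (forall m n, (phi m <= n)%N -> \int[pp]_z (Kn n z - Kn (phi m) z) ^+ 2 <= (4^-1) ^+ m) ->
  {ae pp, forall z, cvgn (fun m => Kn (phi m) z)}.
Proof.
move=> phiS hphi; pose D m z := -1 * Kn (phi m) z + Kn (phi m.+1) z.
have KL n := partial_kernel_Lfun2 my n tb2.
have DL m : D m \in Lfun pp 2%:E by exact: Lfun2_lin.
have mD m := Lfun2_measurable (DL m).
have aL m : (fun z => `|D m z|) \in Lfun pp 2%:E.
  apply/Lfun2P; split; first exact: measurableT_comp.
  by have /Lfun2P[_] := DL m; under [in X in _ -> X]eq_integral do rewrite real_normK ?num_real//.
pose PP : probability (T * T)%type R := pp.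
have small m : (\int[pp]_z `|D m z|%:E <= ((2^-1) ^+ m)%:E)%E.
  have -> : (\int[pp]_z `|D m z|%:E = (L2dot pp (fun z => `|D m z|) (fun=> 1))%:E)%E.
    by rewrite EFin_L2dot//; [apply: eq_integral => z _; rewrite mulr1 | exact: (Lfun2_cst PP 1)].
  have h0 : 0 <= (2^-1 : R) ^+ m by rewrite exprn_ge0// invr_ge0.
  have i0 : 0 <= L2dot pp (fun z => `|D m z|) (fun=> 1).
    by apply: Rintegral_ge0 => z _; rewrite mulr1.
  rewrite lee_fin -(@ler_pXn2r _ 2)// ?nnegrE//.
  apply: le_trans (L2_CauchySchwarz (aL m) (Lfun2_cst PP 1)) _.
  have -> : L2dot pp (fun=> 1) (fun=> 1) = 1 :> R.
    by rewrite /L2dot; under eq_Rintegral do rewrite mulr1; exact: (Rintegral_probability_cst PP).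
  rewrite mulr1 exprAC (_ : 2^-1 ^+ 2 = 4^-1 :> R); last by field.
  apply: le_trans (hphi m _ (phiS m)); rewrite le_eqVlt; apply/orP; left; apply/eqP.
  by apply: eq_Rintegral => z _; rewrite -expr2 real_normK ?num_real// /D; ring.
have ma m : measurable_fun setT (fun z => `|D m z|) by exact: Lfun2_measurable (aL m).
apply: filterS (ae_cvg_series ma (fun m z => normr_ge0 _) small) => z.
move=> /(@normed_cvg _ R^o (fun m => D m z)) cv.
have -> : (fun m => Kn (phi m) z) = (fun m => Kn (phi 0%N) z + series (fun m => D m z) m).
  apply/funext => m; rewrite seriesEnat /=.
  under eq_bigr do rewrite /D mulN1r addrC.
  by rewrite (telescope_sumr (fun m => Kn (phi m) z))// addrC subrK.
by apply: is_cvgD => //; exact: is_cvg_cst.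
Qed.

(** The upper limit is measurable, defined everywhere, and as symmetric as the
    partial kernels. *)
Lemma exists_kernel : exists (phi : nat -> nat) (K : T * T -> R),
  [/\ forall m, (m <= phi m)%N, measurable_fun setT K, forall z, K z = K (z.2, z.1),
    {ae pp, forall z, Kn (phi m) z @[m --> \oo] --> K z} &
    forall m, (\int[pp]_z ((K z - Kn (phi m) z) ^+ 2)%:E <= ((4^-1) ^+ m)%:E)%E].
Proof.
have [phi [phile phiS hphi]] := partial_kernel_fast_subsequence.
have phimono m l : (phi m <= phi (l + m))%N.
  by elim: l => [//|l ih]; apply: leq_trans ih _; rewrite addSn.
pose K z := fine (limn_esup (fun m => (Kn (phi m) z)%:E)).
have mKn n : measurable_fun setT (Kn n) by exact: measurable_partial_kernel.
have mK : measurable_fun setT K.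
  apply: (measurableT_comp (@fine_measurable R setT measurableT)).
  by apply: measurable_fun_limn_esup => m; apply/measurable_EFinP.
have cvK : {ae pp, forall z, Kn (phi m) z @[m --> \oo] --> K z}.
  apply: filterS (partial_kernel_ae_cvg phiS hphi) => z cz.
  have cE : (Kn (phi m) z)%:E @[m --> \oo] --> (limn (fun m => Kn (phi m) z))%:E.
    exact: cvg_EFin_real.
  have [_ e] := cvg_limn_einf_sup cE.
  by rewrite /K e.
exists phi, K; split=> // [z|m].
  by congr (fine (limn_esup _)); apply/funext => m; congr (_%:E); apply: eq_bigr => k _; rewrite mulrC.
apply: (@fatou_le _ _ _ pp (fun l z => (Kn (phi (l + m)%N) z - Kn (phi m) z) ^+ 2)).
- by move=> l; apply: measurable_funX; exact: measurable_funB.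
- by move=> l z; exact: sqr_ge0.
- by apply: measurable_funX; exact: measurable_funB.
- apply: filterS cvK => z cz.
  have c1 : Kn (phi (l + m)%N) z - Kn (phi m) z @[l --> \oo] --> K z - Kn (phi m) z.
    apply: cvgB; last exact: cvg_cst.
    by rewrite -(@cvg_shiftn m) in cz.
  by under eq_fun do rewrite expr2; rewrite expr2; exact: cvgM.
- move=> l; rewrite -EFin_Rintegral ?lee_fin ?hphi//.
  have DL : (fun z => -1 * Kn (phi m) z + Kn (phi (l + m)%N) z) \in Lfun pp 2%:E.
    by apply: Lfun2_lin; exact: partial_kernel_Lfun2.
  have := Lfun2_mul_integrable DL DL.
  by apply: eq_integrable => // z _; congr (_%:E); ring.
Qed.

End KernelLimit.

Lemma tensor_product_Lfun2 (R : realType) (d : measure_display) (T : measurableType d)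
    (nu : probability T R) (f g : T -> R) :
  f \in Lfun nu 2%:E -> g \in Lfun nu 2%:E ->
  (fun z : T * T => f z.1 * g z.2) \in Lfun (nu \x nu)%E 2%:E.
Proof.
move=> fL gL; have mf := Lfun2_measurable fL; have mg := Lfun2_measurable gL.
apply/Lfun2P; split.
  by apply: measurable_funM; exact: measurableT_comp.
have sqi u : u \in Lfun nu 2%:E -> nu.-integrable setT (EFin \o (fun t => u t ^+ 2)).
  by move=> uL; have := Lfun2_mul_integrable uL uL; apply: eq_integrable => // t _; rewrite /= expr2.
have [/integrableP[_ lt] _] := integrable_prodM (sqi f fL) (sqi g gL).
apply: le_lt_trans lt; apply: ge0_le_integral => //.
- by move=> z _; rewrite lee_fin sqr_ge0.
- by apply/measurable_EFinP/measurable_funX/measurable_funM; exact: measurableT_comp.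
- apply: measurableT_comp => //; apply/measurable_EFinP.
  by apply: measurable_funM; apply: measurable_funX; exact: measurableT_comp.
- by move=> z _; rewrite lee_fin -exprMn ler_norm.
Qed.

Section KernelProperties.
Context (R : realType) (H : completeNormedModType R) (dot : {dot H for idfun}) (e : nat -> H).
Context (hH : hilbert_norm dot) (he : orthonormal_basis dot e).
Context (dT : measure_display) (T : measurableType dT) (mu nu : probability T R).
Context (Y : H -> L0 mu) (gY : generalized_function Y) (numu : nu `<< mu).
Local Notation y := (coordinates e Y).
Local Notation pp := (nu \x nu)%E.
Local Notation Kn := (partial_kernel y).
Context (tb1 : tensor_bounded nu y 1) (tb2 : tensor_bounded nu y 2).
Context (phi : nat -> nat) (K : T * T -> R).
Context (phile : forall m, (m <= phi m)%N) (mK : measurable_fun setT K).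
Context (cvK : {ae pp, forall z, Kn (phi m) z @[m --> \oo] --> K z}).
Context (nearK : forall m, (\int[pp]_z ((K z - Kn (phi m) z) ^+ 2)%:E <= ((4^-1) ^+ m)%:E)%E).
Let my k : measurable_fun setT (fun t => y t k).
Proof. exact: measurable_L0. Qed.

Lemma kernel_diff_Lfun2 (m : nat) : (fun z => K z - Kn (phi m) z) \in Lfun pp 2%:E.
Proof.
apply/Lfun2P; split; first by apply: measurable_funB => //; exact: measurable_partial_kernel.
by apply: le_lt_trans (nearK m) _; rewrite ltry.
Qed.

Lemma kernel_Lfun2 : K \in Lfun pp 2%:E.
Proof.
have -> : K = (fun z => 1 * (K z - Kn (phi 0%N) z) + Kn (phi 0%N) z).
  by apply/funext => z; ring.
by apply: Lfun2_lin; [exact: kernel_diff_Lfun2 | exact: partial_kernel_Lfun2].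
Qed.

(** By Fatou, [int K^(2n)] is at most the squared Hilbert-Schmidt norm of the
    moment tensor of order [2n]. *)
Lemma kernel_expn_integrable (n : nat) : tensor_bounded nu y (n * 2) ->
  pp.-integrable setT (fun z => (K z ^+ n)%:E).
Proof.
move=> tb; have [C C0 hC] := tensor_moments_le my tb.
pose PP : probability (T * T)%type R := pp.
have Kn_le : (\int[pp]_z (K z ^+ n ^+ 2)%:E <= C%:E)%E.
  apply: (@fatou_le _ _ _ pp (fun m z => Kn (phi m) z ^+ n ^+ 2)).
  - by move=> m; apply: measurable_funX; apply: measurable_funX; exact: measurable_partial_kernel.
  - by move=> m z; exact: sqr_ge0.
  - by apply: measurable_funX; exact: measurable_funX.
  - apply: filterS cvK => z cz.
    under eq_fun do rewrite -exprM; rewrite -exprM.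
    exact: (continuous_cvg _ (@exprn_continuous R (n * 2) _) cz).
  - move=> m; under eq_integral do rewrite -exprM.
    have [i E] := partial_kernel_moment my (phi m) tb.
    by rewrite -EFin_Rintegral// E lee_fin hC// tuples_below_uniq.
have L : (fun z => K z ^+ n) \in Lfun pp 2%:E.
  apply/Lfun2P; split; first exact: measurable_funX.
  by apply: le_lt_trans Kn_le _; rewrite ltry.
have := Lfun2_mul_integrable L (Lfun2_cst PP 1).
by apply: eq_integrable => // z _; rewrite mulr1.
Qed.

Local Notation wint f := (weak_integral dot Y nu f).

Lemma partial_kernel_form (f : T -> R) (n : nat) : f \in Lfun nu 2%:E ->
  L2dot pp (Kn n) (fun z => f z.1 * f z.2) = \sum_(k < n) dot (wint f) (e k) ^+ 2.
Proof.
move=> fL; have P (k : nat) := integrable_prodM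
  (Lfun2_mul_integrable fL (evaluation_Lfun2 hH he gY numu tb1 (e k)))
  (Lfun2_mul_integrable fL (evaluation_Lfun2 hH he gY numu tb1 (e k))).
rewrite /L2dot (_ : (fun z => _) = (fun z => \sum_(k < n) (f z.1 * Y (e k) z.1) * (f z.2 * Y (e k) z.2))).
  rewrite Rintegral_sum => [|k]; last exact: (P k).1.
  by apply: eq_bigr => k _; rewrite (P k).2 (dot_weak_integral hH he gY numu tb1)// expr2.
apply/funext => z; rewrite big_distrl; apply: eq_bigr => k _ /=.
by rewrite /coordinates; ring.
Qed.

(** For the partial kernels the form is [sum_(k < m) <int f Y, e_k>^2], and
    convergence in [L^2] lets the pairing with [f] tensor [f] pass to the
    limit. *)
Lemma kernel_represents_form : kernel_represents nu K (fun f => `|wint f| ^+ 2).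
Proof.
move=> f fL; have FL := tensor_product_Lfun2 fL fL; set F := fun z : T * T => _ in FL.
have -> : (\int[pp]_z (K z * f z.1 * f z.2)%:E = (L2dot pp K F)%:E)%E.
  rewrite EFin_L2dot//; last exact: kernel_Lfun2.
  by apply: eq_integral => z _; rewrite mulrA.
congr (_%:E).
have c1 : L2dot pp (Kn (phi m)) F @[m --> \oo] --> `|wint f| ^+ 2.
  have -> : (fun m => L2dot pp (Kn (phi m)) F) =
      (fun m => `|wint f| ^+ 2 - `|wint f - \sum_(k < phi m) dot (wint f) (e k) *: e k| ^+ 2).
    by apply/funext => m; rewrite (parseval_diff hH he) partial_kernel_form//; ring.
  rewrite -[X in _ --> X](subr0 (`|wint f| ^+ 2)); apply: cvgB; first exact: cvg_cst.
  have c0 : `|wint f - \sum_(k < n) dot (wint f) (e k) *: e k| @[n --> \oo] --> (0 : R).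
    have := cvg_norm (cvgB (cvg_cst (wint f)) (@cvg_basis_sum _ _ _ _ he (wint f))).
    by rewrite subrr normr0; exact.
  have phioo : phi m @[m --> \oo] --> \oo.
    by move=> A [N _ hN]; exists N => // m Nm; apply: hN => /=; exact: leq_trans Nm (phile m).
  have c2 : `|wint f - \sum_(k < phi m) dot (wint f) (e k) *: e k| @[m --> \oo] --> (0 : R).
    exact: (cvg_comp _ _ phioo c0).
  by rewrite -(mulr0 0); under eq_fun do rewrite expr2; exact: cvgM.
have c2 : L2dot pp (Kn (phi m)) F @[m --> \oo] --> L2dot pp K F.
  have E m : L2dot pp (fun z => K z - Kn (phi m) z) F = L2dot pp K F - L2dot pp (Kn (phi m)) F.
    have -> : (fun z => K z - Kn (phi m) z) = (fun z => -1 * Kn (phi m) z + K z).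
      by apply/funext => z; ring.
    by rewrite L2dot_linl ?kernel_Lfun2 ?partial_kernel_Lfun2//; ring.
  pose S := Num.sqrt (L2dot pp F F).
  have bnd m : `|L2dot pp K F - L2dot pp (Kn (phi m)) F| <= (2^-1) ^+ m * S.
    have h0 : 0 <= (2^-1 : R) ^+ m by rewrite exprn_ge0// invr_ge0.
    rewrite -(@ler_pXn2r _ 2)// ?nnegrE ?mulr_ge0 ?sqrtr_ge0//.
    rewrite real_normK ?num_real// -E exprMn sqr_sqrtr ?L2dot_ge0//.
    apply: le_trans (L2_CauchySchwarz (kernel_diff_Lfun2 m) FL) _.
    rewrite ler_wpM2r ?L2dot_ge0// -lee_fin EFin_L2dot ?kernel_diff_Lfun2//.
    rewrite exprAC (_ : 2^-1 ^+ 2 = 4^-1 :> R); last by field.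
    exact: nearK.
  have b0 : (2^-1) ^+ m * S @[m --> \oo] --> (0 : R).
    by rewrite -(mul0r S); apply: cvgM; [exact: geometric_half_cvg0 | exact: cvg_cst].
  apply/cvgrPdist_le => eps eps0; have /cvgrPdist_le /(_ eps eps0) := b0.
  apply: filterS => m; rewrite sub0r normrN; apply: le_trans.
  by apply: le_trans (bnd m) _; exact: ler_norm.
exact: (@cvg_unique _ (@norm_hausdorff R R^o) _ _ _ _ c1 c2).
Qed.

End KernelProperties.

(** * Uniqueness of the kernel *)

Lemma integral_swap (R : realType) (d : measure_display) (T : measurableType d)
    (nu : probability T R) (G : T * T -> R) :
  (nu \x nu)%E.-integrable setT (EFin \o G) ->
  \int[(nu \x nu)%E]_z G (z.2, z.1) = \int[(nu \x nu)%E]_z G z.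
Proof.
move=> Gi; have mG : measurable_fun setT (EFin \o G) by exact: measurable_int Gi.
have mH : measurable_fun setT (EFin \o (fun z : T * T => G (z.2, z.1))).
  exact: (measurableT_comp mG (measurable_fun_pair measurable_snd measurable_fst)).
have Hi : (nu \x nu)%E.-integrable setT (EFin \o (fun z : T * T => G (z.2, z.1))).
  by apply/(integrable12ltyP _ _ mH) => /=; have /(integrable21ltyP _ _ mG) := Gi.
by rewrite /Rintegral -(integral12_prod_meas1 Hi) -(integral21_prod_meas1 Gi).
Qed.

(** Sets over which the integral vanishes are stable under complement and
    disjoint countable union, and rectangles generate the product
    sigma-algebra. *)
Lemma rectangle_integral_eq0 (R : realType) (d1 : measure_display) (T1 : measurableType d1)
    (Q1 : probability T1 R) (d2 : measure_display) (T2 : measurableType d2) (Q2 : probability T2 R)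
    (f : T1 * T2 -> \bar R) :
  (Q1 \x Q2)%E.-integrable setT f ->
  (forall A B, measurable A -> measurable B -> \int[(Q1 \x Q2)%E]_(z in A `*` B) f z = 0)%E ->
  ae_eq (Q1 \x Q2)%E setT f (cst 0%E).
Proof.
move=> fi rect.
have all0 C : measurable C -> (\int[(Q1 \x Q2)%E]_(z in C) f z = 0)%E.
  pose rects : set (set (T1 * T2)) := [set A1 `*` A2 | A1 in measurable & A2 in measurable].
  have gen : @measurable _ (T1 * T2)%type = <<s rects >> by rewrite measurable_prod_measurableType.
  rewrite gen; move: C.
  apply: (@dynkin_induction _ _ rects (fun C => \int[(Q1 \x Q2)%E]_(z in C) f z = 0)%E) => //.
  - move=> _ _ [A1 mA1 [A2 mA2 <-]] [B1 mB1 [B2 mB2 <-]].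
    exists (A1 `&` B1); first exact: measurableI.
    by exists (A2 `&` B2); [exact: measurableI | rewrite setXI].
  - by rewrite -setXTT; exact: rect.
  - by move=> _ [A1 mA1 [A2 mA2 <-]]; exact: rect.
  - move=> S mS S0.
    have := rect setT setT measurableT measurableT; rewrite setXTT -(setUv S).
    rewrite integral_setU ?S0 ?add0e//; first exact: measurableC.
    - by rewrite setUv; exact: measurable_int fi.
    - by apply/eqP; rewrite setICr.
  - move=> F mF tF F0; rewrite integral_bigcup//; last first.
      by apply: (integrableS measurableT _ (subsetT _) fi); exact: bigcup_measurable.
    by apply: eseries0 => n _ _; exact: F0.
by apply: integral_ae_eq => // C _ mC; rewrite all0// integral0.
Qed.

(** Polarization: testing against [1_A + 1_B] and using the symmetry, a kernel
    with null quadratic form has null integral on every rectangle. *)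
Lemma symmetric_kernel_eq0 (R : realType) (d : measure_display) (T : measurableType d)
    (nu : probability T R) (J : T * T -> R) :
  L2_symmetric_kernel nu J ->
  (forall f, f \in Lfun nu 2%:E -> L2dot (nu \x nu)%E J (fun z => f z.1 * f z.2) = 0) ->
  J = cst 0 %[ae (nu \x nu)%E].
Proof.
move=> [JL Jsym] J0; pose PP : probability (T * T)%type R := (nu \x nu)%E.
have mJ := Lfun2_measurable JL.
have Ji : (nu \x nu)%E.-integrable setT (EFin \o J).
  have := Lfun2_mul_integrable JL (Lfun2_cst PP 1).
  by apply: eq_integrable => // z _; rewrite mulr1.
suff : ae_eq (nu \x nu)%E setT (EFin \o J) (cst 0%E).
  by apply: filterS => z /[apply] -[].
apply: rectangle_integral_eq0 => // A B mA mB.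
have indL (D : set T) : measurable D -> (\1_D : T -> R) \in Lfun nu 2%:E.
  move=> mD; have mi : measurable_fun setT (\1_D : T -> R) by exact: measurable_indic.
  apply/Lfun2P; split => //.
  apply: (@le_lt_trans _ _ (\int[nu]_t (cst 1 t))%E); last first.
    by rewrite integral_cst// [X in (_ * X)%E]probability_setT mule1 ltry.
  apply: ge0_le_integral => //.
  - by apply/measurable_EFinP; exact: measurable_funX.
  - by move=> t _; rewrite lee_fin indicE; case: (t \in D); rewrite ?expr1n ?expr0n.
have prodL (u v : T -> R) : u \in Lfun nu 2%:E -> v \in Lfun nu 2%:E ->
    (fun z : T * T => u z.1 * v z.2) \in Lfun (nu \x nu)%E 2%:E.
  exact: tensor_product_Lfun2.
pose Q (u v : T -> R) := L2dot (nu \x nu)%E J (fun z => u z.1 * v z.2).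
have swap u v : u \in Lfun nu 2%:E -> v \in Lfun nu 2%:E -> Q u v = Q v u.
  move=> uL vL; rewrite /Q /L2dot -integral_swap; last exact: Lfun2_mul_integrable JL (prodL _ _ uL vL).
  apply: Rintegral_ae_eq.
  - have mu' := Lfun2_measurable uL; have mv := Lfun2_measurable vL.
    apply: measurable_funM.
      exact: (measurableT_comp mJ (measurable_fun_pair measurable_snd measurable_fst)).
    by apply: measurable_funM; [exact: (measurableT_comp mu' measurable_snd) | exact: (measurableT_comp mv measurable_fst)].
  - by apply: measurable_funM => //; exact: Lfun2_measurable (prodL _ _ vL uL).
  - by apply: filterS Jsym => z /[apply] <- /=; rewrite [u _ * _]mulrC.
have AL := indL A mA; have BL := indL B mB.
have ABL := Lfun2_lin 1 AL BL.
have QAB : Q (\1_A) (\1_B) = 0.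
  have := J0 _ ABL; rewrite -/(Q _ _).
  have -> : L2dot (nu \x nu)%E J (fun z => (1 * \1_A z.1 + \1_B z.1) * (1 * \1_A z.2 + \1_B z.2)) =
      Q (\1_A) (\1_A) + Q (\1_A) (\1_B) + Q (\1_B) (\1_A) + Q (\1_B) (\1_B).
    have E : (fun z : T * T => (1 * \1_A z.1 + \1_B z.1) * (1 * \1_A z.2 + \1_B z.2)) =
      (fun z => 1 * (\1_A z.1 * \1_A z.2) + (1 * (\1_A z.1 * \1_B z.2) +
        (1 * (\1_B z.1 * \1_A z.2) + \1_B z.1 * \1_B z.2))) :> (T * T -> R).
      by apply/funext => z; ring.
    rewrite E !L2dot_linr ?prodL//; first by rewrite /Q; ring.
      by apply: Lfun2_lin; exact: prodL.
    by apply: Lfun2_lin; [exact: prodL | apply: Lfun2_lin; exact: prodL].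
  by rewrite [Q (\1_A) (\1_A)]J0// [Q (\1_B) (\1_B)]J0// (swap _ _ BL AL) => h; lra.
transitivity ((Q (\1_A) (\1_B))%:E); last by rewrite QAB.
rewrite /Q EFin_L2dot ?prodL// [LHS]integral_mkcond.
have hz z : ((EFin \o J) \_ (A `*` B)) z = (J z * (\1_A z.1 * \1_B z.2))%:E.
  rewrite patchE /= !indicE in_setX; case: (z.1 \in A); case: (z.2 \in B) => /=;
  by rewrite ?mulr1 ?mulr0 ?mul0r.
by apply: eq_integral => z _; rewrite hz.
Qed.

Lemma kernel_unique (R : realType) (d : measure_display) (T : measurableType d)
    (nu : probability T R) (q : (T -> R) -> R) (K K' : T * T -> R) :
  L2_symmetric_kernel nu K -> L2_symmetric_kernel nu K' ->
  kernel_represents nu K q -> kernel_represents nu K' q -> K' = K %[ae (nu \x nu)%E].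
Proof.
move=> [KL Ks] [K'L K's] hK hK'.
have JL := Lfun2_lin (-1) KL K'L.
suff : (fun z => -1 * K z + K' z) = cst 0 %[ae (nu \x nu)%E].
  by apply: filterS => z /[apply] /= h; lra.
apply: symmetric_kernel_eq0; first split=> //.
  by apply: filterS2 Ks K's => z /= Kz K'z _; rewrite (Kz I) (K'z I).
move=> f fL; have FL := tensor_product_Lfun2 fL fL.
rewrite L2dot_linl//; apply/eqP; rewrite mulN1r addrC subr_eq0; apply/eqP.
apply: EFin_inj; rewrite !EFin_L2dot//.
transitivity ((q f)%:E); [rewrite hK'// | rewrite hK//]; apply: eq_integral => z _; by rewrite mulrA.
Qed.

(** * Existence of the measure and of its kernel *)

Theorem corollary20
    (R : realType)
    (H : completeNormedModType R) (dot : {dot H for idfun}) (e : nat -> H)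
    (dW : measure_display) (W : measurableType dW) (P : probability W R)
    (X : H -> L0 P)
    (dT : measure_display) (T : measurableType dT) (mu : probability T R)
    (Y : H -> L0 mu)
    (hH : hilbert_norm dot) (he : orthonormal_basis dot e)
    (hP : standard_probability P) (hX : standard_gaussian X)
    (hmu : standard_probability mu) (hY : randomized_shift e X Y)
    (n : nat) :
  exists mu' : probability T R,
    (mu' `<< mu /\ mu `<< mu') /\
    (forall x : H, ('E_mu'[fun t => (`|Y x t| ^+ n)%R] < +oo)%E) /\
    hilbert_schmidt_moment Y mu' e n /\
    (forall f : T -> R, f \in Lfun mu' 2%:E ->
       weakly_integrable Y mu' f /\
       is_weak_integral dot Y mu' f (weak_integral dot Y mu' f)) /\
    L2_hilbert_schmidt_form mu'
      (fun f => `|weak_integral dot Y mu' f| ^+ 2) /\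
    exists K : T * T -> R,
      [/\ L2_symmetric_kernel mu' K,
          kernel_represents mu' K (fun f => `|weak_integral dot Y mu' f| ^+ 2),
          (forall K' : T * T -> R,
             L2_symmetric_kernel mu' K' ->
             kernel_represents mu' K'
               (fun f => `|weak_integral dot Y mu' f| ^+ 2) ->
             K' = K %[ae (mu' \x mu')%E])
        & (mu' \x mu')%E.-integrable setT (fun z => (K z ^+ n)%:E)].
Proof.
have gY : generalized_function Y by case: hY.
(* the orders 1, 2, [n] and [2n] are used *)
have [nu [numu munu tb]] := exists_tensor_bounded (n * 2).+2 hH he hX hY.
have tb1 : tensor_bounded nu (coordinates e Y) 1 by exact: tb.
have tb2 : tensor_bounded nu (coordinates e Y) 2 by exact: tb.
have tbn : tensor_bounded nu (coordinates e Y) n.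
  by apply: tb; do 2 apply: leqW; rewrite leq_pmulr.
have tb2n : tensor_bounded nu (coordinates e Y) (n * 2) by apply: tb; do 2 apply: leqW.
exists nu; split; first by split.
split; first exact: (evaluation_abs_moment hH he gY numu tbn).
split; first exact: tensor_bounded_hilbert_schmidt tbn.
split; first by move=> f fL; exact: (weak_integralP hH he gY numu tb1).
split; first exact: (covariance_form_hilbert_schmidt hH he gY numu tb1 tb2).
have my k : measurable_fun setT (fun t => coordinates e Y t k) by exact: measurable_L0.
have [phi [K [phile mK Ksym cvK nearK]]] := exists_kernel my tb2.
have KS : L2_symmetric_kernel nu K.
  by split; [exact: (kernel_Lfun2 tb2 mK nearK) | apply: nearW => z _; exact: Ksym].
have Kq := kernel_represents_form hH he gY numu tb1 tb2 phile mK nearK.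
exists K; split => //.
- by move=> K' K'S K'q; exact: kernel_unique KS K'S Kq K'q.
- exact: (kernel_expn_integrable mK cvK tb2n).
Qed.
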